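(* Let $\Sigma$ be a smooth compact torus, $0<T\le\infty$, and let $F\colon[0,T)\times\Sigma\to\mathbb S^3$ be a smooth solution of the Möbius-invariant Willmore flow (MIWF) with $F_t=F(t,\cdot)$, area measures $\mu_t$, image measures $\lambda_t=(F_t)_\#\mu_t$ on $\mathbb S^3$, $W(t)=\mathcal W(F_t)$, $W_0=W(0)$. Assume $\inf_{0<t<T}\min_{x\in\Sigma}|A_t^0(x)|^2\geq c_0>0$. Then for every $0<s<t<T$ and every $\varphi\in C^1(\mathbb S^3)$ $$\left|\int_{\mathbb S^3}\varphi\,\mathrm d\lambda_t-\int_{\mathbb S^3}\varphi\,\mathrm d\lambda_s\right|\leq\frac{2\sqrt{W_0}}{c_0}\,\lVert\varphi\rVert_{C^1(\mathbb S^3)}\sqrt{(t-s)\bigl(W(s)-W(t)\bigr)} .$$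
   Context: $\mathbb S^3\subset\mathbb R^4$ is the unit sphere with round metric $g_{\mathbb S^3}$. For a smooth immersion $F_t\colon\Sigma\to\mathbb S^3$: $g_t:=F_t^*g_{\mathbb S^3}$, $\mu_t$ is its area measure, and $A_t,A_t^0,H_t$ are the second fundamental form, its trace-free part, and the trace mean-curvature vector of $F_t$ in $\mathbb S^3$; norms are with respect to $g_t$ and $g_{\mathbb S^3}$. $\mathcal W(F_t)=\int_\Sigma(1+\frac14|H_t|^2)\,\mathrm d\mu_t$. The $L^2$-gradient $G_t$ is the normal field with $D\mathcal W(F_t)[\phi]=\int_\Sigma\langle G_t,\phi\rangle\,\mathrm d\mu_t$ for all smooth normal fields $\phi$. A smooth MIWF is a smooth family of umbilic-free immersions satisfying $\partial_tF_t=-|A_t^0|^{-4}G_t$. Push-forward: $(f_\#\eta)(B)=\eta(f^{-1}(B))$. Norm: $\lVert\varphi\rVert_{C^1(\mathbb S^3)}:=\lVert\varphi\rVert_{L^\infty(\mathbb S^3)}+\lVert\nabla^{\mathbb S^3}\varphi\rVert_{L^\infty(\mathbb S^3)}$, with $\nabla^{\mathbb S^3}$ the spherical gradient. *)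

(* Defs.v *)
From HB Require Import structures.
From mathcomp Require Import all_boot all_order all_algebra.
From mathcomp Require Import all_classical all_reals all_analysis.

Set Implicit Arguments.
Unset Strict Implicit.
Unset Printing Implicit Defensive.

Import Order.TTheory GRing.Theory Num.Theory.
Import numFieldNormedType.Exports.

Local Open Scope classical_set_scope.
Local Open Scope ring_scope.

Section smooth.
Context (R : realType) (V W : normedModType R).

Fixpoint iter_derive (vs : seq V) (f : V -> W) : V -> W :=
  if vs is v :: vs' then 'D_v (iter_derive vs' f) else f.

(* On a finite-dimensional V this is C^oo on the open set U: all iterated
   directional derivatives exist and are continuous at every point of U. *)
Definition smooth_open (U : set V) (f : V -> W) :=
  forall (vs : seq V) (x : V), U x ->
    {for x, continuous (iter_derive vs f)} /\
    forall v, derivable (iter_derive vs f) x v.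

(* Smoothness on an arbitrary subset A: local smooth extensions exist. *)
Definition smooth_on (A : set V) (f : V -> W) :=
  forall x, A x -> exists U g,
    [/\ open U, U x, smooth_open U g & forall y, U y -> A y -> f y = g y].

End smooth.

Section euclidean.
Context (R : realType).
Implicit Types (u v : 'rV[R]_4).

(* The library norm on 'rV[R]_4 is the sup norm. *)
Definition dot u v : R := \sum_(i < 4) u 0 i * v 0 i.
Definition enorm u : R := Num.sqrt (dot u u).

Definition S3 : set 'rV[R]_4 := [set p | dot p p = 1].

(* Nearest-point projection of R^4 \ {0} onto S^3. *)
Definition to_S3 u : 'rV[R]_4 := (enorm u)^-1 *: u.

End euclidean.
Arguments S3 {R}.

(* Functions on S^3 are represented by functions on R^4, of which only the values
   on S3 are used: they enter through their 0-homogeneous extension off S3. *)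
Section C1_sphere.
Context (R : realType).
Implicit Types (phi : 'rV[R]_4 -> R) (p : 'rV[R]_4).

Definition homog_ext phi : 'rV[R]_4 -> R := phi \o @to_S3 R.

Definition C1_S3 phi :=
  forall p v, p != 0 ->
    derivable (homog_ext phi) p v /\ {for p, continuous ('D_v (homog_ext phi))}.

(* At p in S3 the Euclidean gradient of the 0-homogeneous extension is
   orthogonal to p; it is the gradient of phi for the round metric. *)
Definition grad_S3 phi p : 'rV[R]_4 :=
  \row_i 'D_(delta_mx 0 i) (homog_ext phi) p.

Definition C1_norm phi : R :=
  sup [set `|phi p| | p in S3] + sup [set enorm (grad_S3 phi p) | p in S3].

End C1_sphere.

(* A smooth compact torus, presented through a diffeomorphism R^2/Z^2 -> Sigma:
   the covering map is invariant exactly under Z^2, and the topology and the smooth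
   structure of Sigma are those making it a local diffeomorphism. *)
Record smooth_torus (R : realType) := SmoothTorus {
  torus_sort :> Type;
  torus_cover : R * R -> torus_sort;
  torus_cover_surj : forall x, exists u, torus_cover u = x;
  torus_cover_eq : forall u v, torus_cover u = torus_cover v <->
    exists m n : int, v = (u.1 + m%:~R, u.2 + n%:~R)
}.
Arguments torus_cover {R} _ _.

HB.instance Definition _ (R : realType) (Sigma : smooth_torus R) :=
  gen_eqMixin (torus_sort Sigma).
HB.instance Definition _ (R : realType) (Sigma : smooth_torus R) :=
  gen_choiceMixin (torus_sort Sigma).
HB.instance Definition _ (R : realType) (Sigma : smooth_torus R) :=
  isPointed.Build (torus_sort Sigma) (torus_cover Sigma (0, 0)).

Section torus_measurable.
Context (R : realType) (Sigma : smooth_torus R).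

(* The Borel sets of the quotient topology: the covering map is a Borel
   isomorphism from the fundamental domain [0, 1[ x [0, 1[ onto Sigma. *)
Definition torus_measurable : set (set Sigma) :=
  [set B | measurable (torus_cover Sigma @^-1` B
              : set (measurableTypeR R * measurableTypeR R)%type)].

Lemma torus_measurable0 : torus_measurable set0.
Proof. by rewrite /torus_measurable /= preimage_set0. Qed.

Lemma torus_measurableC B : torus_measurable B -> torus_measurable (~` B).
Proof. by rewrite /torus_measurable /= -preimage_setC; exact: measurableC. Qed.

Lemma torus_measurable_bigcup (B : (set Sigma)^nat) :
  (forall i, torus_measurable (B i)) -> torus_measurable (\bigcup_i B i).
Proof.
by move=> mB; rewrite /torus_measurable /= preimage_bigcup;
   exact: bigcupT_measurable.
Qed.

HB.instance Definition _ := @isMeasurable.Build default_measure_display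
  (torus_sort Sigma) torus_measurable
  torus_measurable0 torus_measurableC torus_measurable_bigcup.

Definition torus_lift (x : Sigma) : R * R := projT1 (cid (torus_cover_surj x)).

End torus_measurable.

(* Local geometry in S^3 of a map f : R^2 -> S^3, at a parameter u. *)
Section local_geometry.
Context (R : realType) (f : R * R -> 'rV[R]_4) (u : R * R).

Definition coord_dir (i : 'I_2) : R * R := if i == 0 then (1, 0) else (0, 1).

Definition partial (i : 'I_2) (h : R * R -> 'rV[R]_4) : R * R -> 'rV[R]_4 :=
  'D_(coord_dir i) h.

Definition metric : 'M[R]_2 :=
  \matrix_(i, j) dot (partial i f u) (partial j f u).

Definition inv_metric : 'M[R]_2 := invmx metric.

Definition area_density : R := Num.sqrt (\det metric).

(* Orthogonal projection onto the normal space of f inside T_{f u} S^3. *)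
Definition normal_part (v : 'rV[R]_4) : 'rV[R]_4 :=
  v - dot v (f u) *: f u
    - \sum_(k < 2) \sum_(l < 2)
        (inv_metric k l * dot v (partial k f u)) *: partial l f u.

Definition second_ff (i j : 'I_2) : 'rV[R]_4 :=
  normal_part (partial i (partial j f) u).

Definition mean_curv : 'rV[R]_4 :=
  \sum_(i < 2) \sum_(j < 2) inv_metric i j *: second_ff i j.

Definition tracefree_ff (i j : 'I_2) : 'rV[R]_4 :=
  second_ff i j - (2^-1 * metric i j) *: mean_curv.

Definition tracefree_ff_sqnorm : R :=
  \sum_(i < 2) \sum_(j < 2) \sum_(k < 2) \sum_(l < 2)
    inv_metric i k * inv_metric j l * dot (tracefree_ff i j) (tracefree_ff k l).

End local_geometry.

Section surfaces.
Context (R : realType) (Sigma : smooth_torus R).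
Implicit Types (f phi G : Sigma -> 'rV[R]_4) (x : Sigma).

Definition periodic_lift f : R * R -> 'rV[R]_4 := f \o torus_cover Sigma.

Definition smooth_map f := smooth_open setT (periodic_lift f).

Definition immersion f :=
  [/\ smooth_map f, forall x, S3 (f x) &
      forall u v, 'D_v (periodic_lift f) u = 0 -> v = 0].

(* |H|^2 and |A^0|^2; for an immersion they do not depend on the chosen lift. *)
Definition H_sq f x : R :=
  let H := mean_curv (periodic_lift f) (torus_lift x) in dot H H.
Definition A0_sq f x : R :=
  tracefree_ff_sqnorm (periodic_lift f) (torus_lift x).

Definition umbilic_free f := forall x, A0_sq f x != 0.

Definition area_measure f (B : set Sigma) : \bar R :=
  (\int[lebesgue_measure \x lebesgue_measure]_
     (u in (`[0%R, 1%R[ `*` `[0%R, 1%R[) `&` torus_cover Sigma @^-1` B)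
     (area_density (periodic_lift f) u)%:E)%E.

Definition surface_int f (h : Sigma -> R) : R :=
  fine (\int[area_measure f]_x (h x)%:E)%E.

Definition willmore f : R := surface_int f (fun x => 1 + 4^-1 * H_sq f x).

Definition normal_field f phi :=
  smooth_map phi /\ forall u,
    dot (phi (torus_cover Sigma u)) (f (torus_cover Sigma u)) = 0 /\
    forall v, dot (phi (torus_cover Sigma u)) ('D_v (periodic_lift f) u) = 0.

(* The variation of f through maps into S^3 with initial velocity phi. *)
Definition variation f phi (e : R) : Sigma -> 'rV[R]_4 :=
  fun x => to_S3 (f x + e *: phi x).

Definition L2_gradient f G :=
  normal_field f G /\
  forall phi, normal_field f phi ->
    is_derive (0 : R) (1 : R) (fun e : R => willmore (variation f phi e))
      (surface_int f (fun x => dot (G x) (phi x))).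

(* The time derivative is one-sided at t = 0. *)
Definition time_derivative (F : R -> Sigma -> 'rV[R]_4) (t : R) x (v : 'rV[R]_4) :=
  h^-1 *: (F (t + h) x - F t x) @[h --> within [set h | 0 <= t + h] 0^'] --> v.

Definition MIWF (T : \bar R) (F : R -> Sigma -> 'rV[R]_4) :=
  [/\ smooth_on [set p : R * (R * R) | 0 <= p.1 /\ (p.1%:E < T)%E]
        (fun p : R * (R * R) => F p.1 (torus_cover Sigma p.2)),
      forall t, 0 <= t -> (t%:E < T)%E -> immersion (F t) /\ umbilic_free (F t) &
      exists G : R -> Sigma -> 'rV[R]_4, forall t, 0 <= t -> (t%:E < T)%E ->
        L2_gradient (F t) (G t) /\
        forall x, time_derivative F t x (- (A0_sq (F t) x ^- 2 *: G t x))].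

(* lambda = f_# mu, a Borel measure on R^4 carried by S^3. *)
Definition image_measure f : set (g_sigma_algebraType (@open 'rV[R]_4)) -> \bar R :=
  pushforward (area_measure f)
    (f : Sigma -> g_sigma_algebraType (@open 'rV[R]_4)).

Definition sphere_int f (phi : 'rV[R]_4 -> R) : R :=
  fine (\int[image_measure f]_(p in S3) (phi p)%:E)%E.

End surfaces.

(* Main.v *)
Require Import Defs.
From HB Require Import structures.
From mathcomp Require Import all_boot all_order all_algebra.
From mathcomp Require Import all_classical all_reals all_analysis.
From mathcomp Require Import measurable_realfun ring lra.
Set Implicit Arguments.
Unset Strict Implicit.
Unset Printing Implicit Defensive.
Import Order.TTheory GRing.Theory Num.Theory.
Import numFieldNormedType.Exports.
Local Open Scope classical_set_scope.
Local Open Scope ring_scope.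

(** Let V be the velocity of the flow at some time; it equals - |A0|^-4 G, so it is
    normal to the surface and G = - |A0|^4 V.  Two rates are compared.

    The energy W decreases at the rate W' = int <G, V> = - int |A0|^4 |V|^2, hence
    c0^2 int |V|^2 <= - W'.  The integral I of a test function phi against the image
    measure moves at the rate I' = int (<grad phi, V> - phi <H, V>), because the area
    element of a surface moving with normal velocity V changes at the rate - <H, V>
    (area_density_expansion).  By Young's inequality (young_integrand) the integrand
    is at most |phi|_C1 (eta (1 + |H|^2 / 4) + |V|^2 / eta) for every eta > 0, so
    |I'| <= |phi|_C1 (eta W0 - W' / (c0^2 eta))   (sphere_rate_le).
    Therefore |phi|_C1 (eta W0 t - W(t) / (c0^2 eta)) + I(t) and the same
    expression with - I(t) are nondecreasing in t; comparing their values at s and t and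
    choosing the best eta gives the estimate (dissipation_estimate).  This takes the
    place of integrating I' in time and applying the Cauchy-Schwarz inequality.

    What has to be justified are the two rates.  The gradient G controls the energy
    along the variation to_S3 (f + h V), while the flow is another family of maps with
    the same initial velocity V.  Both are smooth families, so by the symmetry of mixed
    derivatives (Ck_schwarz) their derivatives of order at most two in space have the
    same expansion d f + h d V + o(h), locally uniformly (vcong_family, vcong_family1,
    vcong_family2).  The relation cong, equality up to o(h) together with a common
    limit, is stable under sums, products, inverses and square roots, so it passes to
    the Willmore integrand (cong_willmore_density); compactness of the unit square makes
    it uniform (uniform_near), and the two energies differ by o(h)
    (willmore_variation_small_diff).  The same calculus of expansions gives the rate of
    I (sphere_expansion), and no derivative is ever taken under an integral sign.

    At time 0 the flow is only known on one side.  All expansions are therefore taken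
    along admissible times, and at time 0 they yield the right-continuity of W, which
    is all that W(s) <= W(0) requires (willmore_le0).

    Integrals over the torus and over the image measure are reduced to integrals over
    the unit square by integral_pushforward_density. *)

(** * Functions of class C^k and symmetry of second derivatives *)

Section line.
Context (R : realType) (V W : normedModType R).

Lemma is_derive_line (f : V -> W) (x v : V) (t : R) d :
  is_derive (t *: v + x) v f d ->
  is_derive t (1 : R) (fun s : R => f (s *: v + x)) d.
Proof.
case=> df dE; rewrite /derivable in df; rewrite /derive in dE.
have E : (fun h : R => h^-1 *: (((fun s : R => f (s *: v + x)) \o shift t) h%:A
            - f (t *: v + x))) =
         (fun h => h^-1 *: ((f \o shift (t *: v + x)) (h *: v) - f (t *: v + x))).
  apply/funext => h /=; congr (_ *: (f _ - _)).
  by rewrite scalerDl -addrA [h%:A]mulr1.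
by apply: DeriveDef; rewrite /derivable /derive /= E.
Qed.

Lemma derivable_line0 (f : V -> W) (x v : V) :
  derivable (fun s : R => f (s *: v + x)) 0 (1 : R) -> derivable f x v.
Proof.
rewrite /derivable /= => H.
have E : (fun h : R => h^-1 *: (((fun s : R => f (s *: v + x)) \o shift (0:R)) h%:A
            - f (0 *: v + x))) =
         (fun h => h^-1 *: ((f \o shift x) (h *: v) - f x)).
  apply/funext => h /=; rewrite scale0r add0r addr0; congr (_ *: (f _ - _)).
  by rewrite [h%:A]mulr1.
by rewrite -E.
Qed.

Lemma is_derive_line0 (f : V -> W) (x v : V) d :
  is_derive 0 (1 : R) (fun s : R => f (s *: v + x)) d -> is_derive x v f d.
Proof.
move=> [H dE]; constructor; [exact: (@derivable_line0 f x v H)|].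
rewrite -dE /derive; f_equal; f_equal.
apply/funext => h /=; rewrite scale0r add0r addr0; congr (_ *: (f _ - _)).
by rewrite [h%:A]mulr1.
Qed.

End line.

Lemma ler_dist_half (R : realFieldType) (a b c e : R) :
  `|a - c| <= e / 2 -> `|b - c| <= e / 2 -> `|a - b| <= e.
Proof. by rewrite !ler_norml => /andP[? ?] /andP[? ?]; apply/andP; split; lra. Qed.

Section balls.
Context (R : realType) (V : normedModType R).

Lemma nbhs_ex_norm (x : V) (P : set V) : nbhs x P ->
  exists2 r : R, 0 < r & forall y : V, `|x - y| < r -> P y.
Proof.
move=> /nbhs_ballP[r /= r0 Hr]; exists r => // y xy.
by apply: Hr; rewrite -ball_normE.
Qed.

Lemma continuous_ex_norm (f : V -> R) (x : V) (e : R) :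
  {for x, continuous f} -> 0 < e ->
  exists2 r : R, 0 < r & forall y : V, `|x - y| < r -> `|f x - f y| <= e.
Proof. by move=> /cvgrPdist_le H e0; apply: nbhs_ex_norm; exact: H. Qed.

Lemma open_ex_norm (U : set V) x : open U -> U x ->
  exists2 r : R, 0 < r & forall y : V, `|x - y| < r -> U y.
Proof. by move=> oU Ux; apply: nbhs_ex_norm; exact: open_nbhs_nbhs. Qed.

End balls.

Section Ck.
Context (R : realType) (V : normedModType R).
Implicit Types (U : set V) (f g a b : V -> R).

(** Being C^k, as a recursion on k: it is suited to proofs by induction that a product
    or an inverse square root is C^k, and holds for all k when [smooth_open] does. *)
Fixpoint Ck (n : nat) (U : set V) (f : V -> R) : Prop :=
  if n is m.+1 then
    (forall x, U x -> {for x, continuous f} /\ forall v, derivable f x v) /\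
    (forall v, Ck m U ('D_v f))
  else forall x, U x -> {for x, continuous f}.

Lemma Ck_cont n U f x : Ck n U f -> U x -> {for x, continuous f}.
Proof. by case: n => [|n]; [exact | move=> [H _] /H[]]. Qed.

Lemma Ck_derivable n U f x v : Ck n.+1 U f -> U x -> derivable f x v.
Proof. by move=> [H _] /H[_]; exact. Qed.

Lemma Ck_is_derive n U f x v : Ck n.+1 U f -> U x -> is_derive x v f ('D_v f x).
Proof. by move=> H Ux; apply: DeriveDef => //; exact: Ck_derivable H Ux. Qed.

Lemma Ck_derive n U f v : Ck n.+1 U f -> Ck n U ('D_v f).
Proof. by move=> [_]; exact. Qed.

Lemma CkW n U f : Ck n.+1 U f -> Ck n U f.
Proof.
elim: n f => [|n IH] f; first by move=> [H _] x /H[].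
by move=> [H1 H2]; split=> // v; exact: IH.
Qed.

Lemma open_near_eq (T : Type) U (f' g' : V -> T) x : open U -> U x ->
  (forall y, U y -> f' y = g' y) -> \forall y \near x, f' y = g' y.
Proof.
by move=> oU Ux fg; apply: filterS (open_nbhs_nbhs (conj oU Ux)) => y /fg.
Qed.

Lemma Ck_ext n U f g : open U -> (forall y, U y -> f y = g y) ->
  Ck n U f -> Ck n U g.
Proof.
move=> oU; elim: n f g => [|n IH] f g fg.
  move=> H x Ux; rewrite /prop_for /continuous_at -(fg _ Ux).
  apply: cvg_trans (H _ Ux); apply: near_eq_cvg.
  by apply: open_near_eq oU Ux _ => y Uy; rewrite fg.
move=> [H1 H2]; split=> [x Ux|v].
  have [H3 H4] := H1 _ Ux; split.
    rewrite /prop_for /continuous_at -(fg _ Ux).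
    apply: cvg_trans H3; apply: near_eq_cvg.
    by apply: open_near_eq oU Ux _ => y Uy; rewrite fg.
  by move=> v; apply: near_eq_derivable (H4 v); apply: open_near_eq oU Ux _.
apply: IH (H2 v) => y Uy; apply: near_eq_derive; exact: open_near_eq oU Uy _.
Qed.

Lemma Ck_cst n U c : Ck n U (cst c).
Proof.
elim: n c => [|n IH] c /=; first by move=> x _; exact: cvg_cst.
split=> [x _|v]; first by split=> [|v]; [exact: cvg_cst | exact: derivable_cst].
rewrite (_ : 'D_v _ = cst 0) //; apply/funext => x; exact: derive_cst.
Qed.

Lemma CkD n U f g : open U -> Ck n U f -> Ck n U g -> Ck n U (fun x => f x + g x).
Proof.
move=> oU; elim: n f g => [|n IH] f g.
  by move=> H1 H2 x Ux; apply: cvgD; [exact: H1|exact: H2].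
move=> H1 H2; split=> [x Ux|v].
  split; first by apply: cvgD; [exact: Ck_cont H1 Ux|exact: Ck_cont H2 Ux].
  by move=> v; apply: derivableD; [exact: (Ck_derivable H1 Ux)|exact: (Ck_derivable H2 Ux)].
have := IH _ _ (Ck_derive v H1) (Ck_derive v H2).
apply: (Ck_ext oU) => y Uy /=.
by rewrite -(deriveD (Ck_derivable H1 Uy) (Ck_derivable H2 Uy)).
Qed.

Lemma CkM n U f g : open U -> Ck n U f -> Ck n U g -> Ck n U (fun x => f x * g x).
Proof.
move=> oU; elim: n f g => [|n IH] f g.
  by move=> H1 H2 x Ux; apply: cvgM; [exact: H1|exact: H2].
move=> H1 H2; split=> [x Ux|v].
  split; first by apply: cvgM; [exact: Ck_cont H1 Ux|exact: Ck_cont H2 Ux].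
  by move=> v; apply: derivableM; [exact: (Ck_derivable H1 Ux)|exact: (Ck_derivable H2 Ux)].
have := CkD oU (IH _ _ (CkW H1) (Ck_derive v H2)) (IH _ _ (CkW H2) (Ck_derive v H1)).
apply: (Ck_ext oU) => y Uy /=.
by rewrite (deriveM (Ck_derivable H1 Uy) (Ck_derivable H2 Uy)).
Qed.

Lemma Ck_sum n U m (f : 'I_m -> V -> R) : open U -> (forall i, Ck n U (f i)) ->
  Ck n U (fun x => \sum_i f i x).
Proof.
move=> oU H; elim: m f H => [|m IH] f H.
  rewrite (_ : (fun _ => _) = cst 0); first exact: Ck_cst.
  by apply/funext => x; rewrite big_ord0.
rewrite (_ : (fun _ => _) = (fun x => f ord0 x + \sum_i f (lift ord0 i) x)).
  by apply: CkD => //; apply: IH.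
by apply/funext => x; rewrite big_ord_recl.
Qed.

Lemma is_derive_rsqrt (x : R) : 0 < x ->
  is_derive x (1 : R) (fun y : R => (Num.sqrt y)^-1) (- 2^-1 * (Num.sqrt x)^-1 ^+ 3).
Proof.
move=> x0.
have sx : Num.sqrt x != 0 by rewrite gt_eqF // sqrtr_gt0.
have := is_deriveV sx (is_derive1_sqrt x0).
move=> /is_derive_eq; apply; rewrite [_ *: _]mulrC; field.
by rewrite sx.
Qed.

(** The derivative - 1/2 (f^(-1/2))^3 D_v f is a product of D_v f and of powers of
    f^(-1/2) itself, which the induction hypothesis already covers. *)
Lemma Ck_rsqrt n U f : open U -> (forall x, U x -> 0 < f x) -> Ck n U f ->
  Ck n U (fun x => (Num.sqrt (f x))^-1).
Proof.
move=> oU f0; elim: n => [|n IH].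
  move=> H x Ux; apply: cvgV; first by rewrite gt_eqF // sqrtr_gt0 f0.
  apply: continuous_cvg; [exact: sqrt_continuous|exact: H].
move=> H.
have D x v : U x -> is_derive x v (fun x => (Num.sqrt (f x))^-1)
   (- 2^-1 * (Num.sqrt (f x))^-1 ^+ 3 * 'D_v f x).
  move=> Ux; apply: is_derive_line0.
  apply: (@is_derive1_comp _ (fun y => (Num.sqrt y)^-1) (fun s => f (s *: v + x))).
    by rewrite scale0r add0r; apply: is_derive_rsqrt; exact: f0.
  by apply: is_derive_line; rewrite scale0r add0r; exact: Ck_is_derive H Ux.
split=> [x Ux|v].
  split=> [|v]; last by case: (D x v Ux).
  apply: cvgV; first by rewrite gt_eqF // sqrtr_gt0 f0.
  apply: continuous_cvg; [exact: sqrt_continuous|exact: Ck_cont H Ux].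
have K := IH (CkW H).
have := CkM oU (CkM oU (Ck_cst n U (- 2^-1)) (CkM oU K (CkM oU K K))) (Ck_derive v H).
apply: (Ck_ext oU) => y Uy /=.
by case: (D y v Uy) => _ ->; congr (_ * _); rewrite exprS expr2.
Qed.

End Ck.

Section schwarz.
Context (R : realType) (V : normedModType R).
Implicit Types (U : set V) (f : V -> R).

(** Two applications of the mean value theorem.  The second difference on the left is
    symmetric in v and w, so exchanging them evaluates the other mixed derivative. *)
Lemma second_difference U f x v w (a : R) : Ck 2 U f -> 0 < a ->
  (forall s r, 0 <= s <= a -> 0 <= r <= a -> U (s *: v + (r *: w + x))) ->
  exists c d, [/\ 0 <= c <= a, 0 <= d <= a &
    f (a *: v + (a *: w + x)) - f (a *: v + x) - f (a *: w + x) + f x =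
    a ^+ 2 * 'D_w ('D_v f) (c *: v + (d *: w + x))].
Proof.
move=> Cf a0 HU.
have aa : 0 <= a <= a by rewrite ltW //=.
have oo : 0 <= (0 : R) <= a by apply/andP; split=> //; exact: ltW.
pose p (s : R) := f (s *: v + (a *: w + x)) - f (s *: v + x).
pose dp s := 'D_v f (s *: v + (a *: w + x)) - 'D_v f (s *: v + x).
have Dp s : 0 <= s <= a -> is_derive s (1 : R) p (dp s).
  move=> sa; apply: is_deriveB; apply: is_derive_line.
    exact: (Ck_is_derive _ Cf (HU _ _ sa aa)).
  by have := HU _ _ sa oo; rewrite scale0r add0r; exact: (Ck_is_derive _ Cf).
have Cp : {within `[0, a], continuous p}.
  apply: derivable_within_continuous => s; rewrite in_itv /= => sa.
  by have [] := Dp s sa.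
have Dp' s : s \in `]0, a[%R -> is_derive s (1 : R) p (dp s).
  by rewrite in_itv /= => /andP[/ltW ? /ltW ?]; apply: Dp; apply/andP.
have [c ca Ec] := MVT_segment (ltW a0) Dp' Cp.
have ca' : 0 <= c <= a by move: ca; rewrite in_itv.
pose q (r : R) := 'D_v f (r *: w + (c *: v + x)).
pose dq r := 'D_w ('D_v f) (r *: w + (c *: v + x)).
have Dq r : 0 <= r <= a -> is_derive r (1 : R) q (dq r).
  move=> ra; apply: (@is_derive_line _ _ _ ('D_v f) (c *: v + x) w r).
  have := HU _ _ ca' ra; rewrite addrCA.
  exact: (Ck_is_derive _ (Ck_derive v Cf)).
have Cq : {within `[0, a], continuous q}.
  apply: derivable_within_continuous => r; rewrite in_itv /= => ra.
  by have [] := Dq r ra.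
have Dq' r : r \in `]0, a[%R -> is_derive r (1 : R) q (dq r).
  by rewrite in_itv /= => /andP[/ltW ? /ltW ?]; apply: Dq; apply/andP.
have [d da Ed] := MVT_segment (ltW a0) Dq' Cq.
have da' : 0 <= d <= a by move: da; rewrite in_itv.
exists c, d; split=> //.
move: Ec Ed; rewrite /p /dp /q /dq !scale0r !add0r !subr0.
rewrite (addrCA (a *: w)) (addrCA (d *: w)) => Ec Ed.
rewrite expr2 -mulrA [a * 'D_w _ _]mulrC -Ed [RHS]mulrC.
transitivity (f (a *: v + (a *: w + x)) - f (a *: v + x) - (f (a *: w + x) - f x)).
  by ring.
rewrite Ec; congr (_ * _); congr (_ - _).
Qed.

(** Divided by a^2, the second difference is a value near x of either mixed
    derivative; both are continuous at x. *)
Lemma Ck_schwarz U f x v w : open U -> Ck 2 U f -> U x ->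
  'D_v ('D_w f) x = 'D_w ('D_v f) x.
Proof.
move=> oU Cf Ux.
have C1 := Ck_cont (Ck_derive v (Ck_derive w Cf)) Ux.
have C2 := Ck_cont (Ck_derive w (Ck_derive v Cf)) Ux.
suff main (e : R) : 0 < e -> `|'D_v ('D_w f) x - 'D_w ('D_v f) x| <= e.
  apply/eqP; rewrite -subr_eq0 -normr_le0; apply/ler_addgt0Pl => e e0.
  by rewrite addr0; exact: main.
move=> e0; have e2 : 0 < e / 2 by rewrite divr_gt0.
have [r1 r10 H1] := continuous_ex_norm C1 e2.
have [r2 r20 H2] := continuous_ex_norm C2 e2.
have [r3 r30 H3] := open_ex_norm oU Ux.
pose r : R := Num.min (Num.min r1 r2) r3.
have r0 : 0 < r by rewrite !lt_min r10 r20.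
pose K : R := `|v| + `|w| + 1.
have K0 : 0 < K by rewrite /K ltr_wpDl // addr_ge0.
(* The parallelogram of sides a v and a w stays within distance r of x. *)
pose a : R := r / (2 * K).
have a0 : 0 < a by rewrite divr_gt0 // mulr_gt0.
have HB (s q : R) : 0 <= s <= a -> 0 <= q <= a -> `|x - (s *: v + (q *: w + x))| < r.
  move=> /andP[s0 sa] /andP[q0 qa]; rewrite addrA distrC addrK.
  rewrite (le_lt_trans (ler_normD _ _)) // !normrZ !ger0_norm //.
  rewrite (@le_lt_trans _ _ (a * (`|v| + `|w|))) //.
    by rewrite mulrDr lerD // ler_wpM2r.
  have aK : a * K = r / 2 by rewrite /a; field; rewrite gt_eqF.
  apply: (@le_lt_trans _ _ (a * K)); last by rewrite aK; lra.
  by rewrite ler_wpM2l ?(ltW a0) // /K lerDl.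
have HU (s q : R) : 0 <= s <= a -> 0 <= q <= a -> U (s *: v + (q *: w + x)).
  move=> s1 q1; apply: H3; apply: lt_le_trans (HB _ _ s1 q1) _.
  by rewrite ge_min lexx orbT.
have HU' (s q : R) : 0 <= s <= a -> 0 <= q <= a -> U (s *: w + (q *: v + x)).
  by move=> s1 q1; rewrite addrCA; exact: HU.
have [c [d [c1 d1 E1]]] := second_difference Cf a0 HU.
have [c' [d' [c1' d1' E2]]] := second_difference Cf a0 HU'.
have a2 : a ^+ 2 != 0 by rewrite expf_neq0 // gt_eqF.
have E : 'D_w ('D_v f) (c *: v + (d *: w + x)) = 'D_v ('D_w f) (c' *: w + (d' *: v + x)).
  apply: (mulfI a2); rewrite -E1 -E2 (addrCA (a *: w)); ring.
have r12 : r <= Num.min r1 r2 by rewrite ge_min lexx.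
have {}H2 : `|'D_w ('D_v f) x - 'D_w ('D_v f) (c *: v + (d *: w + x))| <= e / 2.
  apply: H2; apply: lt_le_trans (HB _ _ c1 d1) _.
  by apply: le_trans r12 _; rewrite ge_min lexx orbT.
have {}H1 : `|'D_v ('D_w f) x - 'D_w ('D_v f) (c *: v + (d *: w + x))| <= e / 2.
  rewrite E addrCA; apply: H1; apply: lt_le_trans (HB _ _ d1' c1') _.
  by apply: le_trans r12 _; rewrite ge_min lexx.
exact: ler_dist_half H1 H2.
Qed.

End schwarz.

(** * Iterated derivatives, matrix entries and time slices *)

Section iter_derive.
Context (R : realType) (V W : normedModType R).
Implicit Types (U : set V) (f g : V -> W).

Lemma iter_derive_ext U f g vs x : open U -> (forall y, U y -> f y = g y) ->
  U x -> iter_derive vs f x = iter_derive vs g x.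
Proof.
move=> oU fg; elim: vs x => [|v vs IH] x Ux /=; first exact: fg.
by apply: near_eq_derive; apply: filterS (open_nbhs_nbhs (conj oU Ux)).
Qed.

Lemma iter_derive_rcons vs v f : iter_derive (rcons vs v) f = iter_derive vs ('D_v f).
Proof. by elim: vs => [//|w vs IH] /=; rewrite IH. Qed.

Lemma smooth_open_derive U f v : smooth_open U f -> smooth_open U ('D_v f).
Proof. by move=> H vs x Ux; rewrite -iter_derive_rcons; exact: H. Qed.

Lemma smooth_open_derivable U f x v : smooth_open U f -> U x -> derivable f x v.
Proof. by move=> H Ux; have [_] := H [::] x Ux; exact. Qed.

Lemma smooth_open_local (A : set V) f :
  (forall x, A x -> exists U g,
     [/\ open U, U x, smooth_open U g & forall y, U y -> f y = g y]) ->
  smooth_open A f.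
Proof.
move=> H vs x Ax; have [U [g [oU Ux sg fg]]] := H x Ax.
have E y : U y -> iter_derive vs f y = iter_derive vs g y.
  exact: iter_derive_ext.
have [cg dg] := sg vs x Ux; split=> [|v].
  rewrite /prop_for /continuous_at E //; apply: cvg_trans cg; apply: near_eq_cvg.
  by apply: filterS (open_nbhs_nbhs (conj oU Ux)) => y Uy; rewrite E.
apply: near_eq_derivable (dg v).
by apply: filterS (open_nbhs_nbhs (conj oU Ux)) => y Uy; rewrite E.
Qed.

End iter_derive.

Section components.
Context (R : realType) (V : normedModType R) (m n : nat).
Implicit Types (U : set V) (f g : V -> 'M[R]_(m.+1, n.+1)).

Lemma derive_component f x v i j : derivable f x v ->
  'D_v (fun y => f y i j) x = ('D_v f x) i j.
Proof. by move=> df; rewrite (derive_mx df) mxE. Qed.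

Lemma smooth_open_component U f i j k : open U -> smooth_open U f ->
  Ck k U (fun x => f x i j).
Proof.
move=> oU; elim: k f => [|k IH] f sf.
  move=> x Ux; have [+ _] := sf [::] x Ux => /=.
  move=> cf; by apply: (@continuous_comp _ _ _ f (fun M : 'M[R]_(m.+1, n.+1) => M i j)); [exact: cf|exact: coord_continuous].
split=> [x Ux|v].
  split; last by move=> v; move: (smooth_open_derivable (v := v) sf Ux) => /derivable_mxP; exact.
  have [+ _] := sf [::] x Ux => /=.
  move=> cf; by apply: (@continuous_comp _ _ _ f (fun M : 'M[R]_(m.+1, n.+1) => M i j)); [exact: cf|exact: coord_continuous].
apply: (Ck_ext oU _ (IH _ (smooth_open_derive v sf))) => y Uy.
by rewrite derive_component //; exact: smooth_open_derivable sf Uy.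
Qed.

End components.

Section slices.
Context (R : realType) (W : normedModType R).
Implicit Types (g : R * (R * R) -> W).

Lemma derive_slice g t v : 'D_v (fun u => g (t, u)) = fun u => 'D_(0, v) g (t, u).
Proof.
apply/funext => u; rewrite /derive; f_equal; f_equal.
apply/funext => h /=; congr (_ *: (g _ - _)); congr (_, _).
by rewrite /= scaler0 add0r.
Qed.

Lemma derivable_slice g t u v :
  derivable g (t, u) (0, v) -> derivable (fun u => g (t, u)) u v.
Proof.
rewrite /derivable; set A := (X in cvg (X @ _)); set B := (X in _ -> cvg (X @ _)).
suff -> : B = A by [].
apply/funext => h; rewrite /A /B /=; congr (_ *: (g _ - _)); congr (_, _).
by rewrite /= scaler0 add0r.
Qed.

(** Freezing the time variable does not change the difference quotients in space. *)
Lemma iter_derive_slice g t vs :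
  iter_derive vs (fun u => g (t, u)) =
  fun u => iter_derive [seq (0, v) | v <- vs] g (t, u).
Proof.
by elim: vs => [//|v vs IH] /=; rewrite IH derive_slice.
Qed.

Lemma continuous_insert (t : R) : continuous (fun u : R * R => (t, u)).
Proof.
move=> u; apply: (@cvg_pair _ _ _ _ (nbhs t) (nbhs u)); first exact: (cvg_cst t).
exact: cvg_id.
Qed.

Lemma open_slice (U : set (R * (R * R))) t : open U -> open [set u | U (t, u)].
Proof.
by move=> oU; apply: (open_comp _ oU) => u _; exact: continuous_insert.
Qed.

Lemma smooth_open_slice (U : set (R * (R * R))) g t :
  smooth_open U g -> smooth_open [set u | U (t, u)] (fun u => g (t, u)).
Proof.
move=> sg vs u /= Utu; rewrite iter_derive_slice.
have [cg dg] := sg [seq (0, v) | v <- vs] _ Utu; split=> [|v].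
  apply: (@continuous_comp _ _ _ (fun u : R * R => (t, u))); [|exact: cg].
  exact: continuous_insert.
exact: derivable_slice.
Qed.

End slices.

Section slice_Ck.
Context (R : realType).

Lemma derive_snd (f : R * R -> R) (a : R * (R * R)) :
  'D_a (fun z : R * (R * R) => f z.2) = fun z => 'D_(a.2) f z.2.
Proof. by []. Qed.

Lemma Ck_snd n (U : set (R * R)) (f : R * R -> R) : Ck n U f ->
  Ck n [set z : R * (R * R) | U z.2] (fun z => f z.2).
Proof.
elim: n f => [|n IH] f.
  by move=> H z /= Uz; apply: (@continuous_comp _ _ _ snd f); [exact: cvg_snd|exact: (H _ Uz)].
move=> [H1 H2]; split=> [z /= Uz|v].
  have [H3 H4] := H1 _ Uz; split; last by move=> v; exact: (H4 v.2).
  by apply: (@continuous_comp _ _ _ snd f); [exact: cvg_snd|exact: H3].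
by rewrite derive_snd; exact: (IH _ (H2 v.2)).
Qed.

Lemma is_derive_fst (z v : R * (R * R)) : is_derive z v (fun z => z.1) v.1.
Proof.
apply: is_derive_line0.
rewrite (_ : (fun _ => _) = (fun s : R => s * v.1 + z.1)) //.
have : is_derive 0 (1 : R) (fun s : R => s * v.1 + z.1) (v.1 *: 1 + 0).
  apply: is_deriveD.
  rewrite (_ : (fun s : R => s * v.1) = v.1 *: id); first exact: is_deriveZ.
  by apply/funext => s /=; rewrite mulrC.
by move/is_derive_eq; apply; rewrite addr0 [_ *: _]mulr1.
Qed.

Lemma Ck_fst n U : Ck n U (fun z : R * (R * R) => z.1).
Proof.
case: n => [|n]; first by move=> z _; exact: cvg_fst.
split=> [z _|v].
  by split; [exact: cvg_fst | move=> v; case: (is_derive_fst z v)].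
rewrite (_ : 'D_v _ = cst v.1); first exact: Ck_cst.
by apply/funext => z; have [_ ->] := is_derive_fst z v.
Qed.

Lemma Ck_shift (V : normedModType R) n (U : set V) (f : V -> R) (a : V) : Ck n U f ->
  Ck n [set x | U (x + a)] (fun x => f (x + a)).
Proof.
have cs y : {for y, continuous (fun x : V => x + a)}.
  by apply: (@continuousD _ _ _ idfun (cst a)); [by move=> B|exact: cst_continuous].
elim: n f => [|n IH] f.
  move=> H x /= Ux; apply: (@continuous_comp _ _ _ (fun x => x + a) f); [|exact: (H _ Ux)].
  exact: cs.
have E v : 'D_v (fun x => f (x + a)) = fun x => 'D_v f (x + a).
  apply/funext => x; rewrite /derive; f_equal; f_equal.
  by apply/funext => h /=; rewrite addrA.
move=> [H1 H2]; split=> [x /= Ux|v]; last by rewrite E; exact: (IH _ (H2 v)).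
have [H3 H4] := H1 _ Ux; split.
  apply: (@continuous_comp _ _ _ (fun x => x + a) f); [|exact: H3].
  exact: cs.
move=> v; have := H4 v; rewrite /derivable.
set A := (X in cvg (X @ _)); set B := (X in _ -> cvg (X @ _)).
suff -> : B = A by [].
by apply/funext => h; rewrite /A /B /= addrA.
Qed.

End slice_Ck.

(** * Equality up to first order *)

Section congruence.
Context (R : realType) (Z : Type) (Fi : set_system Z) (r : Z -> R).
Context {FF : Filter Fi}.
Let r0 z : 0 <= `|r z|. Proof. exact: normr_ge0. Qed.
Implicit Types (a b c : Z -> R) (l m : R).

Definition small_diff a b := forall e : R, 0 < e ->
  \forall z \near Fi, `|a z - b z| <= e * `|r z|.

(** Equality up to o(r), with a common limit l.  The limit is part of the relation
    because inverses and square roots require it to be nonzero.  For r = 0 and a = b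
    only the convergence remains, so that the stability lemmas below also prove
    continuity. *)
Definition cong l a b :=
  [/\ a @ Fi --> l, b @ Fi --> l & small_diff a b].

Lemma small_diff_refl a : small_diff a a.
Proof.
by move=> e e0; apply: nearW => z; rewrite subrr normr0 mulr_ge0 // ltW.
Qed.

Lemma small_diff_sym a b : small_diff a b -> small_diff b a.
Proof. by move=> H e e0; apply: filterS (H e e0) => z; rewrite distrC. Qed.

Lemma small_diff_trans b a c : small_diff a b -> small_diff b c -> small_diff a c.
Proof.
move=> H1 H2 e e0; have e2 : 0 < e / 2 by rewrite divr_gt0.
apply: filterS2 (H1 _ e2) (H2 _ e2) => z.
move: (a z) (b z) (c z) (`|r z|) => x y w s.
by rewrite !ler_norml => /andP[? ?] /andP[? ?]; apply/andP; split; nra.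
Qed.

Lemma small_diffD a b a' b' : small_diff a b -> small_diff a' b' ->
  small_diff (fun z => a z + a' z) (fun z => b z + b' z).
Proof.
move=> H1 H2 e e0; have e2 : 0 < e / 2 by rewrite divr_gt0.
apply: filterS2 (H1 _ e2) (H2 _ e2) => z.
move: (a z) (b z) (a' z) (b' z) (`|r z|) => x y w x' s.
by rewrite !ler_norml => /andP[? ?] /andP[? ?]; apply/andP; split; nra.
Qed.

Lemma cvg_norm_le a l : a @ Fi --> l -> \forall z \near Fi, `|a z| <= `|l| + 1.
Proof.
move/cvgrPdist_le => /(_ 1 ltr01); apply: filterS => z H.
by rewrite -lerBlDl (le_trans (lerB_dist _ _)) // distrC.
Qed.

Lemma small_diffM l m a b a' b' : a @ Fi --> l -> b' @ Fi --> m ->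
  small_diff a b -> small_diff a' b' ->
  small_diff (fun z => a z * a' z) (fun z => b z * b' z).
Proof.
move=> al bm H1 H2 e e0.
pose K : R := (`|l| + 1) + (`|m| + 1).
have K0 : 0 < K by rewrite /K; have := normr_ge0 l; have := normr_ge0 m; lra.
have eK : 0 < e / K by rewrite divr_gt0.
apply: filterS2 (filterI (cvg_norm_le al) (cvg_norm_le bm))
  (filterI (H1 _ eK) (H2 _ eK)) => z [Ha Hb] [Hab Hab'].
have -> : a z * a' z - b z * b' z = a z * (a' z - b' z) + b' z * (a z - b z) by ring.
rewrite (le_trans (ler_normD _ _)) // !normrM.
apply: (@le_trans _ _ ((`|l| + 1) * (e / K * `|r z|) + (`|m| + 1) * (e / K * `|r z|))).
  by apply: lerD; apply: ler_pM.
by rewrite -mulrDl -/K mulrA [K * _]mulrC divfK ?gt_eqF.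
Qed.

Lemma cong_refl l a : a @ Fi --> l -> cong l a a.
Proof. by move=> al; split=> //; exact: small_diff_refl. Qed.

Lemma cong_cst l : cong l (fun=> l) (fun=> l).
Proof. by apply: cong_refl; exact: cvg_cst. Qed.

Lemma cong_sym l a b : cong l a b -> cong l b a.
Proof. by move=> [? ? ?]; split=> //; exact: small_diff_sym. Qed.

Lemma cong_trans b l a c : cong l a b -> cong l b c -> cong l a c.
Proof. by move=> [? _ H] [_ ? ?]; split=> //; exact: small_diff_trans H _. Qed.

Lemma congD l m a b a' b' : cong l a b -> cong m a' b' ->
  cong (l + m) (fun z => a z + a' z) (fun z => b z + b' z).
Proof.
move=> [a1 b1 d1] [a2 b2 d2]; split; [exact: cvgD|exact: cvgD|exact: small_diffD].
Qed.

Lemma congM l m a b a' b' : cong l a b -> cong m a' b' ->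
  cong (l * m) (fun z => a z * a' z) (fun z => b z * b' z).
Proof.
move=> [a1 b1 d1] [a2 b2 d2]; split; [exact: cvgM|exact: cvgM|].
exact: small_diffM a1 b2 d1 d2.
Qed.

Lemma congN l a b : cong l a b -> cong (- l) (fun z => - a z) (fun z => - b z).
Proof.
move=> [a1 b1 d1]; split; [exact: cvgN|exact: cvgN|].
by move=> e e0; apply: filterS (d1 e e0) => z; rewrite -opprB normrN opprK addrC.
Qed.

Lemma congB l m a b a' b' : cong l a b -> cong m a' b' ->
  cong (l - m) (fun z => a z - a' z) (fun z => b z - b' z).
Proof. by move=> H1 H2; exact: congD H1 (congN H2). Qed.

Lemma cong_sum n (l : 'I_n -> R) (a b : 'I_n -> Z -> R) :
  (forall i, cong (l i) (a i) (b i)) ->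
  cong (\sum_i l i) (fun z => \sum_i a i z) (fun z => \sum_i b i z).
Proof.
elim: n l a b => [|n IH] l a b H.
  rewrite big_ord0 (_ : (fun _ => _) = fun=> 0); last first.
    by apply/funext => z; rewrite big_ord0.
  rewrite (_ : (fun z => \sum_i b i z) = fun=> 0); last first.
    by apply/funext => z; rewrite big_ord0.
  exact: cong_cst.
rewrite big_ord_recl.
rewrite (_ : (fun _ => _) = (fun z => a ord0 z + \sum_i a (lift ord0 i) z)); last first.
  by apply/funext => z; rewrite big_ord_recl.
rewrite (_ : (fun z => \sum_i b i z) =
            (fun z => b ord0 z + \sum_i b (lift ord0 i) z)); last first.
  by apply/funext => z; rewrite big_ord_recl.
by apply: congD; [exact: H|apply: IH].
Qed.

Lemma congV l a b : l != 0 -> cong l a b ->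
  cong l^-1 (fun z => (a z)^-1) (fun z => (b z)^-1).
Proof.
move=> l0 [a1 b1 d1]; split; [exact: cvgV|exact: cvgV|].
move=> e e0.
have l2 : 0 < `|l| / 2 by rewrite divr_gt0 // normr_gt0.
pose d : R := e * (`|l| / 2) ^+ 2.
have d0 : 0 < d by rewrite mulr_gt0 // exprn_gt0.
have lower c : c @ Fi --> l -> \forall z \near Fi, `|l| / 2 <= `|c z|.
  move/cvgrPdist_le => /(_ _ l2); apply: filterS => z H.
  have := lerB_dist l (c z); move: H; move: `|l - c z| `|l| `|c z| => x y w.
  by move=> *; lra.
apply: filterS3 (d1 _ d0) (lower a a1) (lower b b1) => z H la lb.
have az : 0 < `|a z| by exact: lt_le_trans la.
have bz : 0 < `|b z| by exact: lt_le_trans lb.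
have -> : (a z)^-1 - (b z)^-1 = (b z - a z) / (a z * b z).
  by field; rewrite -!normr_gt0 az bz.
rewrite normrM normfV normrM ler_pdivrMr ?mulr_gt0 // distrC (le_trans H) //.
rewrite /d mulrAC; apply: ler_wpM2l; first by rewrite mulr_ge0 // ltW.
by rewrite expr2; apply: ler_pM => //; exact: ltW.
Qed.

(** sqrt a - sqrt b = (a - b) / (sqrt a + sqrt b), whose denominator stays away from 0. *)
Lemma cong_sqrt l a b : 0 < l -> cong l a b ->
  cong (Num.sqrt l) (fun z => Num.sqrt (a z)) (fun z => Num.sqrt (b z)).
Proof.
move=> l0 [a1 b1 d1].
have cs c : c @ Fi --> l -> Num.sqrt (c z) @[z --> Fi] --> Num.sqrt l.
  by move=> cl; apply: continuous_cvg => //; exact: sqrt_continuous.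
split; [exact: cs|exact: cs|] => e e0.
have sl : 0 < Num.sqrt l by rewrite sqrtr_gt0.
have s2 : 0 < Num.sqrt l / 2 by rewrite divr_gt0.
have d0 : 0 < e * (Num.sqrt l / 2) by rewrite mulr_gt0.
have pos c : c @ Fi --> l -> \forall z \near Fi, 0 <= c z.
  move/cvgrPdist_le => /(_ _ l0); apply: filterS => z.
  by rewrite ler_norml => /andP[_ H]; lra.
have low : \forall z \near Fi, Num.sqrt l / 2 <= Num.sqrt (a z).
  have /cvgrPdist_le /(_ _ s2) := cs a a1; apply: filterS => z.
  by rewrite ler_norml => /andP[_ H]; lra.
apply: filterS2 (filterI (pos a a1) (pos b b1)) (filterI low (d1 _ d0)) =>
  z [pa pb] [la dz].
have sb : 0 <= Num.sqrt (b z) by exact: sqrtr_ge0.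
have S0 : 0 < Num.sqrt (a z) + Num.sqrt (b z) by lra.
rewrite -(ler_pM2r S0) -[X in _ * X](gtr0_norm S0) -normrM.
have -> : (Num.sqrt (a z) - Num.sqrt (b z)) * (Num.sqrt (a z) + Num.sqrt (b z)) = a z - b z.
  by rewrite -subr_sqr !sqr_sqrtr.
apply: (le_trans dz); rewrite mulrAC; apply: ler_wpM2l; last by lra.
by rewrite mulr_ge0 // ltW.
Qed.

Lemma cong_near l a b a' b' : (\forall z \near Fi, a z = a' z) ->
  (\forall z \near Fi, b z = b' z) -> cong l a b -> cong l a' b'.
Proof.
move=> ea eb [a1 b1 d1]; split.
- by apply: cvg_trans a1; apply: near_eq_cvg; apply: filterS ea.
- by apply: cvg_trans b1; apply: near_eq_cvg; apply: filterS eb.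
- by move=> e e0; apply: filterS3 ea eb (d1 e e0) => z -> ->.
Qed.

Lemma small_diff_le a b c : c @ Fi --> 0 ->
  (\forall z \near Fi, `|a z - b z| <= `|c z| * `|r z|) -> small_diff a b.
Proof.
move=> /cvgrPdist_le c0 H e e0; apply: filterS2 (c0 e e0) H => z.
by rewrite sub0r normrN => H1 /le_trans; apply; apply: ler_wpM2r.
Qed.

End congruence.

(** * The local geometry of a surface up to first order *)

Section matrix2.
Context (R : realType).
Implicit Types (A : 'M[R]_2).

Lemma lift01 : lift ord0 ord0 = 1 :> 'I_2. Proof. exact: val_inj. Qed.
Lemma lift10 : lift 1 ord0 = 0 :> 'I_2. Proof. exact: val_inj. Qed.

Lemma adj_mx2 A i j :
  (\adj A) i j = (-1) ^+ (j + i) * A (lift j ord0) (lift i ord0).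
Proof. by rewrite mxE /cofactor det_mx11 !mxE. Qed.

Lemma det_mx2 A : \det A = A 0 0 * A 1 1 - A 0 1 * A 1 0.
Proof.
rewrite (expand_det_row _ 0) !big_ord_recl big_ord0 /cofactor !det_mx11 !mxE /=.
by rewrite lift01 lift10 expr0 expr1 mul1r addr0 mulN1r mulrN.
Qed.

Lemma inv_mx2 A i j : \det A != 0 ->
  invmx A i j = (\det A)^-1 * ((-1) ^+ (j + i) * A (lift j ord0) (lift i ord0)).
Proof.
move=> d0; rewrite /invmx unitmxE unitfE d0 mxE adj_mx2 //.
Qed.

End matrix2.

Section dot.
Context (R : realType).
Implicit Types (u v w : 'rV[R]_4).

Lemma dotC u v : dot u v = dot v u.
Proof. by apply: eq_bigr => i _; rewrite mulrC. Qed.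

Lemma dotDl u v w : dot (u + v) w = dot u w + dot v w.
Proof. by rewrite -big_split; apply: eq_bigr => i _; rewrite mxE mulrDl. Qed.

Lemma dotZl c u v : dot (c *: u) v = c * dot u v.
Proof. by rewrite mulr_sumr; apply: eq_bigr => i _; rewrite mxE mulrA. Qed.

Lemma dotNl u v : dot (- u) v = - dot u v.
Proof. by rewrite -scaleN1r dotZl mulN1r. Qed.

Lemma dotBl u v w : dot (u - v) w = dot u w - dot v w.
Proof. by rewrite dotDl dotNl. Qed.

Lemma dotDr u v w : dot w (u + v) = dot w u + dot w v.
Proof. by rewrite !(dotC w) dotDl. Qed.

Lemma dotZr c u v : dot u (c *: v) = c * dot u v.
Proof. by rewrite !(dotC u) dotZl. Qed.

Lemma dot0l u : dot 0 u = 0.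
Proof. by rewrite -(scale0r 0) dotZl mul0r. Qed.

Lemma dot_suml n (u : 'I_n -> 'rV[R]_4) w : dot (\sum_i u i) w = \sum_i dot (u i) w.
Proof. by elim/big_ind2: _ => [|x a y b <- <-|//]; rewrite ?dot0l ?dotDl. Qed.

Lemma dot_ge0 u : 0 <= dot u u.
Proof. by apply: sumr_ge0 => i _; rewrite -expr2 sqr_ge0. Qed.

Lemma dot_eq0 u : dot u u = 0 -> u = 0.
Proof.
move=> /eqP; rewrite psumr_eq0; last by move=> i _; rewrite -expr2 sqr_ge0.
move=> /allP H; apply/rowP => i; rewrite mxE.
by have := H i; rewrite mem_index_enum => /(_ isT) /=; rewrite mulf_eq0 orbb => /eqP.
Qed.

(** The squared length of the component of u orthogonal to v, up to a factor: it gives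
    the Cauchy-Schwarz inequality and the positivity of the metric of an immersion. *)
Lemma dot_gram u v :
  dot (dot v v *: u - dot u v *: v) (dot v v *: u - dot u v *: v) =
  dot v v * (dot u u * dot v v - dot u v ^+ 2).
Proof.
rewrite dotBl !(dotC _ (_ - _)) !dotBl !dotZl !(dotC _ (_ *: _)) !dotZl (dotC v u).
by move: (dot u u) (dot u v) (dot v v) => a b c; ring.
Qed.

Lemma dot_cauchy_sq u v : dot u v ^+ 2 <= dot u u * dot v v.
Proof.
have [v0|v0] := eqVneq (dot v v) 0.
  by rewrite (dot_eq0 v0) dotC dot0l dot0l expr0n mulr0.
have vp : 0 < dot v v by rewrite lt_def v0 dot_ge0.
by have := dot_ge0 (dot v v *: u - dot u v *: v);
  rewrite dot_gram pmulr_rge0 // subr_ge0.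
Qed.

Lemma dot_cauchy u v : `|dot u v| <= enorm u * enorm v.
Proof.
rewrite -sqrtr_sqr -sqrtrM ?dot_ge0 //.
by rewrite ler_wsqrtr // dot_cauchy_sq.
Qed.

Lemma enorm_ge0 u : 0 <= enorm u. Proof. exact: sqrtr_ge0. Qed.

Lemma enorm_sqr u : enorm u ^+ 2 = dot u u.
Proof. by rewrite sqr_sqrtr // dot_ge0. Qed.

End dot.

Section vector_congruence.
Context (R : realType) (Z : Type) (Fi : set_system Z) (r : Z -> R).
Context {FF : Filter Fi}.
Local Notation cong := (cong Fi r).

Definition vcong (l : 'rV[R]_4) (a b : Z -> 'rV[R]_4) :=
  forall k, cong (l 0 k) (fun z => a z 0 k) (fun z => b z 0 k).

Lemma cong_eq l l' a b a' b' : l = l' -> a =1 a' -> b =1 b' ->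
  cong l a b -> cong l' a' b'.
Proof. by move=> -> /funext -> /funext ->. Qed.

Lemma vcongB l m a b a' b' : vcong l a b -> vcong m a' b' ->
  vcong (l - m) (fun z => a z - a' z) (fun z => b z - b' z).
Proof.
move=> H1 H2 k.
by apply: (cong_eq _ _ _ (congB (H1 k) (H2 k))) => [|z|z]; rewrite !mxE.
Qed.

Lemma vcongZ l m a b a' b' : cong l a b -> vcong m a' b' ->
  vcong (l *: m) (fun z => a z *: a' z) (fun z => b z *: b' z).
Proof.
move=> H1 H2 k.
by apply: (cong_eq _ _ _ (congM H1 (H2 k))) => [|z|z]; rewrite !mxE.
Qed.

Lemma vcong_sum n (l : 'I_n -> 'rV[R]_4) (a b : 'I_n -> Z -> 'rV[R]_4) :
  (forall i, vcong (l i) (a i) (b i)) ->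
  vcong (\sum_i l i) (fun z => \sum_i a i z) (fun z => \sum_i b i z).
Proof.
move=> H k.
by apply: (cong_eq _ _ _ (cong_sum (fun i => H i k))) => [|z|z]; rewrite summxE.
Qed.

Lemma cong_dot l m a b a' b' : vcong l a b -> vcong m a' b' ->
  cong (dot l m) (fun z => dot (a z) (a' z)) (fun z => dot (b z) (b' z)).
Proof.
by move=> H1 H2; apply: cong_sum => i; exact: congM.
Qed.

Lemma vcong_sym l a b : vcong l a b -> vcong l b a.
Proof. by move=> H k; exact: cong_sym. Qed.

Lemma vcong_trans b l a c : vcong l a b -> vcong l b c -> vcong l a c.
Proof. by move=> H H' k; exact: cong_trans (H k) (H' k). Qed.

End vector_congruence.

Definition willmore_density (R : realType) (f : R * R -> 'rV[R]_4) (u : R * R) : R :=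
  (1 + 4^-1 * dot (mean_curv f u) (mean_curv f u)) * area_density f u.

Section geometry_congruence.
Context (R : realType) (Z : Type) (Fi : set_system Z) (r : Z -> R).
Context {FF : Filter Fi}.
Local Notation cong := (cong Fi r).
Local Notation vcong := (vcong Fi r).
Variables (fa fb : Z -> R * R -> 'rV[R]_4) (ua ub : Z -> R * R).
Variables (f : R * R -> 'rV[R]_4) (u : R * R).
Hypothesis H0 : vcong (f u) (fun z => fa z (ua z)) (fun z => fb z (ub z)).
Hypothesis H1 : forall i, vcong (partial i f u)
  (fun z => partial i (fa z) (ua z)) (fun z => partial i (fb z) (ub z)).

Lemma cong_metric i j : cong (metric f u i j)
  (fun z => metric (fa z) (ua z) i j) (fun z => metric (fb z) (ub z) i j).
Proof.
apply: (cong_eq _ _ _ (cong_dot (H1 i) (H1 j))) => [|z|z]; by rewrite mxE.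
Qed.

Lemma cong_det_metric : cong (\det (metric f u))
  (fun z => \det (metric (fa z) (ua z))) (fun z => \det (metric (fb z) (ub z))).
Proof.
apply: (cong_eq _ _ _ (congB (congM (cong_metric 0 0) (cong_metric 1 1))
  (congM (cong_metric 0 1) (cong_metric 1 0)))) => [|z|z]; by rewrite det_mx2.
Qed.

Hypothesis det_gt0 : 0 < \det (metric f u).

Lemma cong_area_density : cong (area_density f u)
  (fun z => area_density (fa z) (ua z)) (fun z => area_density (fb z) (ub z)).
Proof. exact: cong_sqrt cong_det_metric. Qed.

Lemma cong_inv_metric i j : cong (inv_metric f u i j)
  (fun z => inv_metric (fa z) (ua z) i j) (fun z => inv_metric (fb z) (ub z) i j).
Proof.
have d0 : \det (metric f u) != 0 by rewrite gt_eqF.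
have [ca cb _] := cong_det_metric.
have nz c : c @ Fi --> \det (metric f u) -> \forall z \near Fi, c z != 0.
  move/cvgrPdist_lt => /(_ _ det_gt0); apply: filterS => z.
  by rewrite ltr_norml => /andP[_ H]; rewrite gt_eqF //; lra.
rewrite /inv_metric inv_mx2 //.
apply: (cong_near _ _ (congM (congV d0 cong_det_metric)
  (congM (cong_cst r ((-1) ^+ (j + i))) (cong_metric (lift j ord0) (lift i ord0))))).
  by apply: filterS (nz _ ca) => z H; rewrite inv_mx2.
by apply: filterS (nz _ cb) => z H; rewrite inv_mx2.
Qed.

Lemma vcong_normal_part l a b : vcong l a b -> vcong (normal_part f u l)
  (fun z => normal_part (fa z) (ua z) (a z)) (fun z => normal_part (fb z) (ub z) (b z)).
Proof.
move=> Hv; apply: vcongB.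
  by apply: vcongB => //; apply: vcongZ => //; exact: cong_dot.
apply: vcong_sum => k; apply: vcong_sum => j; apply: vcongZ => //.
by apply: congM; [exact: cong_inv_metric|exact: cong_dot].
Qed.

Hypothesis H2 : forall i j, vcong (partial i (partial j f) u)
  (fun z => partial i (partial j (fa z)) (ua z))
  (fun z => partial i (partial j (fb z)) (ub z)).

Lemma vcong_mean_curv : vcong (mean_curv f u)
  (fun z => mean_curv (fa z) (ua z)) (fun z => mean_curv (fb z) (ub z)).
Proof.
apply: vcong_sum => i; apply: vcong_sum => j; apply: vcongZ.
  exact: cong_inv_metric.
by apply: vcong_normal_part; exact: H2.
Qed.

(** The geometry depends on the derivatives of order at most two through ring
    operations, one inverse and one square root, both taken at the positive number
    det g; hence it inherits their equality up to o(r). *)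
Lemma cong_willmore_density : cong (willmore_density f u)
  (fun z => willmore_density (fa z) (ua z)) (fun z => willmore_density (fb z) (ub z)).
Proof.
apply: congM; last exact: cong_area_density.
apply: congD; first exact: cong_cst.
apply: congM; first exact: cong_cst.
by apply: cong_dot => //; exact: vcong_mean_curv.
Qed.

End geometry_congruence.

(** * One-parameter families of maps *)

Lemma MVT_abs (R : realType) (p dp : R -> R) (h : R) :
  (forall s, `|s| <= `|h| -> is_derive s (1 : R) p (dp s)) ->
  exists2 c, `|c| <= `|h| & p h - p 0 = dp c * h.
Proof.
move=> H.
have cont a b : (forall s : R, a <= s <= b -> `|s| <= `|h|) -> {within `[a, b], continuous p}.
  move=> ab; apply: derivable_within_continuous => s; rewrite in_itv /= => sab.
  by have [] := H s (ab s sab).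
have [h0|h0] := leP 0 h.
  have ab s : 0 <= s <= h -> `|s| <= `|h|.
    by move=> /andP[s0 sh]; rewrite !ger0_norm.
  have D s : s \in `]0, h[%R -> is_derive s (1 : R) p (dp s).
    rewrite in_itv /= => /andP[/ltW s0 /ltW sh]; apply: H; apply: ab.
    by apply/andP.
  have [c + E] := MVT_segment h0 D (cont _ _ ab).
  by rewrite in_itv /= => /ab ch; exists c => //; rewrite E subr0.
have ab s : h <= s <= 0 -> `|s| <= `|h|.
  by move=> /andP[sh s0]; rewrite !ler0_norm ?lerN2 // ltW.
have D s : s \in `]h, 0[%R -> is_derive s (1 : R) p (dp s).
  rewrite in_itv /= => /andP[/ltW s0 /ltW sh]; apply: H; apply: ab.
  by apply/andP.
have [c + E] := MVT_segment (ltW h0) D (cont _ _ ab).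
rewrite in_itv /= => /ab ch; exists c => //.
by move: E; rewrite sub0r mulrN => /eqP; rewrite -subr_eq0 opprK => /eqP E'; lra.
Qed.

Lemma norm_nbhs (R : realType) (V : normedModType R) (x : V) (r : R) (P : set V) :
  0 < r -> (forall y : V, `|x - y| < r -> P y) -> nbhs x P.
Proof.
move=> r0 H; apply/nbhs_ballP; exists r => //= y.
by rewrite -ball_normE; exact: H.
Qed.

Lemma cong_small_diff (R : realType) (Z : Type) (Fi : set_system Z) (r : Z -> R)
    {FF : Filter Fi} (l : R) (a b : Z -> R) :
  r @ Fi --> 0 -> a @ Fi --> l -> small_diff Fi r a b -> cong Fi r l a b.
Proof.
move=> /cvgrPdist_le r0 al H; split=> //; apply/cvgrPdist_le => e e0.
have e2 : 0 < e / 2 by rewrite divr_gt0.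
move/cvgrPdist_le : al => al.
apply: filterS3 (r0 _ e2) (al _ e2) (H _ ltr01) => z.
rewrite sub0r normrN mul1r => h1 h2 h3.
have {}h3 : `|b z - a z| <= e / 2 by rewrite distrC (le_trans h3).
exact: ler_dist_half h2 h3.
Qed.

Section taylor.
Context (R : realType).
Local Notation E := (R * (R * R))%type.
Implicit Types (U : set E) (g : E -> R).

Definition time_dir : E := (1, (0, 0)).

Lemma time_line (s : R) (u : R * R) : s *: time_dir + (0, u) = (s, u) :> E.
Proof.
rewrite /time_dir; case: u => x y.
by congr (_, (_, _)) => /=; rewrite ?scaler0 ?add0r // addr0 [_ *: _]mulr1.
Qed.

Lemma norm_slice (u v : R * R) (s h : R) : `|s| <= `|h| ->
  `|((0, u) : E) - (s, v)| <= `|((0, u) : E) - (h, v)|.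
Proof.
move=> sh; rewrite !prod_normE /= !sub0r !normrN.
rewrite ge_max; apply/andP; split; rewrite le_max; apply/orP.
  by left.
by right.
Qed.

(** The mean value theorem in time and the continuity of the time derivative at
    (0, u0) give a remainder that is uniform for u near u0. *)
Lemma taylor_time U g u0 : open U -> U (0, u0) -> Ck 1 U g ->
  small_diff (nbhs ((0, u0) : E)) fst g
    (fun z => g (0, z.2) + z.1 * 'D_time_dir g (0, z.2)).
Proof.
move=> oU U0 Cg e e0; have e2 : 0 < e / 2 by rewrite divr_gt0.
have [r1 r10 H1] := open_ex_norm oU U0.
have [r2 r20 H2] := continuous_ex_norm (Ck_cont (Ck_derive time_dir Cg) U0) e2.
apply: (@norm_nbhs _ _ _ (Num.min r1 r2)); first by rewrite lt_min r10.
move=> [h u]; rewrite lt_min => /andP[h1 h2] /=.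
have inU s : `|s| <= `|h| -> U (s, u).
  by move=> sh; apply: H1; exact: le_lt_trans (norm_slice _ _ sh) h1.
have near0 s : `|s| <= `|h| -> `|'D_time_dir g (s, u) - 'D_time_dir g (0, u0)| <= e / 2.
  by move=> sh; rewrite distrC; apply: H2; exact: le_lt_trans (norm_slice _ _ sh) h2.
have D s : `|s| <= `|h| ->
    is_derive s (1 : R) (fun s => g (s *: time_dir + (0, u))) ('D_time_dir g (s, u)).
  move=> sh; rewrite -(time_line s u); apply: is_derive_line.
  by rewrite time_line; exact: (Ck_is_derive _ Cg (inU s sh)).
have [c ch] := MVT_abs D.
rewrite !time_line => Ec.
have h0 : `|0 : R| <= `|h| by rewrite normr0.
rewrite opprD addrA Ec [h * _]mulrC -mulrBl normrM; apply: ler_wpM2r => //.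
exact: ler_dist_half (near0 c ch) (near0 0 h0).
Qed.

Lemma cong_taylor U g u0 : open U -> U (0, u0) -> Ck 1 U g ->
  cong (nbhs ((0, u0) : E)) fst (g (0, u0)) g
    (fun z => g (0, z.2) + z.1 * 'D_time_dir g (0, z.2)).
Proof.
move=> oU U0 Cg; apply: cong_small_diff; first exact: cvg_fst.
  exact: Ck_cont Cg U0.
exact: taylor_time oU U0 Cg.
Qed.

End taylor.

Section slice_partial.
Context (R : realType).
Local Notation E := (R * (R * R))%type.
Implicit Types (U : set E) (G : E -> 'rV[R]_4) (p : R * R -> 'rV[R]_4).

Lemma near_slice U (t : R) (u : R * R) : open U -> U (t, u) ->
  \forall v \near u, U (t, v).
Proof. by move=> oU Utu; apply: open_nbhs_nbhs; split=> //; exact: open_slice. Qed.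

Definition CkV n U G := forall k, Ck n U (fun z => G z 0 k).

Definition space_dir (i : 'I_2) : E := (0, coord_dir R i).

(** The derivative taken entrywise, where the theory of [Ck] applies. *)
Definition row_derive (v : E) G : E -> 'rV[R]_4 :=
  fun z => \row_k 'D_v (fun z => G z 0 k) z.

Lemma row_derive_coord v G z k : row_derive v G z 0 k = 'D_v (fun z => G z 0 k) z.
Proof. by rewrite mxE. Qed.

Lemma row_deriveE v G k : (fun z => row_derive v G z 0 k) = 'D_v (fun z => G z 0 k).
Proof. by apply/funext => z; rewrite mxE. Qed.

Lemma row_derive2_coord v w G z k :
  row_derive v (row_derive w G) z 0 k = 'D_v ('D_w (fun z => G z 0 k)) z.
Proof.
apply: (etrans (row_derive_coord v (row_derive w G) z k)).
exact: (congr1 (fun h => derive h z v) (row_deriveE w G k)).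
Qed.

Lemma CkV_derive n U v G : CkV n.+1 U G -> CkV n U (row_derive v G).
Proof. by move=> H k; rewrite row_deriveE; exact: Ck_derive. Qed.

Lemma slice_partial n U G t p i : open U -> CkV n.+1 U G ->
  (forall u, U (t, u) -> p u = G (t, u)) ->
  forall u, U (t, u) -> partial i p u = row_derive (space_dir i) G (t, u).
Proof.
move=> oU CG pG u Utu.
have N : \forall v \near u, U (t, v) by exact: near_slice.
have -> : partial i p u = 'D_(coord_dir R i) (fun u => G (t, u)) u.
  apply: near_eq_derive.
  by apply: filterS N => v; exact: pG.
rewrite (congr1 (fun h => h u) (derive_slice G t (coord_dir R i))) /= derive_mx; last first.
  apply/derivable_mxP => a k; rewrite (ord1 a).
  exact: Ck_derivable (CG k) Utu.
by apply/rowP => k; rewrite !mxE.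
Qed.

Lemma slice_partial2 n U G t p i j : open U -> CkV n.+2 U G ->
  (forall u, U (t, u) -> p u = G (t, u)) ->
  forall u, U (t, u) ->
  partial i (partial j p) u = row_derive (space_dir i) (row_derive (space_dir j) G) (t, u).
Proof.
move=> oU CG pG; apply: (slice_partial (n := n)) => //; first exact: CkV_derive.
exact: slice_partial oU CG pG.
Qed.

End slice_partial.

Section family.
Context (R : realType).
Local Notation E := (R * (R * R))%type.

(** A family of maps with value f and velocity V at time 0.  Only its values at the
    times in adm count, and there it must extend to a C^3 map g of time and space:
    admissible times are one-sided when the flow is considered at its initial time. *)
Definition smooth_family (adm : set R) (Phi : R -> R * R -> 'rV[R]_4)
    (f V : R * R -> 'rV[R]_4) (u0 : R * R) :=
  exists U (g : E -> 'rV[R]_4), [/\ open U, U (0, u0), CkV 3 U g &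
    [/\ forall t u, adm t -> U (t, u) -> Phi t u = g (t, u),
        forall u, U (0, u) -> f u = g (0, u) &
        forall u, U (0, u) -> V u = row_derive (time_dir R) g (0, u)]].

Definition time_filter (adm : set R) (u0 : R * R) : set_system E :=
  within [set z : E | adm z.1] (nbhs ((0, u0) : E)).

#[global] Instance time_filter_filter adm u0 : Filter (time_filter adm u0).
Proof. exact: within_filter. Qed.

Context (adm : set R) (Phi : R -> R * R -> 'rV[R]_4) (f V : R * R -> 'rV[R]_4).
Context (u0 : R * R).
Hypothesis HF : smooth_family adm Phi f V u0.

Local Notation vcong := (vcong (time_filter adm u0) fst).

Lemma cong_within (a b : E -> R) l :
  cong (nbhs ((0, u0) : E)) fst l a b -> cong (time_filter adm u0) fst l a b.
Proof.
move=> [a1 b1 d1]; split.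
- by apply: cvg_trans a1; apply: cvg_app; exact: cvg_within.
- by apply: cvg_trans b1; apply: cvg_app; exact: cvg_within.
- by move=> e e0; apply: cvg_within; exact: d1.
Qed.

Lemma vcong_family_taylor (U : set E) (g : E -> 'rV[R]_4)
    (p : R -> R * R -> 'rV[R]_4) (q w : R * R -> 'rV[R]_4) :
  open U -> U (0, u0) -> CkV 1 U g ->
  (forall t u, adm t -> U (t, u) -> p t u = g (t, u)) ->
  (forall u, U (0, u) -> q u = g (0, u)) ->
  (forall u, U (0, u) -> w u = row_derive (time_dir R) g (0, u)) ->
  vcong (q u0) (fun z => p z.1 z.2) (fun z => q z.2 + z.1 *: w z.2).
Proof.
move=> oU U0 Cg pg qg wg k; rewrite qg //.
have N1 : \forall z \near ((0, u0) : E), U z by exact: open_nbhs_nbhs.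
have N2 : \forall z \near ((0, u0) : E), U (0, z.2).
  have : \forall u \near u0, U (0, u).
    exact: near_slice.
  by apply: (@cvg_snd R (R * R)%type (nbhs (0:R)) (nbhs u0)).
apply: (cong_near _ _ (cong_within (cong_taylor oU U0 (Cg k)))).
  by apply: filterS N1 => -[t u] /= Utu ta; rewrite pg.
apply: cvg_within; apply: filterS N2 => -[t u] /= U0u.
by rewrite !mxE qg // wg // mxE.
Qed.

Lemma row_derive_comm n (U : set E) v w (g : E -> 'rV[R]_4) : open U -> CkV n.+2 U g ->
  forall z, U z -> row_derive v (row_derive w g) z = row_derive w (row_derive v g) z.
Proof.
move=> oU Cg z Uz; apply/rowP => k.
have C2 : Ck 2 U (fun z => g z 0 k).
  move: (Cg k) => {Cg Uz}; elim: n => [//|n IH] C; apply: IH; exact: CkW C.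
have S := Ck_schwarz v w oU C2 Uz.
exact: (etrans (row_derive2_coord v w g z k) (etrans S (esym (row_derive2_coord w v g z k)))).
Qed.

Lemma row_derive_ext (U : set E) v (g h : E -> 'rV[R]_4) : open U ->
  (forall z, U z -> g z = h z) -> forall z, U z -> row_derive v g z = row_derive v h z.
Proof.
move=> oU gh z Uz; apply/rowP => k.
apply: (etrans (row_derive_coord v g z k)).
apply: (etrans _ (esym (row_derive_coord v h z k))).
apply: near_eq_derive.
by apply: filterS (open_nbhs_nbhs (conj oU Uz)) => y Uy; rewrite gh.
Qed.

Lemma vcong_family : vcong (f u0) (fun z => Phi z.1 z.2) (fun z => f z.2 + z.1 *: V z.2).
Proof.
have [U [g [oU U0 Cg [H1 H2 H3]]]] := HF.
by apply: vcong_family_taylor oU U0 _ H1 H2 H3 => k; do 2 apply: CkW; exact: Cg.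
Qed.

(** The first order term is the time derivative of d_i g; exchanging the derivatives
    makes it d_i V. *)
Lemma vcong_family1 i : vcong (partial i f u0)
  (fun z => partial i (Phi z.1) z.2)
  (fun z => partial i f z.2 + z.1 *: partial i V z.2).
Proof.
have [U [g [oU U0 Cg [H1 H2 H3]]]] := HF.
have Cg1 : CkV 2 U (row_derive (space_dir R i) g) by exact: CkV_derive.
apply: (@vcong_family_taylor U (row_derive (space_dir R i) g)
  (fun t => partial i (Phi t)) (partial i f) (partial i V) oU U0).
- by move=> k; apply: CkW; exact: Cg1.
- by move=> t u ta; apply: (slice_partial i oU Cg) => v; exact: H1.
- exact: (slice_partial i oU Cg H2).
- move=> u U0u; rewrite (row_derive_comm (time_dir R) (space_dir R i) oU Cg U0u).
  exact: (slice_partial i oU (CkV_derive (time_dir R) Cg) H3 U0u).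
Qed.

Lemma vcong_family2 i j : vcong (partial i (partial j f) u0)
  (fun z => partial i (partial j (Phi z.1)) z.2)
  (fun z => partial i (partial j f) z.2 + z.1 *: partial i (partial j V) z.2).
Proof.
have [U [g [oU U0 Cg [H1 H2 H3]]]] := HF.
have Cj : CkV 2 U (row_derive (space_dir R j) g) by exact: CkV_derive.
have Cij : CkV 1 U (row_derive (space_dir R i) (row_derive (space_dir R j) g)).
  exact: CkV_derive.
apply: (@vcong_family_taylor U (row_derive (space_dir R i) (row_derive (space_dir R j) g))
  (fun t => partial i (partial j (Phi t))) (partial i (partial j f))
  (partial i (partial j V)) oU U0 Cij).
- by move=> t u ta; apply: (slice_partial2 i j oU Cg) => v; exact: H1.
- exact: (slice_partial2 i j oU Cg H2).
- move=> u U0u; rewrite (row_derive_comm (time_dir R) (space_dir R i) oU Cj U0u).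
  rewrite (row_derive_ext (space_dir R i) oU
    (row_derive_comm (time_dir R) (space_dir R j) oU Cg) U0u).
  exact: (slice_partial2 i j oU (CkV_derive (time_dir R) Cg) H3 U0u).
Qed.

End family.

(** * The flow and the normal variation as smooth families *)

Lemma derive_translate (R : realType) (V W : normedModType R) (f : V -> W) (a x v : V) :
  'D_v (fun y => f (y + a)) x = 'D_v f (x + a).
Proof.
rewrite /derive; f_equal; f_equal.
by apply/funext => h /=; rewrite addrA.
Qed.

Section flow_family.
Context (R : realType) (T : \bar R) (F : R -> R * R -> 'rV[R]_4) (t0 : R).
Local Notation E := (R * (R * R))%type.
Let A : set E := [set p : E | 0 <= p.1 /\ (p.1%:E < T)%E].
Hypothesis smF : smooth_on A (fun p : E => F p.1 p.2).
Hypothesis t00 : 0 <= t0.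
Hypothesis t0T : (t0%:E < T)%E.
Variable V : R * R -> 'rV[R]_4.
Hypothesis velF : forall u,
  h^-1 *: (F (t0 + h) u - F t0 u) @[h --> within [set h | 0 <= t0 + h] (0 : R)^'] --> V u.

Definition admissible : set R := [set h | 0 <= t0 + h /\ ((t0 + h)%:E < T)%E].

Lemma admissible_near : \forall h \near (0 : R), ((t0 + h)%:E < T)%E.
Proof.
case: T t0T => [r| |] //; last by move=> _; near=> h; exact: ltry.
rewrite lte_fin => tr.
have d0 : 0 < r - t0 by rewrite subr_gt0.
apply: (norm_nbhs d0) => h; rewrite sub0r normrN lte_fin -ltrBrDl.
by move/(le_lt_trans (ler_norm _)).
Unshelve. all: by end_near. Qed.

(** The filter of one-sided approach is proper, so limits along it are unique. *)
Lemma right_proper : ProperFilter (within [set h | 0 <= t0 + h] (0 : R)^').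
Proof.
apply: Build_ProperFilter_ex => B [e /= e0 He].
have e2 : 0 < e / 2 by rewrite divr_gt0.
exists (e / 2); apply: (He (e / 2)) => /=.
- by rewrite sub0r normrN gtr0_norm // ltr_pdivrMr // ltr_pMr // ltr1n.
- by rewrite gt_eqF.
- by rewrite addr_ge0 // ltW.
Qed.

(** The quotient defining the velocity may be one-sided, but the local extension g has
    a two-sided time derivative, which must then be the same limit. *)
Lemma flow_velocity (U : set E) (g : E -> 'rV[R]_4) : open U -> smooth_open U g ->
  (forall y, U y -> A y -> F y.1 y.2 = g y) ->
  forall u, U (t0, u) -> V u = 'D_(time_dir R) g (t0, u).
Proof.
move=> oU sg Fg u Uu.
have D : derivable g (t0, u) (time_dir R) by exact: smooth_open_derivable sg Uu.
have PF := right_proper.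
apply: (norm_cvg_unique (@velF u)).
have D' : h^-1 *: (g (h *: time_dir R + (t0, u)) - g (t0, u))
  @[h --> within [set h | 0 <= t0 + h] (0 : R)^'] --> 'D_(time_dir R) g (t0, u).
  apply: cvg_trans D; apply: cvg_app; exact: cvg_within.
apply: cvg_trans D'; apply: near_eq_cvg.
have tE h : h *: time_dir R + (t0, u) = (t0 + h, u) :> E.
  rewrite /time_dir; case: (u) => x y.
  by congr (_, (_, _)) => /=; rewrite ?scaler0 ?add0r // addrC [_ *: _]mulr1.
have N1 : \forall h \near (0 : R), U (t0 + h, u).
  have [r r0 Hr] := open_ex_norm oU Uu.
  apply: (norm_nbhs r0) => h; rewrite sub0r normrN => hr; apply: Hr.
  rewrite prod_normE /= subrr normr0 opprD addNKr normrN.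
  by rewrite gt_max hr r0.
have N : \forall h \near (0 : R)^', 0 <= t0 + h ->
    h^-1 *: (g (h *: time_dir R + (t0, u)) - g (t0, u)) = h^-1 *: (F (t0 + h) u - F t0 u).
  apply: cvg_within; apply: filterS2 admissible_near N1 => h hT hU h0.
  by rewrite tE -(Fg (t0 + h, u)) // -(Fg (t0, u)).
exact: N.
Qed.

Lemma smooth_velocity : smooth_open setT V.
Proof.
apply: smooth_open_local => u _.
have [U [g [oU Uu sg Fg]]] := smF (x := (t0, u)) (conj t00 t0T).
exists [set u | U (t0, u)], (fun u => 'D_(time_dir R) g (t0, u)); split => //.
- exact: open_slice.
- exact: (@smooth_open_slice R _ U _ t0 (smooth_open_derive (time_dir R) sg)).
- by move=> v; exact: (flow_velocity oU sg Fg).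
Qed.

Lemma flow_family u0 :
  smooth_family admissible (fun h => F (t0 + h)) (F t0) V u0.
Proof.
have [U [g [oU Uu sg Fg]]] := smF (x := (t0, u0)) (conj t00 t0T).
(* Translate time so that t0 becomes 0. *)
pose a : E := (t0, 0).
have aE (h : R) (u : R * R) : ((h, u) : E) + a = (t0 + h, u).
  by rewrite /a; congr (_, _) => /=; [rewrite addrC|rewrite addr0].
have aE0 (u : R * R) : ((0, u) : E) + a = (t0, u) by rewrite aE addr0.
exists [set z | U (z + a)], (fun z => g (z + a)); split.
- apply: (open_comp _ oU) => z _.
  by apply: (@continuousD _ _ _ idfun (cst a)); [by move=> B|exact: cst_continuous].
- by rewrite /= aE0.
- by move=> k; apply: (@Ck_shift _ _ 3 U (fun z => g z 0 k)); exact: smooth_open_component.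
split=> [h u [h0 hT] /=|u /=|u /=].
- by rewrite aE => Uh; rewrite -Fg.
- by rewrite aE0 => U0; rewrite -Fg.
- rewrite aE0 => U0; rewrite (flow_velocity oU sg Fg U0).
  have D : derivable g (t0, u) (time_dir R) by exact: smooth_open_derivable sg U0.
  apply/rowP => k; rewrite -(derive_component 0 k D).
  apply: (etrans _ (esym (row_derive_coord _ _ _ _))).
  apply: (etrans _ (esym (derive_translate (fun z => g z 0 k) _ _ _))).
  by rewrite aE0.
Qed.

End flow_family.

Section variation_family.
Context (R : realType) (f V : R * R -> 'rV[R]_4).
Local Notation E := (R * (R * R))%type.
Hypothesis smf : smooth_open setT f.
Hypothesis smV : smooth_open setT V.
Hypothesis ff : forall u, dot (f u) (f u) = 1.
Hypothesis fV : forall u, dot (V u) (f u) = 0.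

Lemma dot_variation u (e : R) :
  dot (f u + e *: V u) (f u + e *: V u) = 1 + e ^+ 2 * dot (V u) (V u).
Proof.
rewrite dotDl !dotDr !dotZl !dotZr ff (dotC (f u)) fV.
by rewrite !mulr0 addr0 add0r mulrA expr2.
Qed.

Lemma variation_CkV : CkV 3 setT (fun z : E => to_S3 (f z.2 + z.1 *: V z.2)).
Proof.
pose w (z : E) := f z.2 + z.1 *: V z.2.
move=> k; rewrite /to_S3 /enorm.
have Cf j : Ck 3 setT (fun z : E => f z.2 0 j).
  exact: (Ck_snd (smooth_open_component 0 j 3 openT smf)).
have CV j : Ck 3 setT (fun z : E => V z.2 0 j).
  exact: (Ck_snd (smooth_open_component 0 j 3 openT smV)).
have Cw j : Ck 3 setT (fun z => w z 0 j).
  have := CkD openT (Cf j) (CkM openT (Ck_fst 3 setT) (CV j)).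
  by apply: (Ck_ext openT) => z _; rewrite !mxE.
have Cd : Ck 3 setT (fun z => dot (w z) (w z)).
  apply: Ck_sum; first exact: openT.
  by move=> j; exact: (CkM openT (Cw j) (Cw j)).
have pos z : setT z -> 0 < dot (w z) (w z).
  move=> _; rewrite dot_variation; apply: ltr_pwDl; first exact: ltr01.
  by apply: mulr_ge0; [exact: sqr_ge0|exact: dot_ge0].
have := CkM openT (Ck_rsqrt openT pos Cd) (Cw k).
by apply: (Ck_ext openT) => z _; rewrite [in RHS]mxE.
Qed.

(** As V is orthogonal to f, |f + e V|^2 = 1 + e^2 |V|^2: the projection to the sphere
    does not affect the velocity. *)
Lemma variation_family u0 :
  smooth_family setT (fun e u => to_S3 (f u + e *: V u)) f V u0.
Proof.
pose w (z : E) := f z.2 + z.1 *: V z.2.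
exists setT, (fun z => to_S3 (w z)); split => //;
  [exact: openT|exact: variation_CkV|].
have w0 u : to_S3 (w (0, u)) = f u.
  by rewrite /w /to_S3 /enorm dot_variation /= expr0n mul0r addr0 sqrtr1 invr1 !scale1r scale0r addr0.
split=> [t u _ _ //|u _|u _]; first by rewrite w0.
apply/rowP => k; apply: (etrans _ (esym (row_derive_coord _ _ _ _))).
apply: esym; suff /@derive_val : is_derive ((0, u) : E) (time_dir R) (fun z => to_S3 (w z) 0 k) (V u 0 k) by [].
apply: is_derive_line0.
have -> : (fun s : R => to_S3 (w (s *: time_dir R + (0, u))) 0 k) =
    (fun s => (Num.sqrt (1 + s ^+ 2 * dot (V u) (V u)))^-1 * (f u 0 k + s * V u 0 k)).
  by apply/funext => s; rewrite time_line /to_S3 /enorm /w dot_variation !mxE.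
set m := dot (V u) (V u).
have D1 : is_derive (0 : R) (1 : R) (fun s : R => 1 + s ^+ 2 * m) 0.
  have -> : (fun s : R => 1 + s ^+ 2 * m) = cst 1 + m \*: (id * id : R -> R).
    by apply/funext => s /=; rewrite mulrC expr2.
  have := is_deriveD (is_derive_cst (1 : R) (0 : R) (1 : R))
    (is_deriveZ m (is_deriveM (is_derive_id (0 : R) (1 : R)) (is_derive_id (0 : R) (1 : R)))).
  by move/is_derive_eq; apply; rewrite /= !scale0r !addr0 scaler0 ?addr0.
have D2 : is_derive (0 : R) (1 : R) (fun s : R => f u 0 k + s * V u 0 k) (V u 0 k).
  have -> : (fun s : R => f u 0 k + s * V u 0 k) = cst (f u 0 k) + V u 0 k \*: (id : R -> R).
    by apply/funext => s /=; rewrite mulrC.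
  have := is_deriveD (is_derive_cst (f u 0 k) (0 : R) (1 : R))
    (is_deriveZ (V u 0 k) (is_derive_id (0 : R) (1 : R))).
  by move/is_derive_eq; apply; rewrite add0r [_ *: _]mulr1.
have x0 : 0 < 1 + 0 ^+ 2 * m by rewrite expr0n mul0r addr0.
have D3 := @is_derive1_comp _ (fun y => (Num.sqrt y)^-1) _ 0 _ _ (is_derive_rsqrt x0) D1.
have := is_deriveM D3 D2; move/is_derive_eq; apply => /=.
rewrite expr0n mul0r addr0 sqrtr1 invr1 scale1r mulr0 scaler0 addr0 //.
Qed.

End variation_family.

(** * Measurability in the plane and integrals against a density *)

Section plane_measurable.
Context (R : realType).
Local Notation P := (measurableTypeR R * measurableTypeR R)%type.

(** Rational boxes form a countable base of the plane. *)
Lemma open_measurable_plane (O : set (R * R)) : open O -> measurable (O : set P).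
Proof.
move=> oO.
pose box (q : (rat * rat) * (rat * rat)) : set P :=
  `]ratr q.1.1, ratr q.1.2[ `*` `]ratr q.2.1, ratr q.2.2[.
(* The boxes with rational corners that lie in O. *)
pose F q := if `[< box q `<=` O >] then box q else set0.
have -> : O = \bigcup_q F q.
  apply/seteqP; split=> [[x y] Oxy|xy [q _]]; last first.
    by rewrite /F; case: asboolP => // + ?; exact.
  have [e /= e0 He] := (nbhs_ballP _ _).1 (open_nbhs_nbhs (conj oO Oxy)).
  have lo (z : R) : z - e < z by rewrite ltrBlDr ltrDl.
  have hi (z : R) : z < z + e by rewrite ltrDl.
  have [a] := rat_in_itvoo (lo x); have [b] := rat_in_itvoo (hi x).
  have [c] := rat_in_itvoo (lo y); have [d] := rat_in_itvoo (hi y).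
  rewrite !in_itv /= => /andP[d1 d2] /andP[c1 c2] /andP[b1 b2] /andP[a1 a2].
  exists ((a, b), (c, d)) => //; rewrite /F; case: asboolP => [_|[]].
    by split; rewrite /= in_itv /=; apply/andP.
  move=> [u v] [/=]; rewrite !in_itv /= => /andP[u1 u2] /andP[v1 v2].
  apply: He; split; rewrite /= /ball /= ltr_norml; apply/andP; split; lra.
apply: countable_bigcupT_measurable; first exact: countableP.
move=> q.
rewrite /F; case: asboolP => // _.
by apply: measurableX; exact: measurable_itv.
Qed.

Lemma continuous_measurable_plane (D : set P) (a : R * R -> R) :
  continuous a -> measurable_fun D (a : P -> R).
Proof.
move=> ca; apply: (@measurable_funS _ _ P _ setT) => //.
apply: (measurability _ (measurable_realfun.RGenOpens.measurableE R)).
move=> _ [_ [x [y ->] <-]]; rewrite setTI; apply: open_measurable_plane.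
by apply: open_comp.
Qed.

End plane_measurable.

Section density.
Local Open Scope ereal_scope.
Context d (T : measurableType d) (R : realType) (mu : {measure set T -> \bar R}).
Variables (D : set T) (g : T -> R).
Hypothesis mD : measurable D.
Hypothesis mg : measurable_fun D g.
Hypothesis g0 : forall x, (0 <= g x)%R.

Definition density_measure (A : set T) : \bar R := \int[mu]_(x in D `&` A) (g x)%:E.

Let nu0 : density_measure set0 = 0.
Proof. by rewrite /density_measure setI0 integral_set0. Qed.

Let nu_ge0 A : 0 <= density_measure A.
Proof. by apply: integral_ge0 => x _; rewrite lee_fin. Qed.

Let nu_sigma_additive : semi_sigma_additive density_measure.
Proof.
move=> A mA tA mUA; rewrite /density_measure setI_bigcupr ge0_integral_bigcup.
- apply: is_cvg_ereal_nneg_natsum_cond => n _ _.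
  by apply: integral_ge0 => x _; rewrite lee_fin.
- by move=> k; exact: measurableI.
- apply/measurable_EFinP; apply: measurable_funS mg => //.
  by move=> x [i _ []].
- by move=> x _; rewrite lee_fin.
- exact: trivIset_setIl.
Qed.

Let nu : {measure set T -> \bar R} := HB.pack density_measure
  (isMeasure.Build _ _ _ density_measure nu0 nu_ge0 nu_sigma_additive).

Import HBNNSimple.

Let simple_integral_density (h : {nnsfun T >-> R}) :
  \int[nu]_x (h x)%:E = \int[mu]_(x in D) ((h x)%:E * (g x)%:E).
Proof.
rewrite integralT_nnsfun sintegralE.
under [RHS]eq_integral => x _.
  rewrite (fimfunE h x) -fsumEFin // ge0_mule_fsuml; last first.
    by move=> r; exact: nnfun_muleindic_ge0.
  over.
rewrite ge0_integral_fsum //; last 2 first.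
- move=> r; apply: emeasurable_funM; apply/measurable_EFinP => //.
  by apply: measurable_funTS; exact: measurable_funM.
- move=> r x _; apply: mule_ge0; first exact: nnfun_muleindic_ge0.
  by rewrite lee_fin.
apply: eq_fsbigr => r; rewrite inE => -[t _ ht].
have r0 : (0 <= r)%R by rewrite -ht.
have mr : measurable (h @^-1` [set r]) by exact: measurable_sfunP.
under [RHS]eq_integral do rewrite EFinM -muleA.
rewrite ge0_integralZl //; last 2 first.
- apply: emeasurable_funM; apply/measurable_EFinP => //.
- by move=> x _; rewrite -EFinM lee_fin mulr_ge0.
congr (_ * _); rewrite /nu /= /density_measure integral_mkcondr.
by apply: eq_integral => x _; rewrite epatch_indic muleC.
Qed.

Let ge0_integral_density (f : T -> \bar R) : measurable_fun setT f ->
  (forall x, 0 <= f x) ->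
  \int[nu]_x f x = \int[mu]_(x in D) (f x * (g x)%:E).
Proof.
move=> mf f0; pose h := nnsfun_approx measurableT mf.
have hf x : (EFin \o h ^~ x) n @[n --> \oo] --> f x by exact: cvg_nnsfun_approx.
have hnd x m n : (m <= n)%N -> (h m x <= h n x)%R.
  by move=> mn; exact/lefP/nd_nnsfun_approx.
have M1 n : measurable_fun setT (fun x => (h n x)%:E) by exact/measurable_EFinP.
have P1 n x : setT x -> 0 <= (h n x)%:E by rewrite lee_fin.
have N1 x : setT x -> {homo (fun n => (h n x)%:E) : m n / (m <= n)%N >-> m <= n}.
  by move=> _ m n mn; rewrite lee_fin; exact: hnd.
have M2 n : measurable_fun D (fun x => (h n x)%:E * (g x)%:E).
  apply: emeasurable_funM; apply/measurable_EFinP => //.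
  exact: measurable_funTS.
have P2 n x : D x -> 0 <= (h n x)%:E * (g x)%:E.
  by move=> _; rewrite -EFinM lee_fin mulr_ge0.
have N2 x : D x -> {homo (fun n => (h n x)%:E * (g x)%:E) : m n / (m <= n)%N >-> m <= n}.
  by move=> _ m n mn; rewrite -!EFinM lee_fin ler_wpM2r // hnd.
have E1 := monotone_convergence nu measurableT M1 P1 N1.
have E2 := monotone_convergence mu mD M2 P2 N2.
transitivity (\int[nu]_x limn (fun n => (h n x)%:E)).
  by apply: eq_integral => x _; apply/esym/cvg_lim => //; exact: hf.
rewrite E1; transitivity (\int[mu]_(x in D) limn (fun n => (h n x)%:E * (g x)%:E)).
  by rewrite E2; congr (limn _); apply/funext => n; exact: simple_integral_density.
by apply: eq_integral => x _; apply/cvg_lim => //; apply: cvgeZr => //; exact: hf.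
Qed.

(** Holds for the positive and the negative part of f separately, because the density g
    is nonnegative. *)
Lemma integral_pushforward_density d' (Y : measurableType d') (phi : T -> Y)
    (B : set Y) (f : Y -> R) :
  measurable_fun setT phi -> measurable B -> (forall x, B (phi x)) ->
  measurable_fun B f ->
  \int[pushforward density_measure phi]_(y in B) (f y)%:E =
  \int[mu]_(x in D) (f (phi x) * g x)%:E.
Proof.
move=> mphi mB phiB mf.
have preB : phi @^-1` B = setT by apply/seteqP; split=> x // _; exact: phiB.
have key (k : Y -> \bar R) : measurable_fun B k -> (forall y, 0 <= k y) ->
    \int[pushforward density_measure phi]_(y in B) k y =
    \int[mu]_(x in D) (k (phi x) * (g x)%:E).
  move=> mk k0; have := ge0_integral_pushforward mphi nu mB mk.
  move=> ->; last by move=> y _; exact: k0.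
  rewrite preB; apply: ge0_integral_density; last by move=> x; exact: k0.
  by apply: (measurable_comp mB) => // _ [x _ <-].
have mE : measurable_fun B (fun y => (f y)%:E) by exact/measurable_EFinP.
pose phi' : {mfun T >-> Y} := HB.pack phi (isMeasurableFun.Build _ _ _ _ _ mphi).
have E := integralE (pushforward nu phi' : {measure set Y -> \bar R}) B (fun y => (f y)%:E).
rewrite [LHS]E (key _ (measurable_funepos mE) (funepos_ge0 _)).
rewrite (key _ (measurable_funeneg mE) (funeneg_ge0 _)).
rewrite [RHS]integralE; congr (_ - _); apply: eq_integral => x _.
  rewrite !funeposE; have [h|h] := leP 0%R (f (phi x)).
    by rewrite !max_l ?lee_fin ?mulr_ge0 // EFinM.
  by rewrite !max_r ?mul0e ?lee_fin ?nmulr_rle0 ?g0 // ltW.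
rewrite !funenegE; have [h|h] := leP 0%R (f (phi x)).
  by rewrite !max_r ?mul0e // -EFinN lee_fin oppr_le0 // mulr_ge0.
rewrite -!EFinN !max_l ?lee_fin.
- by rewrite -EFinM mulNr.
- by rewrite oppr_ge0 mulr_le0_ge0 // ltW.
- by rewrite oppr_ge0 ltW.
Qed.

End density.

(** * Strict differentiability and immersions *)

Section strict_differentiability.
Context (R : realType) (V : normedModType R).

(** Go from q to its translate one direction at a time and apply the mean value theorem
    to each step. *)
Lemma strict_diff (U : set V) (f : V -> R) x n (d : 'I_n -> V) (e : R) :
  open U -> U x -> (forall i y, U y -> derivable f y (d i)) ->
  (forall i, {for x, continuous ('D_(d i) f)}) -> 0 < e ->
  exists2 r : R, 0 < r & forall (q : V) (t : 'I_n -> R),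
    `|x - q| < r -> (forall i, `|t i| < r) ->
    `|f (\sum_i t i *: d i + q) - f q - \sum_i t i * 'D_(d i) f q| <=
      e * \sum_i `|t i|.
Proof.
move=> oU Ux + + e0; elim: n d => [|n IH] d Df Cf.
  exists 1 => // q t _ _.
  by rewrite !big_ord0 add0r subrr subr0 normr0 mulr0.
have [r1 r10 H1] := IH (fun i => d (lift ord0 i))
  (fun i => Df (lift ord0 i)) (fun i => Cf (lift ord0 i)).
have e2 : 0 < e / 2 by rewrite divr_gt0.
have [r2 r20 H2] := continuous_ex_norm (Cf ord0) e2.
have [r3 r30 H3] := open_ex_norm oU Ux.
pose rho : R := Num.min r2 r3.
have rho0 : 0 < rho by rewrite lt_min r20.
pose K : R := 1 + \sum_i `|d i|.
have S0 : 0 <= \sum_i `|d i| by apply: sumr_ge0 => i _; exact: normr_ge0.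
have K0 : 0 < K by rewrite /K; lra.
pose r : R := Num.min r1 (rho / K).
have rK : 0 < rho / K by rewrite divr_gt0.
exists r; first by rewrite lt_min r10.
move=> q t xq tr.
have rr1 : r <= r1 by rewrite ge_min lexx.
have rrho : r * K <= rho.
  by rewrite -ler_pdivlMr // ge_min lexx orbT.
have r0 : 0 <= r by rewrite le_min (ltW r10) (ltW rK).
set S := \sum_(i < n) t (lift ord0 i) *: d (lift ord0 i).
have nS : `|S| <= r * \sum_(i < n) `|d (lift ord0 i)|.
  apply: (le_trans (ler_norm_sum _ _ _)); rewrite mulr_sumr.
  apply: ler_sum => i _; rewrite normrZ; apply: ler_wpM2r; first exact: normr_ge0.
  by apply: ltW; exact: tr.
have near_x (s : R) : `|s| <= `|t ord0| -> `|x - (s *: d ord0 + (S + q))| < rho.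
  move=> st.
  have -> : x - (s *: d ord0 + (S + q)) = (x - q) - (s *: d ord0 + S).
    by rewrite addrA [_ + q]addrC opprD addrA.
  apply: (le_lt_trans (ler_normB _ _)).
  have h1 : `|s *: d ord0| <= r * `|d ord0|.
    rewrite normrZ; apply: ler_wpM2r; first exact: normr_ge0.
    by apply: (le_trans st); apply: ltW; exact: tr.
  have h2 := ler_normD (s *: d ord0) S.
  have h3 : r * K = r + (r * `|d ord0| + r * \sum_(i < n) `|d (lift ord0 i)|).
    by rewrite /K big_ord_recl mulrDr mulr1 mulrDr.
  move: h1 h2 h3 nS xq rrho.
  move: `|x - q| `|s *: d ord0| `|S| `|s *: d ord0 + S| (r * `|d ord0|) (r * \sum_(i < n) _) (r * K).
  by move=> *; lra.
have near_q : `|x - q| < rho.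
  apply: (lt_le_trans xq); apply: le_trans rrho.
  by rewrite -[leLHS]mulr1; apply: ler_wpM2l => //; rewrite /K; lra.
have lin2 y : `|x - y| < rho -> `|'D_(d ord0) f y - 'D_(d ord0) f x| <= e / 2.
  move=> xy; rewrite distrC; apply: H2; apply: (lt_le_trans xy).
  by rewrite ge_min lexx.
have D s : `|s| <= `|t ord0| -> is_derive s (1 : R)
    (fun s => f (s *: d ord0 + (S + q))) ('D_(d ord0) f (s *: d ord0 + (S + q))).
  move=> st; apply: is_derive_line; apply: DeriveDef => //; apply: Df.
  apply: H3; apply: (lt_le_trans (near_x s st)).
  by rewrite ge_min lexx orbT.
have [c ct] := MVT_abs D.
rewrite scale0r add0r => Ec.
have HS := H1 q (fun i => t (lift ord0 i)) (lt_le_trans xq rr1)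
  (fun i => lt_le_trans (tr (lift ord0 i)) rr1).
rewrite -/S in HS.
rewrite !big_ord_recl -/S -(addrA _ S q).
have Hc := ler_dist_half (lin2 _ (near_x c ct)) (lin2 _ near_q).
have H0 : `|f (t ord0 *: d ord0 + (S + q)) - f (S + q) - t ord0 * 'D_(d ord0) f q|
    <= e * `|t ord0|.
  rewrite Ec [_ * t ord0]mulrC -mulrBr normrM mulrC.
  by apply: ler_wpM2r => //; exact: normr_ge0.
rewrite mulrDr.
apply: le_trans (lerD H0 HS); apply: le_trans (ler_normD _ _).
rewrite le_eqVlt; apply/orP; left; apply/eqP; congr (`|_|).
by ring.
Qed.

(** Additivity of the directional derivative in the direction, which follows from
    strict differentiability at x. *)
Lemma derive_linear (U : set V) (f : V -> R) x n (d : 'I_n -> V) (t : 'I_n -> R) :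
  open U -> U x -> Ck 1 U f ->
  'D_(\sum_i t i *: d i) f x = \sum_i t i * 'D_(d i) f x.
Proof.
move=> oU Ux Cf; set v := \sum_i t i *: d i; set l := \sum_i _.
apply: cvg_lim => //; apply/cvgrPdist_le => e e0.
pose K : R := 1 + \sum_i `|t i|.
have S0 : 0 <= \sum_i `|t i| by apply: sumr_ge0 => i _; exact: normr_ge0.
have K0 : 0 < K by rewrite /K; lra.
have eK : 0 < e / K by rewrite divr_gt0.
have Df i y : U y -> derivable f y (d i) by exact: Ck_derivable Cf.
have Cd i := Ck_cont (Ck_derive (d i) Cf) Ux.
have [r r0 H] := strict_diff oU Ux Df Cd eK.
have rK : 0 < r / K by rewrite divr_gt0.
have N : \forall h \near (0 : R), `|h| < r / K.
  by apply: (norm_nbhs rK) => h; rewrite sub0r normrN.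
have N' : \forall h \near (0 : R)^', `|h| < r / K by apply: cvg_within.
have N0 : \forall h \near (0 : R)^', h != 0 by exact: nbhs_dnbhs_neq.
apply: filterS2 N' N0 => h hr h0 /=.
have tr i : `|h * t i| < r.
  rewrite normrM; apply: (@le_lt_trans _ _ (`|h| * K)).
    apply: ler_wpM2l; first exact: normr_ge0.
    rewrite /K (bigD1 i) //= -[leLHS]add0r.
    have : 0 <= \sum_(j < n | j != i) `|t j| by apply: sumr_ge0 => j _; exact: normr_ge0.
    by move: (\sum_(j < n | _) _) `|t i| => a b a0; lra.
  by rewrite -ltr_pdivlMr.
have xx : `|x - x| < r by rewrite subrr normr0.
have := H x (fun i => h * t i) xx tr.
have -> : \sum_i (h * t i) *: d i = h *: v.
  by rewrite /v scaler_sumr; apply: eq_bigr => i _; rewrite scalerA.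
have -> : \sum_i h * t i * 'D_(d i) f x = h * l.
  by rewrite /l mulr_sumr; apply: eq_bigr => i _; rewrite mulrA.
have -> : \sum_i `|h * t i| = `|h| * \sum_i `|t i|.
  by rewrite mulr_sumr; apply: eq_bigr => i _; rewrite normrM.
move: (f (h *: v + x)) (f x) => a b HH.
have -> : l - h^-1 *: (a - b) = - (h^-1 * (a - b - h * l)).
  rewrite /GRing.scale /=; field; exact: h0.
rewrite normrN normrM normfV ler_pdivrMl ?normr_gt0 //.
apply: (le_trans HH); rewrite mulrCA; apply: ler_wpM2l; first exact: normr_ge0.
rewrite -[leRHS](divfK (lt0r_neq0 K0)); apply: ler_wpM2l; first exact: ltW.
by rewrite /K; lra.
Qed.

End strict_differentiability.

Section immersion.
Context (R : realType) (p : R * R -> 'rV[R]_4) (u : R * R).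
Hypothesis smp : smooth_open setT p.
Hypothesis immp : forall v, 'D_v p u = 0 -> v = 0.

Lemma derive_plane (x y : R) :
  'D_(x, y) p u = x *: partial 0 p u + y *: partial 1 p u.
Proof.
have dp v : derivable p u v by exact: (smooth_open_derivable smp I).
apply/rowP => k; rewrite !mxE -!(derive_component 0 k (dp _)).
have Ck1 := smooth_open_component 0 k 1 openT smp.
pose t (i : 'I_2) : R := if i == 0 then x else y.
have := derive_linear (x := u) (coord_dir R) t openT I Ck1.
rewrite !big_ord_recl !big_ord0 !addr0 lift01 /t /coord_dir /=.
by congr (derive _ _ _ = _); congr (_, _); rewrite /= ?scaler0 ?addr0 ?add0r [_ *: _]mulr1.
Qed.

(** If the Gram determinant vanished, the partial derivatives would be dependent, and
    some directional derivative would vanish. *)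
Lemma det_metric_gt0 : 0 < \det (metric p u).
Proof.
rewrite det_mx2 !mxE -/(partial _ p) (dotC (partial 1 p u)).
set a := partial 0 p u; set b := partial 1 p u.
have bn0 : b != 0.
  apply/eqP => b0; have := @immp (0, 1).
  rewrite derive_plane -/a -/b b0 scale0r scaler0 addr0 => /(_ erefl) [] /eqP.
  by rewrite oner_eq0.
have bb : 0 < dot b b.
  rewrite lt_def dot_ge0 andbT; apply: contra bn0 => /eqP b0.
  by rewrite (dot_eq0 b0).
have : dot b b *: a - dot a b *: b != 0.
  apply/eqP => E; have := @immp (dot b b, - dot a b).
  rewrite derive_plane scaleNr => /(_ E) [] bb0 _.
  by move: bb; rewrite bb0 ltxx.
move=> /eqP wn0.
have : 0 < dot (dot b b *: a - dot a b *: b) (dot b b *: a - dot a b *: b).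
  rewrite lt_def dot_ge0 andbT; apply/eqP => w0; apply: wn0; exact: dot_eq0.
by rewrite dot_gram pmulr_rgt0 // expr2.
Qed.

End immersion.

(** * Integrals over the unit square *)

Section square_integral.
Context (R : realType).
Local Notation P := (measurableTypeR R * measurableTypeR R)%type.
Local Notation leb2 := (lebesgue_measure \x lebesgue_measure)%E.

Implicit Types (a b : R * R -> R) (c e : R).

Definition square : set (R * R) := `[0%R, 1%R[ `*` `[0%R, 1%R[.
Definition closed_square : set (R * R) := `[0%R, 1%R] `*` `[0%R, 1%R].

Definition square_int (a : R * R -> R) : R :=
  fine (\int[leb2]_(u in (square : set P)) (a u)%:E)%E.

Lemma square_sub : square `<=` closed_square.
Proof.
move=> [x y] [/= ]; rewrite !in_itv /= => /andP[? /ltW ?] /andP[? /ltW ?].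
by split; rewrite /= in_itv /=; apply/andP.
Qed.

Lemma compact_closed_square : compact closed_square.
Proof. by apply: compact_setX; exact: segment_compact. Qed.

Lemma measurable_square : measurable (square : set P).
Proof. by apply: measurableX; exact: measurable_itv. Qed.

Lemma square_measure : leb2 (square : set P) = 1%E.
Proof.
rewrite /square product_measure1E; [|exact: measurable_itv|exact: measurable_itv].
have E01 : lebesgue_measure (`[0%R, 1%R[ : set R) = 1%E.
  by rewrite lebesgue_measure_itv /= lte01 sube0.
by rewrite -[RHS]mule1; congr (_ * _)%E; exact: E01.
Qed.

Lemma continuous_integrable (a : R * R -> R) : continuous a ->
  leb2.-integrable (square : set P) (EFin \o a).
Proof.
move=> ca; apply: measurable_bounded_integrable.
- exact: measurable_square.
- by rewrite [X in (X < _)%E]square_measure ltry.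
- exact: continuous_measurable_plane.
have cK : compact [set a u | u in closed_square].
  apply: continuous_compact; last exact: compact_closed_square.
  by apply: continuous_subspaceT.
have [M [Mr HM]] := compact_bounded cK.
exists M; split => // y My u Su; apply: (HM _ My).
by exists u => //; exact: square_sub.
Qed.

Lemma square_intD a b : continuous a -> continuous b ->
  square_int (fun u => a u + b u) = square_int a + square_int b.
Proof.
by move=> ca cb; apply: RintegralD; [exact: measurable_square| |];
  exact: continuous_integrable.
Qed.

Lemma square_intB a b : continuous a -> continuous b ->
  square_int (fun u => a u - b u) = square_int a - square_int b.
Proof.
by move=> ca cb; apply: RintegralB; [exact: measurable_square| |];
  exact: continuous_integrable.
Qed.

Lemma square_intZ c a : continuous a ->
  square_int (fun u => c * a u) = c * square_int a.
Proof.
by move=> ca; apply: RintegralZl; [exact: measurable_square|exact: continuous_integrable].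
Qed.

Lemma square_int_le a b : continuous a -> continuous b ->
  (forall u, closed_square u -> a u <= b u) -> square_int a <= square_int b.
Proof.
move=> ca cb ab; apply: le_Rintegral.
- exact: measurable_square.
- exact: continuous_integrable.
- exact: continuous_integrable.
- by move=> u /square_sub; exact: ab.
Qed.

Lemma square_int_cst c : square_int (fun=> c) = c.
Proof.
rewrite /square_int integral_cst; last exact: measurable_square.
by rewrite [X in (_ * X)%E]square_measure mule1.
Qed.

Lemma square_int_dist a b e : continuous a -> continuous b ->
  (forall u, closed_square u -> `|a u - b u| <= e) ->
  `|square_int a - square_int b| <= e.
Proof.
move=> ca cb H; have ce : continuous (cst e : R * R -> R) by exact: cst_continuous.
rewrite -square_intB // ler_norml; apply/andP; split.
  rewrite -[leLHS]square_int_cst; apply: square_int_le.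
  - exact: cst_continuous.
  - by move=> u; apply: cvgB; [exact: ca|exact: cb].
  - by move=> u /H; rewrite ler_norml => /andP[].
rewrite -[leRHS]square_int_cst; apply: square_int_le => //.
- by move=> u; apply: cvgB; [exact: ca|exact: cb].
- by move=> u /H; rewrite ler_norml => /andP[].
Qed.

(** Estimates near each parameter become uniform by compactness of the closed square. *)
Lemma uniform_near (adm : set R) (Q : R -> R * R -> Prop) :
  (forall u, closed_square u -> \forall z \near time_filter adm u, Q z.1 z.2) ->
  \forall h \near within adm (nbhs (0 : R)), forall u, closed_square u -> Q h u.
Proof.
move=> H.
have /compact_near_coveringP cov := compact_closed_square.
apply: (cov R (within adm (nbhs (0 : R))) Q) => u Ku.
have := H u Ku; rewrite /time_filter => -[[A B] /= [A0 Bu] AB].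
exists (B, [set h | adm h /\ A h]) => /=.
  by split=> //; apply: filterS A0 => h Ah ah.
by move=> [v h] /= [Bv [ah Ah]]; exact: (AB (h, v) (conj Ah Bv) ah).
Qed.

End square_integral.

(** * Integrals over the torus *)

Section C2map.
Context (R : realType).
Implicit Types (p : R * R -> 'rV[R]_4) (u a : R * R).

(** Entrywise continuity of the derivatives of order at most two, all that the geometry
    of p depends on. *)
Definition C2map p :=
  [/\ forall k, continuous (fun u => p u 0 k),
      forall i k, continuous (fun u => partial i p u 0 k) &
      forall i j k, continuous (fun u => partial i (partial j p) u 0 k)].

Lemma smooth_C2map p : smooth_open setT p -> C2map p.
Proof.
move=> sp.
have C q k : (forall u, {for u, continuous q}) -> continuous (fun u => (q u : 'rV[R]_4) 0 k).
  move=> cq u; apply: (@continuous_comp _ _ _ q (fun M : 'M[R]_(1, 4) => M 0 k)).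
    exact: cq.
  exact: coord_continuous.
split=> [k|i k|i j k]; apply: C => u.
- by have [] := sp [::] u I.
- by have [] := sp [:: coord_dir R i] u I.
- by have [] := sp [:: coord_dir R i; coord_dir R j] u I.
Qed.

Lemma slice_C2map (G : R * (R * R) -> 'rV[R]_4) (t : R) :
  CkV 3 setT G -> C2map (fun u => G (t, u)).
Proof.
move=> CG.
have C n (H : R * (R * R) -> 'rV[R]_4) k : CkV n setT H ->
    continuous (fun u => H (t, u) 0 k).
  move=> CH u; apply: (@continuous_comp _ _ _ (fun u : R * R => (t, u)) (fun z => H z 0 k)).
    exact: continuous_insert.
  exact: Ck_cont (CH k) I.
have E u : setT (t, u) -> G (t, u) = G (t, u) by [].
split=> [k|i k|i j k]; first exact: (C _ _ _ CG).
- have -> : (fun u => partial i (fun u => G (t, u)) u 0 k) =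
      (fun u => row_derive (space_dir R i) G (t, u) 0 k).
    apply/funext => u; congr (fun_of_matrix _ 0 k).
    by apply: (slice_partial i openT CG) => [v _|].
  exact: (C _ _ _ (CkV_derive (space_dir R i) CG)).
- have -> : (fun u => partial i (partial j (fun u => G (t, u))) u 0 k) =
      (fun u => row_derive (space_dir R i) (row_derive (space_dir R j) G) (t, u) 0 k).
    apply/funext => u; congr (fun_of_matrix _ 0 k).
    by apply: (slice_partial2 i j openT CG) => [v _|].
  exact: (C _ _ _ (CkV_derive (space_dir R i) (CkV_derive (space_dir R j) CG))).
Qed.

Section continuity.
Variable p : R * R -> 'rV[R]_4.
Hypothesis Cp : C2map p.

(* With size 0, a congruence of p with itself is continuity. *)
Let r0 : R * R -> R := fun=> 0.

Let C0 u : vcong (nbhs u) r0 (p u) p p.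
Proof. by move=> k; apply: cong_refl; have [H _ _] := Cp; exact: H. Qed.

Let C1 u i : vcong (nbhs u) r0 (partial i p u) (partial i p) (partial i p).
Proof. by move=> k; apply: cong_refl; have [_ H _] := Cp; exact: H. Qed.

Let C2 u i j : vcong (nbhs u) r0 (partial i (partial j p) u)
  (partial i (partial j p)) (partial i (partial j p)).
Proof. by move=> k; apply: cong_refl; have [_ _ H] := Cp; exact: H. Qed.

Lemma continuous_det_metric : continuous (fun u => \det (metric p u)).
Proof.
move=> u; have [H _ _] := cong_det_metric (fa := fun=> p) (fb := fun=> p)
  (ua := id) (ub := id) (C1 u).
exact: H.
Qed.

Lemma continuous_area_density : continuous (area_density p).
Proof.
move=> u; apply: (@continuous_comp _ _ _ (fun u => \det (metric p u)) Num.sqrt).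
  exact: continuous_det_metric.
exact: sqrt_continuous.
Qed.

Hypothesis det0 : forall u, 0 < \det (metric p u).

Lemma continuous_mean_curv k : continuous (fun u => mean_curv p u 0 k).
Proof.
move=> u.
have H : vcong (nbhs u) r0 (mean_curv p u) (mean_curv p) (mean_curv p).
  exact: (vcong_mean_curv (fa := fun=> p) (fb := fun=> p)
    (ua := id) (ub := id) (C0 u) (C1 u) (det0 u) (C2 u)).
by have [H' _ _] := H k; exact: H'.
Qed.

Lemma continuous_willmore_density : continuous (willmore_density p).
Proof.
move=> u; have [H _ _] := cong_willmore_density (fa := fun=> p) (fb := fun=> p)
  (ua := id) (ub := id) (C0 u) (C1 u) (det0 u) (C2 u).
exact: H.
Qed.

End continuity.

(** The mean curvature vector as a function of the values of the derivatives, which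
    makes it visible that equal derivatives give equal curvature. *)
Definition mean_curv_jet (x : 'rV[R]_4) (d1 : 'I_2 -> 'rV[R]_4)
    (d2 : 'I_2 -> 'I_2 -> 'rV[R]_4) : 'rV[R]_4 :=
  let gi := invmx (\matrix_(i < 2, j < 2) dot (d1 i) (d1 j)) in
  \sum_(i < 2) \sum_(j < 2) gi i j *: (d2 i j - dot (d2 i j) x *: x
    - \sum_(k < 2) \sum_(l < 2) (gi k l * dot (d2 i j) (d1 k)) *: d1 l).

Lemma mean_curv_jetE p u : mean_curv p u =
  mean_curv_jet (p u) (fun i => partial i p u) (fun i j => partial i (partial j p) u).
Proof. by []. Qed.

Section periodicity.
Variables (p : R * R -> 'rV[R]_4) (a : R * R).
Hypothesis pa : forall u, p (u + a) = p u.

Lemma partial_periodic i u : partial i p (u + a) = partial i p u.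
Proof.
apply: (etrans (esym (derive_translate p a u (coord_dir R i)))).
by have -> : (fun y => p (y + a)) = p by apply/funext => y; exact: pa.
Qed.

Lemma partial2_periodic i j u :
  partial i (partial j p) (u + a) = partial i (partial j p) u.
Proof.
apply: (etrans (esym (derive_translate (partial j p) a u (coord_dir R i)))).
have -> : (fun y => partial j p (y + a)) = partial j p.
  by apply/funext => y; exact: partial_periodic.
by [].
Qed.

Lemma metric_periodic u : metric p (u + a) = metric p u.
Proof.
have E : (fun i => partial i p (u + a)) = (fun i => partial i p u).
  by apply/funext => i; exact: partial_periodic.
exact: (congr1 (fun t : 'I_2 -> 'rV[R]_4 => \matrix_(i < 2, j < 2) dot (t i) (t j)) E).
Qed.

Lemma mean_curv_periodic u : mean_curv p (u + a) = mean_curv p u.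
Proof.
have E1 : (fun i => partial i p (u + a)) = (fun i => partial i p u).
  by apply/funext => i; exact: partial_periodic.
have E2 : (fun i j => partial i (partial j p) (u + a)) =
          (fun i j => partial i (partial j p) u).
  by apply/funext => i; apply/funext => j; exact: partial2_periodic.
apply: (etrans (mean_curv_jetE p (u + a))).
by rewrite E1 E2 pa -mean_curv_jetE.
Qed.

End periodicity.

End C2map.

Section surface.
Context (R : realType) (Sigma : smooth_torus R).
Local Notation P := (measurableTypeR R * measurableTypeR R)%type.
Local Notation cover := (torus_cover Sigma).
Implicit Types (f : Sigma -> 'rV[R]_4).

(** The lift chosen by [torus_lift] is arbitrary, but differs from u by an integer
    vector, under which every lifted map is periodic. *)
Lemma cover_lift_shift u :
  exists a : R * R, torus_lift (cover u) = u + a /\ forall v, cover (v + a) = cover v.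
Proof.
have : cover u = cover (torus_lift (cover u)).
  by rewrite /torus_lift; case: cid => v /= ->.
move=> /torus_cover_eq[m [n E]]; exists (m%:~R, n%:~R); split.
  by rewrite E; case: (u).
by move=> v; apply: esym; apply/torus_cover_eq; exists m, n; case: v.
Qed.

Lemma H_sq_cover f u : H_sq f (cover u) =
  dot (mean_curv (periodic_lift f) u) (mean_curv (periodic_lift f) u).
Proof.
have [a [E pa]] := cover_lift_shift u.
have pl v : periodic_lift f (v + a) = periodic_lift f v by rewrite /periodic_lift /= pa.
by rewrite /H_sq E (mean_curv_periodic pl).
Qed.

Lemma measurable_cover : measurable_fun setT (cover : P -> Sigma).
Proof. by move=> _ B mB; rewrite setTI. Qed.

Lemma measurable_surface (h : Sigma -> R) : continuous (h \o cover) ->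
  measurable_fun setT h.
Proof.
move=> ch _ B mB; rewrite setTI.
have := continuous_measurable_plane (D := setT) ch.
by move=> /(_ measurableT B mB); rewrite setTI.
Qed.

Lemma area_measureE f : area_measure f =
  pushforward (density_measure (lebesgue_measure \x lebesgue_measure)%E
    (@square R : set P) (area_density (periodic_lift f) : P -> R)) (cover : P -> Sigma).
Proof. by apply/funext => B; reflexivity. Qed.

Lemma surface_intE f (h : Sigma -> R) :
  C2map (periodic_lift f) -> continuous (h \o cover) ->
  surface_int f h =
    square_int (fun u => h (cover u) * area_density (periodic_lift f) u).
Proof.
move=> Cf ch; congr fine; rewrite area_measureE.
have mg : measurable_fun (@square R : set P) (area_density (periodic_lift f) : P -> R).
  exact: continuous_measurable_plane (continuous_area_density Cf).
have g0 (u : P) : 0 <= area_density (periodic_lift f) u by exact: sqrtr_ge0.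
have := integral_pushforward_density (lebesgue_measure \x lebesgue_measure)%E
  (@measurable_square R) mg g0 measurable_cover (measurableT) (fun=> I)
  (measurable_surface ch).
by [].
Qed.

Lemma willmoreE f : C2map (periodic_lift f) ->
  (forall u, 0 < \det (metric (periodic_lift f) u)) ->
  willmore f = square_int (willmore_density (periodic_lift f)).
Proof.
move=> Cf d0.
have ch : continuous ((fun x => 1 + 4^-1 * H_sq f x) \o cover); last first.
  apply: (etrans (surface_intE Cf ch)).
  apply: (congr1 (@square_int R)); apply/funext => u.
  exact: (congr1 (fun t => (1 + 4^-1 * t) * area_density (periodic_lift f) u)
    (H_sq_cover f u)).
have -> : (fun x => 1 + 4^-1 * H_sq f x) \o cover = (fun u => 1 + 4^-1 *
   dot (mean_curv (periodic_lift f) u) (mean_curv (periodic_lift f) u)).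
  by apply/funext => u; exact: (congr1 (fun t => 1 + 4^-1 * t) (H_sq_cover f u)).
move=> u; apply: cvgD; first exact: cvg_cst.
apply: cvgM; first exact: cvg_cst.
have H k := continuous_mean_curv Cf d0 k.
set mc := mean_curv (periodic_lift f) in H *.
have Hv : vcong (nbhs u) (fun=> 0) (mc u) mc mc.
  by move=> k; apply: cong_refl; exact: H.
by have [H' _ _] := cong_dot Hv Hv; exact: H'.
Qed.

Lemma continuous_dot_self : continuous (fun q : 'rV[R]_4 => dot q q).
Proof.
move=> q.
have H : vcong (nbhs q) (fun=> 0) q id id.
  by move=> k; apply: cong_refl; exact: coord_continuous.
by have [H' _ _] := cong_dot H H; exact: H'.
Qed.

Lemma closed_S3 : closed (@S3 R).
Proof.
have -> : @S3 R = (fun q => dot q q) @^-1` [set 1] by [].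
apply: preimage_closed; first by move=> q _; exact: continuous_dot_self.
by apply: accessible_closed_set1; apply: hausdorff_accessible; exact: norm_hausdorff.
Qed.

Lemma sphere_intE f (phi psi : 'rV[R]_4 -> R) (U : set 'rV[R]_4) :
  smooth_map f -> (forall x, S3 (f x)) ->
  open U -> S3 `<=` U -> (forall q, U q -> {for q, continuous psi}) ->
  (forall q, S3 q -> phi q = psi q) ->
  sphere_int f phi =
    square_int (fun u => phi (periodic_lift f u) * area_density (periodic_lift f) u).
Proof.
move=> sf fS oU SU cpsi phipsi; congr fine.
have Cf := smooth_C2map sf.
have cf u : {for u, continuous (periodic_lift f)} by have [] := sf [::] u I.
have mO (O : set 'rV[R]_4) : open O ->
    measurable (O : set (g_sigma_algebraType (@open 'rV[R]_4))).
  by move=> oO; apply: sub_sigma_algebra.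
have mS : measurable (@S3 R : set (g_sigma_algebraType (@open 'rV[R]_4))).
  by rewrite -(setCK (@S3 R)); apply: measurableC; apply: mO; exact: closed_openC closed_S3.
have mg : measurable_fun (@square R : set P) (area_density (periodic_lift f) : P -> R).
  exact: continuous_measurable_plane (continuous_area_density Cf).
have g0 (u : P) : 0 <= area_density (periodic_lift f) u by exact: sqrtr_ge0.
pose rV4 := g_sigma_algebraType (@open 'rV[R]_4).
have mf : measurable_fun setT (periodic_lift f : P -> rV4).
  apply: (@measurability _ _ P rV4 setT (periodic_lift f) open) => //.
  move=> _ [B oB <-]; rewrite setTI; apply: open_measurable_plane.
  by apply: open_comp => // u _; exact: cf.
have mphi : measurable_fun (S3 : set rV4) (phi : rV4 -> R).
  apply: (measurability _ (measurable_realfun.RGenOpens.measurableE R)).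
  move=> _ [_ [x [y ->] <-]].
  have -> : S3 `&` phi @^-1` `]x, y[ = S3 `&` (U `&` psi @^-1` `]x, y[).
    apply/seteqP; split=> q [Sq /= H]; split=> //.
      by split; [exact: SU|rewrite /= -phipsi].
    by case: H => _; rewrite /= phipsi.
  apply: measurableI => //; apply: mO.
  rewrite openE => q [Uq /= Iq]; rewrite /interior.
  apply: filterI; first exact: open_nbhs_nbhs.
  apply: (cpsi q Uq); apply: open_nbhs_nbhs; split; [exact: interval_open|exact: Iq].
have fS' (u : P) : (S3 : set rV4) (periodic_lift f u) by exact: fS.
have := integral_pushforward_density (lebesgue_measure \x lebesgue_measure)%E
  (@measurable_square R) mg g0 mf mS fS' mphi.
by [].
Qed.

End surface.

(** * First order expansions in time *)

Lemma dist_lt_pos (R : realFieldType) (a b : R) : `|a - b| < a -> 0 < b.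
Proof. by rewrite ltr_norml => /andP[_ H]; lra. Qed.

Section expansions.
Context (R : realType) (adm : set R).
Local Notation E := (R * (R * R))%type.
Implicit Types (p q : R -> R * R -> 'rV[R]_4) (f V : R * R -> 'rV[R]_4) (u : R * R).

Lemma time_filter_snd u0 (a : R * R -> R) : {for u0, continuous a} ->
  a z.2 @[z --> time_filter adm u0] --> a u0.
Proof.
move=> ca.
have H : {for ((0, u0) : E), continuous (fun z : E => a z.2)}.
  apply: (@continuous_comp _ _ _ snd a); [exact: cvg_snd|exact: ca].
by apply: cvg_trans H; apply: cvg_app; exact: cvg_within.
Qed.

Lemma time_filter_fst u0 : (z : E).1 @[z --> time_filter adm u0] --> (0 : R).
Proof.
have H : {for ((0, u0) : E), continuous (fun z : E => z.1)} by exact: cvg_fst.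
by apply: cvg_trans H; apply: cvg_app; exact: cvg_within.
Qed.

Lemma cong_snd u0 (a : R * R -> R) : {for u0, continuous a} ->
  cong (time_filter adm u0) fst (a u0) (fun z => a z.2) (fun z => a z.2).
Proof. by move=> ca; apply: cong_refl; exact: time_filter_snd. Qed.

Lemma cong_fst u0 : cong (time_filter adm u0) fst 0 fst fst.
Proof. by apply: cong_refl; exact: time_filter_fst. Qed.

Lemma willmore_family_cong p q f V u0 :
  smooth_family adm p f V u0 -> smooth_family adm q f V u0 ->
  0 < \det (metric f u0) ->
  cong (time_filter adm u0) fst (willmore_density f u0)
    (fun z => willmore_density (p z.1) z.2) (fun z => willmore_density (q z.1) z.2).
Proof.
move=> Hp Hq d0.
apply: (cong_willmore_density (fa := fun z : E => p z.1) (fb := fun z : E => q z.1)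
  (ua := fun z => z.2) (ub := fun z => z.2)) => //.
- exact: vcong_trans (vcong_family Hp) (vcong_sym (vcong_family Hq)).
- by move=> i; exact: vcong_trans (vcong_family1 Hp i) (vcong_sym (vcong_family1 Hq i)).
- by move=> i j; exact: vcong_trans (vcong_family2 Hp i j) (vcong_sym (vcong_family2 Hq i j)).
Qed.

Lemma det_family_near p f V :
  (forall u, smooth_family adm p f V u) -> (forall u, 0 < \det (metric f u)) ->
  \forall h \near within adm (nbhs (0 : R)),
    forall u, closed_square u -> 0 < \det (metric (p h) u).
Proof.
move=> Hp d0; apply: uniform_near => u _.
have [+ _ _] := cong_det_metric (fa := fun z : E => p z.1) (fb := fun z : E => p z.1)
  (ua := fun z => z.2) (ub := fun z => z.2)
  (fun i => vcong_trans (vcong_family1 (Hp u) i) (vcong_sym (vcong_family1 (Hp u) i))).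
move/cvgrPdist_lt => /(_ _ (d0 u)); apply: filterS => z.
exact: dist_lt_pos.
Qed.

Lemma square_int_small_diff (a b : R -> R * R -> R) :
  (\forall h \near within adm (nbhs (0 : R)), continuous (a h)) ->
  (\forall h \near within adm (nbhs (0 : R)), continuous (b h)) ->
  (forall u, closed_square u -> small_diff (time_filter adm u) fst
     (fun z => a z.1 z.2) (fun z => b z.1 z.2)) ->
  small_diff (within adm (nbhs (0 : R))) id
    (fun h => square_int (a h)) (fun h => square_int (b h)).
Proof.
move=> ca cb H e e0.
have N : \forall h \near within adm (nbhs (0 : R)), forall u, closed_square u ->
    `|a h u - b h u| <= e * `|h|.
  by apply: uniform_near => u Ku; exact: H u Ku e e0.
apply: filterS3 ca cb N => h cah cbh; exact: square_int_dist.
Qed.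

Lemma cong_time_linear u0 (a b : R * R -> R) :
  {for u0, continuous a} -> {for u0, continuous b} ->
  cong (time_filter adm u0) fst (a u0 + 0 * b u0)
    (fun z => a z.2 + z.1 * b z.2) (fun z => a z.2 + z.1 * b z.2).
Proof.
move=> ca cb; apply: congD; first exact: cong_snd.
by apply: congM; [exact: cong_fst|exact: cong_snd].
Qed.

(** The product of the first order terms carries a factor h^2, which is o(h). *)
Lemma time_linearM u0 (a a' b b' : R * R -> R) (A B : E -> R) l m :
  {for u0, continuous a} -> {for u0, continuous a'} ->
  {for u0, continuous b} -> {for u0, continuous b'} ->
  cong (time_filter adm u0) fst l A (fun z => a z.2 + z.1 * a' z.2) ->
  cong (time_filter adm u0) fst m B (fun z => b z.2 + z.1 * b' z.2) ->
  cong (time_filter adm u0) fst (l * m) (fun z => A z * B z)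
    (fun z => a z.2 * b z.2 + z.1 * (a z.2 * b' z.2 + a' z.2 * b z.2)).
Proof.
move=> ca ca' cb cb' HA HB.
have [H1 H2 H3] := congM HA HB.
have S : small_diff (time_filter adm u0) fst
    (fun z => (a z.2 + z.1 * a' z.2) * (b z.2 + z.1 * b' z.2))
    (fun z => a z.2 * b z.2 + z.1 * (a z.2 * b' z.2 + a' z.2 * b z.2)).
  have [L _ _] := congM (cong_fst u0) (congM (cong_snd ca') (cong_snd cb')).
  apply: (small_diff_le (c := fun z : E => z.1 * (a' z.2 * b' z.2))).
    by move: L; rewrite mul0r.
  apply: nearW => z; rewrite -normrM le_eqVlt; apply/orP; left; apply/eqP.
  by congr (`|_|); ring.
apply: cong_small_diff; [exact: time_filter_fst|exact: H1|].
exact: small_diff_trans H3 S.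
Qed.

(** The expected expansion b + h b' of the square root has a square equal to
    a + h a' up to o(h); conclude by taking square roots. *)
Lemma time_linear_sqrt u0 (a a' : R * R -> R) (A : E -> R) :
  {for u0, continuous a} -> {for u0, continuous a'} -> 0 < a u0 ->
  cong (time_filter adm u0) fst (a u0) A (fun z => a z.2 + z.1 * a' z.2) ->
  cong (time_filter adm u0) fst (Num.sqrt (a u0)) (fun z => Num.sqrt (A z))
    (fun z => Num.sqrt (a z.2) + z.1 * (a' z.2 / (2 * Num.sqrt (a z.2)))).
Proof.
move=> ca ca' a0 HA.
have s0 : 0 < Num.sqrt (a u0) by rewrite sqrtr_gt0.
pose b u := Num.sqrt (a u).
pose b' u := a' u / (2 * Num.sqrt (a u)).
have cb : {for u0, continuous b}.
  by apply: (@continuous_comp _ _ _ a Num.sqrt) => //; exact: sqrt_continuous.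
have cb' : {for u0, continuous b'}.
  apply: cvgM; first exact: ca'.
  apply: cvgV; first by rewrite mulf_neq0 // gt_eqF.
  by apply: cvgM; [exact: cvg_cst|exact: cb].
have [B1 _ _] := cong_time_linear cb cb'.
rewrite mul0r addr0 in B1.
have apos : \forall z \near time_filter adm u0, 0 < a z.2.
  have /cvgrPdist_lt/(_ _ a0) := time_filter_snd ca; apply: filterS => z.
  exact: dist_lt_pos.
have bpos : \forall z \near time_filter adm u0, 0 <= b z.2 + z.1 * b' z.2.
  have /cvgrPdist_lt/(_ _ s0) := B1; apply: filterS => z.
  by move/dist_lt_pos/ltW.
(* The square of b + h b' is a + h a' up to the o(h) term h^2 b'^2. *)
have C2 := time_linearM cb cb' cb cb' (cong_time_linear cb cb') (cong_time_linear cb cb').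
rewrite mul0r addr0 -expr2 sqr_sqrtr ?(ltW a0) // in C2.
have C3 : cong (time_filter adm u0) fst (a u0)
    (fun z => (b z.2 + z.1 * b' z.2) * (b z.2 + z.1 * b' z.2))
    (fun z => a z.2 + z.1 * a' z.2).
  apply: (cong_near _ _ C2); first exact: nearW.
  apply: filterS apos => z az.
  have sz : Num.sqrt (a z.2) != 0 by rewrite gt_eqF // sqrtr_gt0.
  have az2 : Num.sqrt (a z.2) * Num.sqrt (a z.2) = a z.2.
    by rewrite -expr2 sqr_sqrtr // ltW.
  rewrite /b /b' az2; congr (_ + _ * _); field.
  exact: sz.
apply: (cong_near _ _ (cong_sqrt a0 (cong_trans HA (cong_sym C3)))).
  exact: nearW.
by apply: filterS bpos => z bz; rewrite -expr2 sqrtr_sqr ger0_norm.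
Qed.

End expansions.

(** * First variation of the area density and of a test function *)

Lemma ex_norm_continuous (R : realType) (V : normedModType R) (f : V -> R) (x : V) :
  (forall e : R, 0 < e ->
    exists2 r : R, 0 < r & forall y : V, `|x - y| < r -> `|f x - f y| <= e) ->
  {for x, continuous f}.
Proof.
move=> H; apply/cvgrPdist_le => e /H[r r0 Hr].
exact: (norm_nbhs r0 Hr).
Qed.

Lemma sum_ord22 (R : realType) (F : 'I_2 -> 'I_2 -> R) :
  \sum_i \sum_j F i j = F 0 0 + F 0 1 + (F 1 0 + F 1 1).
Proof. by rewrite !big_ord_recl !big_ord0 !addr0 lift01. Qed.

Lemma inv_mx2_coords (R : realType) (A : 'M[R]_2) : \det A != 0 ->
  [/\ invmx A 0 0 = (\det A)^-1 * A 1 1, invmx A 0 1 = - ((\det A)^-1 * A 0 1),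
      invmx A 1 0 = - ((\det A)^-1 * A 1 0) & invmx A 1 1 = (\det A)^-1 * A 0 0].
Proof.
move=> d0; split; rewrite (inv_mx2 _ _ d0) ?lift01 ?lift10 /=.
- by rewrite expr0 mul1r.
- by rewrite expr1 mulN1r mulrN.
- by rewrite expr1 mulN1r mulrN.
- by rewrite expr2 mulrNN mulr1 mul1r.
Qed.

Section first_variation.
Context (R : realType) (adm : set R).
Local Notation E := (R * (R * R))%type.
Implicit Types (p : R -> R * R -> 'rV[R]_4) (f V : R * R -> 'rV[R]_4) (u : R * R).

Lemma continuous_dot (X : topologicalType) (a b : X -> 'rV[R]_4) (u : X) :
  (forall k, {for u, continuous (fun v => a v 0 k)}) ->
  (forall k, {for u, continuous (fun v => b v 0 k)}) ->
  {for u, continuous (fun v => dot (a v) (b v))}.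
Proof.
move=> ca cb.
have Ha : vcong (nbhs u) (fun=> 0) (a u) a a by move=> k; apply: cong_refl; exact: ca.
have Hb : vcong (nbhs u) (fun=> 0) (b u) b b by move=> k; apply: cong_refl; exact: cb.
by have [H _ _] := cong_dot Ha Hb; exact: H.
Qed.

Lemma time_linear_dot u0 (a a' b b' : R * R -> 'rV[R]_4) (A B : E -> 'rV[R]_4) l m :
  (forall k, {for u0, continuous (fun v => a' v 0 k)}) ->
  (forall k, {for u0, continuous (fun v => b' v 0 k)}) ->
  vcong (time_filter adm u0) fst l A (fun z => a z.2 + z.1 *: a' z.2) ->
  vcong (time_filter adm u0) fst m B (fun z => b z.2 + z.1 *: b' z.2) ->
  cong (time_filter adm u0) fst (dot l m) (fun z => dot (A z) (B z))
    (fun z => dot (a z.2) (b z.2) +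
      z.1 * (dot (a z.2) (b' z.2) + dot (a' z.2) (b z.2))).
Proof.
move=> ca cb HA HB; have [H1 H2 H3] := cong_dot HA HB.
apply: cong_small_diff; [exact: time_filter_fst|exact: H1|].
apply: small_diff_trans H3 _.
have [L _ _] := congM (cong_fst adm u0) (cong_snd adm (continuous_dot ca cb)).
apply: (small_diff_le (c := fun z : E => z.1 * dot (a' z.2) (b' z.2))).
  by move: L; rewrite mul0r.
apply: nearW => z; rewrite -normrM le_eqVlt; apply/orP; left; apply/eqP.
by congr (`|_|); rewrite !dotDl !dotDr !dotZl !dotZr; ring.
Qed.

Section area.
Variables (p : R -> R * R -> 'rV[R]_4) (f V : R * R -> 'rV[R]_4).
Hypothesis Hp : forall u, smooth_family adm p f V u.
Hypothesis sf : smooth_open setT f.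
Hypothesis sV : smooth_open setT V.
Hypothesis det0 : forall u, 0 < \det (metric f u).
Hypothesis Vf : forall u, dot (V u) (f u) = 0.
Hypothesis Vdf : forall u i, dot (V u) (partial i f u) = 0.

Let bff i j u := dot (partial i (partial j f) u) (V u).

(** Differentiate <V, d_j f> = 0 in the direction i. *)
Let dot_partialV i j u : dot (partial i V u) (partial j f u) = - bff i j u.
Proof.
have dV : derivable V u (coord_dir R i) by exact: (smooth_open_derivable sV).
have df : derivable (partial j f) u (coord_dir R i).
  exact: (smooth_open_derivable (smooth_open_derive (coord_dir R j) sf)).
have D : is_derive u (coord_dir R i) (fun v => dot (V v) (partial j f v))
   (\sum_k (V u 0 k * partial i (partial j f) u 0 k + partial j f u 0 k * partial i V u 0 k)).
  have -> : (fun v => dot (V v) (partial j f v)) =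
     \sum_k ((fun v => V v 0 k) * (fun v => partial j f v 0 k)).
    by apply/funext => v; rewrite fct_sumE.
  apply: is_derive_sum => k.
  apply: is_deriveM; apply: DeriveDef.
  - by move/derivable_mxP : dV; exact.
  - exact: derive_component.
  - by move/derivable_mxP : df; exact.
  - exact: derive_component.
have D0 : is_derive u (coord_dir R i) (fun v => dot (V v) (partial j f v)) 0.
  have -> : (fun v => dot (V v) (partial j f v)) = cst 0 by apply/funext => v; exact: Vdf.
  exact: is_derive_cst.
have := etrans (esym (@derive_val _ _ _ _ _ _ _ D)) (@derive_val _ _ _ _ _ _ _ D0).
rewrite big_split /= => /eqP; rewrite addr_eq0 => /eqP E1.
apply: oppr_inj; rewrite opprK /bff (dotC _ (V u)).
apply: (etrans _ (esym E1)); congr (- _).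
by apply: eq_bigr => k _; rewrite mulrC.
Qed.

Let dot_second_ff i j u : dot (second_ff f u i j) (V u) = bff i j u.
Proof.
rewrite /second_ff /normal_part dotBl dotBl dotZl (dotC (f u)) Vf mulr0 subr0.
rewrite dot_suml big1 ?subr0 // => k _; rewrite dot_suml big1 // => l _.
by rewrite dotZl (dotC (partial l f u)) Vdf mulr0.
Qed.

Let metric_variation i j u :=
  dot (partial i f u) (partial j V u) + dot (partial i V u) (partial j f u).

Let metric_variationE i j u : metric_variation i j u = - (bff j i u + bff i j u).
Proof.
rewrite opprD; apply: (f_equal2 +%R); last exact: dot_partialV.
exact: (etrans (dotC _ _) (dot_partialV j i u)).
Qed.

Let metric_sym i j u : metric f u i j = metric f u j i.
Proof.
apply: (etrans (mxE _ _ i j)); apply: (etrans _ (esym (mxE _ _ j i))).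
exact: dotC.
Qed.

Let det_variation u :=
  (metric f u 0 0 * metric_variation 1 1 u + metric_variation 0 0 u * metric f u 1 1) -
  (metric f u 0 1 * metric_variation 1 0 u + metric_variation 0 1 u * metric f u 1 0).

Let dot_mean_curv u : dot (mean_curv f u) (V u) =
  \sum_(i < 2) \sum_(j < 2) inv_metric f u i j * bff i j u.
Proof.
apply: (etrans (dot_suml _ _)); apply: eq_bigr => i _.
apply: (etrans (dot_suml _ _)); apply: eq_bigr => j _.
by apply: (etrans (dotZl _ _ _)); congr (_ * _); exact: dot_second_ff.
Qed.

Let det_variationE u :
  det_variation u = - (2 * dot (mean_curv f u) (V u) * \det (metric f u)).
Proof.
have d0 : \det (metric f u) != 0 by rewrite gt_eqF.
have [i00 i01 i10 i11] := inv_mx2_coords d0.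
have H : dot (mean_curv f u) (V u) = (\det (metric f u))^-1 *
    (metric f u 1 1 * bff 0 0 u - metric f u 0 1 * (bff 0 1 u + bff 1 0 u)
      + metric f u 0 0 * bff 1 1 u).
  apply: (etrans (dot_mean_curv u)).
  apply: (etrans (sum_ord22 (fun i j => inv_metric f u i j * bff i j u))).
  rewrite /inv_metric i00 i01 i10 i11 (metric_sym 1 0).
  by move: (bff 0 0 u) (bff 0 1 u) (bff 1 0 u) (bff 1 1 u) => x y z w; ring.
rewrite H /det_variation !metric_variationE (metric_sym 1 0).
move: d0; move: (metric f u 0 0) (metric f u 0 1) (metric f u 1 1) (bff 0 0 u)
  (bff 0 1 u) (bff 1 0 u) (bff 1 1 u) (\det (metric f u)) => a b c x y z w d d0.
by field.
Qed.

Let Cf := smooth_C2map sf.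
Let CV := smooth_C2map sV.

Let c1f i u k : {for u, continuous (fun v => partial i f v 0 k)}.
Proof. by have [_ H _] := Cf; exact: H. Qed.

Let c1V i u k : {for u, continuous (fun v => partial i V v 0 k)}.
Proof. by have [_ H _] := CV; exact: H. Qed.

Let cmetric i j u : {for u, continuous (fun v => metric f v i j)}.
Proof.
have -> : (fun v => metric f v i j) = (fun v => dot (partial i f v) (partial j f v)).
  by apply/funext => v; rewrite mxE.
by apply: continuous_dot; exact: c1f.
Qed.

Let cmetric_variation i j u : {for u, continuous (metric_variation i j)}.
Proof.
by apply: cvgD; apply: continuous_dot; [exact: c1f|exact: c1V|exact: c1V|exact: c1f].
Qed.

(** First variation of area.  As V is normal, the metric changes at the rate
    - <d_i d_j f, V> - <d_j d_i f, V>, without derivatives of V; its trace is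
    - 2 <H, V>, and the area density is the square root of the determinant. *)
Lemma area_density_expansion u0 : cong (time_filter adm u0) fst (area_density f u0)
  (fun z => area_density (p z.1) z.2)
  (fun z => area_density f z.2 +
    z.1 * (- dot (mean_curv f z.2) (V z.2) * area_density f z.2)).
Proof.
have metE i j : cong (time_filter adm u0) fst (metric f u0 i j)
    (fun z => metric (p z.1) z.2 i j)
    (fun z => metric f z.2 i j + z.1 * metric_variation i j z.2).
  apply: (cong_eq _ _ _ (time_linear_dot (@c1V i u0) (@c1V j u0)
    (vcong_family1 (Hp u0) i) (vcong_family1 (Hp u0) j))) => [|z|z]; by rewrite mxE.
have detE : cong (time_filter adm u0) fst (\det (metric f u0))
    (fun z => \det (metric (p z.1) z.2))
    (fun z => \det (metric f z.2) + z.1 * det_variation z.2).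
  apply: (cong_eq _ _ _ (congB
    (time_linearM (@cmetric 0 0 u0) (@cmetric_variation 0 0 u0) (@cmetric 1 1 u0)
      (@cmetric_variation 1 1 u0) (metE 0 0) (metE 1 1))
    (time_linearM (@cmetric 0 1 u0) (@cmetric_variation 0 1 u0) (@cmetric 1 0 u0)
      (@cmetric_variation 1 0 u0) (metE 0 1) (metE 1 0)))) => [|z|z].
  - exact: (esym (det_mx2 _)).
  - exact: (esym (det_mx2 _)).
  - apply: (etrans _ (congr1 (fun d => d + z.1 * det_variation z.2) (esym (det_mx2 _)))).
    rewrite /det_variation.
    move: (metric f z.2 0 0) (metric f z.2 0 1) (metric f z.2 1 0) (metric f z.2 1 1)
      (metric_variation 0 0 z.2) (metric_variation 0 1 z.2)
      (metric_variation 1 0 z.2) (metric_variation 1 1 z.2) => a b c d x y w v.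
    by ring.
have cdet : {for u0, continuous (fun v => \det (metric f v))}.
  exact: continuous_det_metric.
have cvar : {for u0, continuous det_variation}.
  apply: cvgB; apply: cvgD; apply: cvgM;
    first [exact: cmetric|exact: cmetric_variation].
apply: (cong_near _ _ (time_linear_sqrt cdet cvar (det0 u0) detE)); first exact: nearW.
apply: nearW => z; rewrite /area_density; congr (_ + _ * _).
rewrite det_variationE; have := det0 z.2.
move: (\det (metric f z.2)) (dot (mean_curv f z.2) (V z.2)) => d h d0.
have s0 : Num.sqrt d != 0 by rewrite gt_eqF // sqrtr_gt0.
rewrite -{1}(sqr_sqrtr (ltW d0)); field.
exact: s0.
Qed.

Section test_function.
Variables (U : set 'rV[R]_4) (psi : 'rV[R]_4 -> R).
Hypothesis oU : open U.
Hypothesis fU : forall u, U (f u).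
Let dir (k : 'I_4) : 'rV[R]_4 := delta_mx 0 k.
Hypothesis dpsi : forall k q, U q -> derivable psi q (dir k).
Hypothesis cpsi : forall k q, U q -> {for q, continuous ('D_(dir k) psi)}.

Lemma row_delta_sum (w : 'rV[R]_4) : w = \sum_k w 0 k *: dir k.
Proof. exact: row_sum_delta. Qed.

Lemma norm_coord_le (w : 'rV[R]_4) k : `|w 0 k| <= `|w|.
Proof.
rewrite [leRHS]/Num.Def.normr /= mx_normrE.
exact: (le_bigmax _ (fun ij : 'I_1 * 'I_4 => `|w ij.1 ij.2|) (0, k)).
Qed.

(** The hypotheses only speak of directional derivatives; continuity comes from strict
    differentiability. *)
Lemma psi_continuous q : U q -> {for q, continuous psi}.
Proof.
move=> Uq; have e0 : (0 : R) < 1 by exact: ltr01.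
have [r r0 H] := strict_diff oU Uq dpsi (fun k => @cpsi k q Uq) e0.
apply: ex_norm_continuous => e e1.
pose M : R := 1 + \sum_k (1 + `|'D_(dir k) psi q|).
have S0 : 0 <= \sum_k (1 + `|'D_(dir k) psi q|).
  by apply: sumr_ge0 => k _; rewrite addr_ge0.
have M0 : 0 < M by rewrite /M; lra.
have eM : 0 < e / M by rewrite divr_gt0.
exists (Num.min r (e / M)); first by rewrite lt_min r0.
move=> w; rewrite lt_min => /andP[wr we].
have qq : `|q - q| < r by rewrite subrr normr0.
have tl k : `|(w - q) 0 k| <= `|q - w| by rewrite distrC; exact: norm_coord_le.
have := H q (fun k => (w - q) 0 k) qq (fun k => le_lt_trans (tl k) wr).
rewrite -row_delta_sum subrK mul1r => Hw.
have B : `|\sum_k (w - q) 0 k * 'D_(dir k) psi q| + \sum_k `|(w - q) 0 k| <= e.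
  apply: (@le_trans _ _ (\sum_k `|(w - q) 0 k| * (1 + `|'D_(dir k) psi q|))).
    under [leRHS]eq_bigr => k _ do rewrite mulrDr mulr1.
    rewrite big_split /= [leLHS]addrC; apply: lerD; first exact: lexx.
    apply: (le_trans (ler_norm_sum _ _ _)); apply: ler_sum => k _.
    by rewrite normrM.
  apply: (@le_trans _ _ (\sum_k e / M * (1 + `|'D_(dir k) psi q|))).
    apply: ler_sum => k _; apply: ler_wpM2r; first by rewrite addr_ge0.
    by apply: le_trans (tl k) _; exact: ltW.
  rewrite -mulr_sumr -[leRHS](divfK (lt0r_neq0 M0)); apply: ler_wpM2l; first exact: ltW.
  by rewrite /M; lra.
rewrite distrC; apply: le_trans B.
rewrite -lerBlDl; apply: le_trans Hw.
by rewrite lerBlDl -[X in `|X| <= _](subrK (\sum_k (w - q) 0 k * 'D_(dir k) psi q)) addrC ler_normD.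
Qed.

Definition grad_dot (q v : 'rV[R]_4) : R := \sum_k v 0 k * 'D_(dir k) psi q.

Let cf u k : {for u, continuous (fun v => f v 0 k)}.
Proof. by have [H _ _] := Cf; exact: H. Qed.

Let cV u k : {for u, continuous (fun v => V v 0 k)}.
Proof. by have [H _ _] := CV; exact: H. Qed.

Let cff u : {for u, continuous f}.
Proof. by have [] := @sf [::] u I. Qed.

Let cDpsi u k : {for u, continuous (fun v => 'D_(dir k) psi (f v))}.
Proof.
apply: (@continuous_comp _ _ _ f ('D_(dir k) psi)); first exact: cff.
exact: cpsi.
Qed.

Lemma continuous_grad_dot u0 : {for u0, continuous (fun v => grad_dot (f v) (V v))}.
Proof.
have C : cong (nbhs u0) (fun=> 0) (grad_dot (f u0) (V u0))
    (fun v => grad_dot (f v) (V v)) (fun v => grad_dot (f v) (V v)).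
  apply: cong_sum => k; apply: congM; apply: cong_refl; first exact: cV.
  exact: cDpsi.
by have [H _ _] := C; exact: H.
Qed.

(** Strict differentiability of psi at f u0, applied to the displacement
    p - f = h V + o(h). *)
Lemma test_function_expansion u0 : cong (time_filter adm u0) fst (psi (f u0))
  (fun z => psi (p z.1 z.2)) (fun z => psi (f z.2) + z.1 * grad_dot (f z.2) (V z.2)).
Proof.
have cpf : {for u0, continuous (fun v => psi (f v))}.
  apply: (@continuous_comp _ _ _ f psi); first exact: cff.
  exact: psi_continuous.
have cg := @continuous_grad_dot u0.
have T k : cong (time_filter adm u0) fst 0 (fun z => (p z.1 z.2 - f z.2) 0 k)
    (fun z => z.1 * V z.2 0 k).
  apply: (cong_eq _ _ _ (congB (vcong_family (Hp u0) k) (cong_snd adm (@cf u0 k))))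
    => [|z|z]; rewrite ?subrr // !mxE //.
  by rewrite addrAC subrr add0r.
have [L1 _ _] := cong_time_linear adm cpf cg.
apply: cong_sym; apply: cong_small_diff; first exact: time_filter_fst.
  by move: L1; rewrite mul0r addr0.
apply: small_diff_sym.
have S1 : small_diff (time_filter adm u0) fst
    (fun z => psi (f z.2) + \sum_k (p z.1 z.2 - f z.2) 0 k * 'D_(dir k) psi (f z.2))
    (fun z => psi (f z.2) + z.1 * grad_dot (f z.2) (V z.2)).
  have -> : (fun z : E => psi (f z.2) + z.1 * grad_dot (f z.2) (V z.2)) =
      (fun z : E => psi (f z.2) + \sum_k (z.1 * V z.2 0 k) * 'D_(dir k) psi (f z.2)).
    apply/funext => z; congr (_ + _); rewrite mulr_sumr.
    by apply: eq_bigr => k _; rewrite mulrA.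
  have [_ _ S] := cong_sum (n := 4) (fun k => congM (T k) (cong_snd adm (@cDpsi u0 k))).
  by apply: small_diffD; [exact: small_diff_refl|exact: S].
apply: small_diff_trans S1 => e e0.
(* |p - f| is at most (|V u0| + 2) |h| entrywise: the 2 absorbs the variation of V
   near u0 and the o(h) error. *)
pose B : R := \sum_k (`|V u0 0 k| + 2).
have B0 : 0 <= B by apply: sumr_ge0 => k _; rewrite addr_ge0.
have B1 : 0 < B + 1 by lra.
have eB : 0 < e / (B + 1) by rewrite divr_gt0.
have [r r0 H] := strict_diff oU (fU u0) dpsi (fun k => @cpsi k _ (fU u0)) eB.
have N1 : \forall z \near time_filter adm u0, `|f u0 - f z.2| < r.
  have cn : {for u0, continuous (fun v => `|f u0 - f v|)}.
    apply: (@continuous_comp _ _ _ (fun v => f u0 - f v) Num.norm); last first.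
      exact: norm_continuous.
    by apply: cvgB; [exact: cvg_cst|exact: cff].
  have /cvgrPdist_lt/(_ _ r0) := @time_filter_snd R adm u0 _ cn.
  by apply: filterS => z; rewrite subrr normr0 sub0r normrN normr_id.
have N2 : \forall z \near time_filter adm u0, forall k, `|(p z.1 z.2 - f z.2) 0 k| < r.
  apply: filter_forall => k; have [/cvgrPdist_lt/(_ _ r0) L _ _] := T k.
  by apply: filterS L => z; rewrite sub0r normrN.
have N3 : \forall z \near time_filter adm u0,
    forall k, `|(p z.1 z.2 - f z.2) 0 k| <= (`|V u0 0 k| + 2) * `|z.1|.
  apply: filter_forall => k; have [_ _ /(_ _ ltr01) L] := T k.
  apply: filterS2 L (cvg_norm_le (@time_filter_snd R adm u0 _ (@cV u0 k))) => z.
  rewrite mul1r; set t := (p z.1 z.2 - f z.2) 0 k => h1 h2.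
  have -> : t = (t - z.1 * V z.2 0 k) + z.1 * V z.2 0 k by ring.
  apply: (le_trans (ler_normD _ _)).
  apply: (le_trans (lerD h1 (_ : _ <= `|z.1| * (`|V u0 0 k| + 1)))).
    by rewrite normrM; apply: ler_wpM2l.
  by rewrite le_eqVlt; apply/orP; left; apply/eqP; ring.
apply: filterS3 N1 N2 N3 => z n1 n2 n3.
have := H (f z.2) (fun k => (p z.1 z.2 - f z.2) 0 k) n1 n2.
rewrite -row_delta_sum subrK opprD addrA => HH; apply: (le_trans HH).
apply: (@le_trans _ _ (e / (B + 1) * (B * `|z.1|))).
  apply: ler_wpM2l; first exact: ltW.
  by rewrite mulr_suml; apply: ler_sum => k _; exact: n3.
rewrite mulrA; apply: ler_wpM2r; first exact: normr_ge0.
rewrite -[leRHS](divfK (lt0r_neq0 B1)); apply: ler_wpM2l; first exact: ltW.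
by lra.
Qed.

End test_function.
End area.
End first_variation.

(** * Young's inequality, derivatives from expansions, the unit sphere *)

Section real_lemmas.
Context (R : realType).

(** x z <= eta z^2 / 4 + x^2 / eta, for z = 1 and for z = y.  Below, x is the norm of
    the velocity, y that of the mean curvature, and a and b bound the test function and
    its gradient. *)
Lemma young_integrand (A B a b x y eta : R) : 0 <= a <= A -> 0 <= b <= B ->
  0 <= x -> 0 <= y -> 0 < eta ->
  x * (b + a * y) <= (A + B) * (eta * (1 + 4^-1 * y ^+ 2) + x ^+ 2 / eta).
Proof.
move=> /andP[a0 aA] /andP[b0 bB] x0 y0 eta0.
have i0 : 0 < eta^-1 by rewrite invr_gt0.
have sq (z : R) : x * z <= eta * (4^-1 * z ^+ 2) + x ^+ 2 / eta.
  have : 0 <= eta^-1 * (x - eta * z / 2) ^+ 2 by rewrite mulr_ge0 ?sqr_ge0 // ltW.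
  have -> : eta^-1 * (x - eta * z / 2) ^+ 2 =
      eta * (4^-1 * z ^+ 2) + x ^+ 2 / eta - x * z by field; rewrite gt_eqF.
  by rewrite subr_ge0.
have s1 := sq 1; have sy := sq y; rewrite mulr1 expr1n mulr1 in s1.
set K := eta * _ + _.
have K1 : x <= K.
  apply: (le_trans s1); rewrite /K lerD2r ler_pM2l //.
  by have := sqr_ge0 y; move: (y ^+ 2) => w w0; lra.
have K2 : x * y <= K.
  by apply: (le_trans sy); rewrite /K lerD2r ler_pM2l // lerDr.
have K0 : 0 <= K by apply: le_trans K1.
rewrite mulrDr mulrDl addrC; apply: lerD.
  by rewrite mulrCA; apply: ler_pM => //; apply: mulr_ge0.
by rewrite mulrC; apply: ler_pM.
Qed.

(** The best choice is eta = sqrt B / sqrt A; adding d > 0 to both roots keeps it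
    meaningful when A or B vanishes. *)
Lemma young_optimal (x N A B : R) : 0 <= N -> 0 <= A -> 0 <= B ->
  (forall eta, 0 < eta -> x <= N * (eta * A + B / eta)) ->
  x <= 2 * N * (Num.sqrt A * Num.sqrt B).
Proof.
move=> N0 A0 B0 H.
set a := Num.sqrt A; set b := Num.sqrt B.
have a0 : 0 <= a by exact: sqrtr_ge0.
have b0 : 0 <= b by exact: sqrtr_ge0.
have AE : A = a * a by rewrite -expr2 sqr_sqrtr.
have BE : B = b * b by rewrite -expr2 sqr_sqrtr.
apply/ler_addgt0Pr => e e0.
(* The error of the shifted eta is d N (a + b), made smaller than e. *)
pose M : R := N * (a + b) + 1.
have Nab : 0 <= N * (a + b) by rewrite mulr_ge0 // addr_ge0.
have M0 : 0 < M by rewrite /M; lra.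
pose d : R := e / M.
have d0 : 0 < d by rewrite divr_gt0.
have ad : 0 < a + d by lra.
have bd : 0 < b + d by lra.
have eta0 : 0 < (b + d) / (a + d) by rewrite divr_gt0.
apply: (le_trans (H _ eta0)).
have h1 : (b + d) / (a + d) * A <= (b + d) * a.
  rewrite AE mulrAC ler_pdivrMr // -mulrA; apply: ler_wpM2l; first exact: ltW.
  by apply: ler_wpM2l => //; lra.
have h2 : B / ((b + d) / (a + d)) <= b * (a + d).
  rewrite BE invf_div mulrA ler_pdivrMr //.
  rewrite -[leLHS]mulrA [leRHS]mulrAC -[leRHS]mulrA; apply: ler_wpM2l => //.
  by apply: ler_wpM2r; [exact: ltW|lra].
apply: (@le_trans _ _ (N * ((b + d) * a + b * (a + d)))).
  by apply: ler_wpM2l => //; exact: lerD.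
have -> : N * ((b + d) * a + b * (a + d)) = 2 * N * (a * b) + d * (N * (a + b)) by ring.
rewrite lerD2l /d mulrAC ler_pdivrMr //; apply: ler_wpM2l; first exact: ltW.
by rewrite /M; lra.
Qed.

Lemma expansion_is_derive (f : R -> R) (t d : R) :
  (forall e, 0 < e -> \forall h \near (0 : R), `|f (t + h) - (f t + h * d)| <= e * `|h|) ->
  is_derive t (1 : R) f d.
Proof.
move=> H.
have C : h^-1 *: ((f \o shift t) h%:A - f t) @[h --> (0 : R)^'] --> d.
  apply/cvgrPdist_le => e e0.
  have N0 : \forall h \near (0 : R)^', h != 0 by exact: nbhs_dnbhs_neq.
  have N1 : \forall h \near (0 : R)^', `|f (t + h) - (f t + h * d)| <= e * `|h|.
    by apply: cvg_within; exact: H.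
  apply: filterS2 N0 N1 => h h0 /=.
  rewrite [h%:A]mulr1 [h + t]addrC; move: (f (t + h)) (f t) => x y Hh.
  have -> : d - h^-1 *: (x - y) = - (h^-1 * (x - (y + h * d))).
    by rewrite /GRing.scale /=; field; exact: h0.
  by rewrite normrN normrM normfV ler_pdivrMl ?normr_gt0 // [leRHS]mulrC.
apply: DeriveDef; first by apply/cvg_ex; exists d.
by apply: cvg_lim.
Qed.

Lemma is_derive_expansion (f : R -> R) (t d : R) : is_derive t (1 : R) f d ->
  forall e, 0 < e -> \forall h \near (0 : R), `|f (t + h) - (f t + h * d)| <= e * `|h|.
Proof.
move=> [Df dE] e e0.
have C : h^-1 *: ((f \o shift t) h%:A - f t) @[h --> (0 : R)^'] --> d.
  by rewrite -dE; exact: Df.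
move/cvgrPdist_le : C => /(_ _ e0).
rewrite /dnbhs near_withinE; apply: filterS => h /= Hh.
have [->|h0] := eqVneq h 0; first by rewrite addr0 mul0r addr0 subrr normr0 mulr0.
have := Hh h0; rewrite [h%:A]mulr1 [h + t]addrC; move: (f (t + h)) (f t) => x y {}Hh.
have -> : x - (y + h * d) = - (h * (d - h^-1 *: (x - y))).
  by rewrite /GRing.scale /=; field; exact: h0.
by rewrite normrN normrM mulrC; apply: ler_wpM2r.
Qed.

Lemma derive_ge0_le (f df : R -> R) (a b : R) : a < b ->
  (forall x, a <= x <= b -> is_derive x (1 : R) f (df x)) ->
  (forall x, a <= x <= b -> 0 <= df x) -> f a <= f b.
Proof.
move=> ab D d0.
have C : {within `[a, b], continuous f}.
  apply: derivable_within_continuous => x; rewrite in_itv /= => xab.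
  by have [] := D x xab.
have D' x : x \in `]a, b[%R -> is_derive x (1 : R) f (df x).
  by rewrite in_itv /= => /andP[/ltW ? /ltW ?]; apply: D; apply/andP.
have [c] := MVT ab D' C; rewrite in_itv /= => /andP[/ltW ac /ltW cb] E.
rewrite -subr_ge0 E mulr_ge0 //; last by rewrite subr_ge0 ltW.
by apply: d0; apply/andP.
Qed.

End real_lemmas.

Section sphere.
Context (R : realType).

Lemma compact_S3 : compact (@S3 R).
Proof.
apply: bounded_closed_compact; last exact: closed_S3.
exists 1; split; first exact: num_real.
move=> M M1 q Sq; apply: le_trans (ltW M1).
rewrite [leLHS]/Num.Def.normr /= mx_normrE; apply: bigmax_le => // -[i k] _ /=.
rewrite (ord1 i) -(@ler_pXn2r _ 2) ?nnegrE // expr1n.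
rewrite -[leRHS]Sq /dot (bigD1 k) //= real_normK ?num_real // expr2 lerDl.
by apply: sumr_ge0 => j _; rewrite -expr2 sqr_ge0.
Qed.

Lemma S3_sup_ge (g : 'rV[R]_4 -> R) : (forall q, S3 q -> {for q, continuous g}) ->
  forall q, S3 q -> g q <= sup [set g q | q in @S3 R].
Proof.
move=> cg q Sq.
have cS : {within @S3 R, continuous g}.
  by apply: continuous_in_subspaceT => x; rewrite inE; exact: cg.
have [M [_ HM]] := compact_bounded (continuous_compact cS compact_S3).
apply: ub_le_sup; last by exists q.
exists (M + 1) => _ [x Sx <-].
have M1 : M < M + 1 by rewrite ltrDl.
by apply: le_trans (ler_norm _) _; apply: (HM _ M1); exists x.
Qed.

Lemma S3_neq0 (q : 'rV[R]_4) : S3 q -> q != 0.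
Proof.
move=> Sq; apply/eqP => q0; move: Sq; rewrite q0 /S3 /= dot0l => /esym/eqP.
by rewrite oner_eq0.
Qed.

Lemma to_S3_id (q : 'rV[R]_4) : S3 q -> to_S3 q = q.
Proof. by rewrite /S3 /= /to_S3 /enorm => ->; rewrite sqrtr1 invr1 scale1r. Qed.

Lemma open_neq0 : open [set q : 'rV[R]_4 | q != 0].
Proof.
have -> : [set q : 'rV[R]_4 | q != 0] = ~` [set 0].
  by apply/seteqP; split=> q /= /eqP.
apply: closed_openC; apply: accessible_closed_set1.
by apply: hausdorff_accessible; exact: norm_hausdorff.
Qed.

End sphere.

(** * The flow at one time *)

Section unit_square.
Context (R : realType) (Sigma : smooth_torus R).

Lemma torus_point_square (u : R * R) :
  exists v a : R * R, [/\ u = v + a, closed_square v &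
    forall w, torus_cover Sigma (w + a) = torus_cover Sigma w].
Proof.
have fl (x : R) : 0 <= x - (Num.floor x)%:~R <= 1.
  by have := floor_itv x; rewrite intrD => /andP[h1 h2]; apply/andP; split; lra.
exists (u.1 - (Num.floor u.1)%:~R, u.2 - (Num.floor u.2)%:~R).
exists ((Num.floor u.1)%:~R, (Num.floor u.2)%:~R); split.
- by case: u => x y; congr (_, _); rewrite /= subrK.
- by split; rewrite /= in_itv /=; exact: fl.
- move=> w; apply: esym; apply/torus_cover_eq.
  by exists (Num.floor u.1), (Num.floor u.2); case: w.
Qed.

(** The positivity extends from the square by periodicity. *)
Lemma det_metric_square (f : Sigma -> 'rV[R]_4) :
  (forall u, closed_square u -> 0 < \det (metric (periodic_lift f) u)) ->
  forall u, 0 < \det (metric (periodic_lift f) u).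
Proof.
move=> H u; have [v [a [-> Kv pa]]] := torus_point_square u.
have pl w : periodic_lift f (w + a) = periodic_lift f w.
  exact: (congr1 f (pa w)).
by rewrite (metric_periodic pl); exact: H.
Qed.

End unit_square.

Lemma smooth_familyS (R : realType) (adm adm' : set R) Phi f V u0 : adm `<=` adm' ->
  smooth_family adm' Phi f V u0 -> smooth_family adm Phi f V u0.
Proof.
move=> s [U [g [oU U0 Cg [H1 H2 H3]]]]; exists U, g; split=> //; split=> // t u /s.
exact: H1.
Qed.

Lemma ler_dist_trans (R : realFieldType) (a b c e s : R) :
  `|a - b| <= e / 2 * s -> `|b - c| <= e / 2 * s -> `|a - c| <= e * s.
Proof.
by rewrite !ler_norml => /andP[? ?] /andP[? ?]; apply/andP; split; nra.
Qed.

Lemma square_int_norm_le (R : realType) (a b : R * R -> R) :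
  continuous a -> continuous b ->
  (forall u, closed_square u -> `|a u| <= b u) -> `|square_int a| <= square_int b.
Proof.
move=> ca cb H; have cnb : continuous (fun u => -1 * b u).
  by move=> u; apply: cvgM; [exact: cvg_cst|exact: cb].
rewrite ler_norml; apply/andP; split.
  rewrite -mulN1r -(square_intZ _ cb); apply: square_int_le => // u /H.
  by rewrite ler_norml mulN1r => /andP[].
by apply: square_int_le => // u /H; rewrite ler_norml => /andP[].
Qed.

Section flow_step.
Context (R : realType) (Sigma : smooth_torus R) (T : \bar R).
Variables (F : R -> Sigma -> 'rV[R]_4) (t0 : R) (G : Sigma -> 'rV[R]_4).
Let f := F t0.
Hypothesis smF : smooth_on [set p : R * (R * R) | 0 <= p.1 /\ (p.1%:E < T)%E]
  (fun p : R * (R * R) => F p.1 (torus_cover Sigma p.2)).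
Hypothesis immF : forall t, 0 <= t -> (t%:E < T)%E -> immersion (F t) /\ umbilic_free (F t).
Hypothesis t00 : 0 <= t0.
Hypothesis t0T : (t0%:E < T)%E.
Hypothesis gradG : L2_gradient f G.
Hypothesis velF : forall x, time_derivative F t0 x (- (A0_sq f x ^- 2 *: G x)).

Definition velocity (x : Sigma) : 'rV[R]_4 := - (A0_sq f x ^- 2 *: G x).

Let pf := periodic_lift f.
Let pV := periodic_lift velocity.
Let adm : set R := admissible T t0.

Lemma lift_smooth t : 0 <= t -> (t%:E < T)%E -> smooth_open setT (periodic_lift (F t)).
Proof. by move=> h1 h2; have [[]] := immF h1 h2. Qed.

Lemma lift_det t : 0 <= t -> (t%:E < T)%E ->
  forall u, 0 < \det (metric (periodic_lift (F t)) u).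
Proof.
move=> h1 h2 u; have [[sm _ im] _] := immF h1 h2.
by apply: det_metric_gt0 => // v; exact: im.
Qed.

Lemma willmore_lift t : 0 <= t -> (t%:E < T)%E ->
  willmore (F t) = square_int (willmore_density (periodic_lift (F t))).
Proof.
move=> h1 h2; apply: willmoreE; last exact: lift_det.
by apply: smooth_C2map; exact: lift_smooth.
Qed.

Lemma willmore_ge0 t : 0 <= t -> (t%:E < T)%E -> 0 <= willmore (F t).
Proof.
move=> h1 h2; rewrite (willmore_lift h1 h2); apply: Rintegral_ge0 => u _.
apply: mulr_ge0; last exact: sqrtr_ge0.
by apply: addr_ge0 => //; apply: mulr_ge0; [rewrite invr_ge0|exact: dot_ge0].
Qed.

Let sf : smooth_open setT pf. Proof. exact: lift_smooth. Qed.
Let df u : 0 < \det (metric pf u). Proof. exact: lift_det. Qed.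

Let velF' u : h^-1 *: (F (t0 + h) (torus_cover Sigma u) - F t0 (torus_cover Sigma u))
  @[h --> within [set h | 0 <= t0 + h] (0 : R)^'] --> pV u.
Proof. exact: velF. Qed.

Let sV : smooth_open setT pV.
Proof.
exact: (@smooth_velocity R T (fun t u => F t (torus_cover Sigma u)) t0 smF t00 t0T pV velF').
Qed.

Let family u : smooth_family adm (fun h => periodic_lift (F (t0 + h))) pf pV u.
Proof.
exact: (@flow_family R T (fun t u => F t (torus_cover Sigma u)) t0 smF t00 t0T pV velF').
Qed.

Let ff u : dot (pf u) (pf u) = 1.
Proof. by have [[_ S _] _] := immF t00 t0T; exact: S. Qed.

Let Vf u : dot (pV u) (pf u) = 0.
Proof.
have [[_ N] _] := gradG; have [N1 _] := N u.
by rewrite /pV /periodic_lift /= /velocity dotNl dotZl N1 mulr0 oppr0.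
Qed.

Let VDf u v : dot (pV u) ('D_v pf u) = 0.
Proof.
have [[_ N] _] := gradG; have [_ N1] := N u.
by rewrite /pV /periodic_lift /= /velocity dotNl dotZl N1 mulr0 oppr0.
Qed.

Let normalV : normal_field f velocity.
Proof. by split=> // u; split=> [|v]; [exact: Vf|exact: VDf]. Qed.

Let adm0 : adm 0. Proof. by rewrite /adm /admissible /= addr0. Qed.

Let adm_in h : adm h -> 0 <= t0 + h /\ ((t0 + h)%:E < T)%E. Proof. by []. Qed.

Let varfam u : smooth_family adm (fun e => periodic_lift (Defs.variation f velocity e)) pf pV u.
Proof.
apply: (smooth_familyS (@subsetT _ adm)).
exact: (variation_family sf sV ff Vf u).
Qed.

Let var_C2 e : C2map (periodic_lift (Defs.variation f velocity e)).
Proof. exact: (slice_C2map e (variation_CkV sf sV ff Vf)). Qed.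

(** Both families start at f with the same velocity, so their Willmore integrands agree
    up to o(h), uniformly over the square. *)
Lemma willmore_variation_small_diff : small_diff (within adm (nbhs (0 : R))) id
  (fun h => willmore (F (t0 + h))) (fun h => willmore (Defs.variation f velocity h)).
Proof.
have N0 : \forall h \near within adm (nbhs (0 : R)), adm h by exact: withinT.
have N1 : \forall h \near within adm (nbhs (0 : R)),
    forall u, 0 < \det (metric (periodic_lift (Defs.variation f velocity h)) u).
  by apply: filterS (det_family_near varfam df) => h; exact: det_metric_square.
have S : small_diff (within adm (nbhs (0 : R))) id
    (fun h => square_int (willmore_density (periodic_lift (F (t0 + h)))))
    (fun h => square_int (willmore_density (periodic_lift (Defs.variation f velocity h)))).
  apply: square_int_small_diff.
  - apply: filterS N0 => h /adm_in[h1 h2].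
    apply: continuous_willmore_density; last exact: lift_det.
    by apply: smooth_C2map; exact: lift_smooth.
  - by apply: filterS N1 => h hd; apply: continuous_willmore_density.
  - by move=> u _; have [] := willmore_family_cong (family u) (varfam u) (df u).
move=> e e0; apply: filterS3 N0 N1 (S e e0) => h /adm_in[h1 h2] hd.
by rewrite (willmore_lift h1 h2) (willmoreE (var_C2 h) hd).
Qed.

Definition energy_rate : R := surface_int f (fun x => dot (G x) (velocity x)).

(** The definition of the gradient differentiates the energy along the normal variation;
    the flow has the same energy up to o(h). *)
Lemma willmore_expansion e : 0 < e ->
  \forall h \near within adm (nbhs (0 : R)),
    `|willmore (F (t0 + h)) - (willmore f + h * energy_rate)| <= e * `|h|.
Proof.
move=> e0; have e2 : 0 < e / 2 by rewrite divr_gt0.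
have [_ /(_ velocity normalV) D] := gradG.
have X := is_derive_expansion D e2.
have W0 : willmore (Defs.variation f velocity 0) = willmore f.
  have := willmore_variation_small_diff ltr01.
  move/nbhs_singleton => /(_ adm0); rewrite addr0 normr0 mulr0 normr_le0 subr_eq0.
  by move/eqP => E; exact: esym E.
have X' : \forall h \near within adm (nbhs (0 : R)),
    `|willmore (Defs.variation f velocity h) - (willmore f + h * energy_rate)| <= e / 2 * `|h|.
  by apply: cvg_within; apply: filterS X => h; rewrite add0r W0.
apply: filterS2 X' (willmore_variation_small_diff e2) => h h1 h2.
exact: ler_dist_trans h2 h1.
Qed.

Section test.
Variable phi : 'rV[R]_4 -> R.
Hypothesis Cphi : C1_S3 phi.
Let psi := homog_ext phi.
Let U : set 'rV[R]_4 := [set q | q != 0].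

Let psiE q : S3 q -> phi q = psi q.
Proof. by move=> Sq; rewrite /psi /homog_ext /= to_S3_id. Qed.

Let dpsi (k : 'I_4) q : U q -> derivable psi q (delta_mx 0 k).
Proof. by move=> Uq; have [] := Cphi (delta_mx 0 k) Uq. Qed.

Let cDpsi (k : 'I_4) q : U q -> {for q, continuous ('D_(delta_mx 0 k) psi)}.
Proof. by move=> Uq; have [] := Cphi (delta_mx 0 k) Uq. Qed.

Let cpsi q : U q -> {for q, continuous psi}.
Proof. exact: (psi_continuous (@open_neq0 R) dpsi cDpsi). Qed.

Let lift_S3 t : 0 <= t -> (t%:E < T)%E -> forall u, S3 (periodic_lift (F t) u).
Proof. by move=> h1 h2 u; have [[_ S _] _] := immF h1 h2; exact: S. Qed.

Let mass t u := psi (periodic_lift (F t) u) * area_density (periodic_lift (F t)) u.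

Let mass_continuous t : 0 <= t -> (t%:E < T)%E -> continuous (mass t).
Proof.
move=> h1 h2 u; apply: cvgM; last first.
  by apply: continuous_area_density; apply: smooth_C2map; exact: lift_smooth.
apply: (@continuous_comp _ _ _ (periodic_lift (F t)) psi).
  by have [] := @lift_smooth t h1 h2 [::] u I.
by apply: cpsi; apply: S3_neq0; exact: lift_S3.
Qed.

Let sphere_lift t : 0 <= t -> (t%:E < T)%E -> sphere_int (F t) phi = square_int (mass t).
Proof.
move=> h1 h2; have [[sm S _] _] := immF h1 h2.
rewrite (sphere_intE sm S (@open_neq0 R) (@S3_neq0 R) cpsi psiE).
apply: (congr1 (@square_int R)); apply/funext => u.
by rewrite /mass -psiE //; exact: lift_S3.
Qed.

Let rate_density u : R :=
  psi (pf u) * (- dot (mean_curv pf u) (pV u) * area_density pf u) +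
  grad_dot psi (pf u) (pV u) * area_density pf u.

Let cdens : continuous (area_density pf).
Proof. by apply: continuous_area_density; exact: smooth_C2map. Qed.

Let cpsif u : {for u, continuous (fun v => psi (pf v))}.
Proof.
apply: (@continuous_comp _ _ _ pf psi); first by have [] := @sf [::] u I.
by apply: cpsi; apply: S3_neq0; exact: ff.
Qed.

Let cHV u : {for u, continuous (fun v => - dot (mean_curv pf v) (pV v))}.
Proof.
apply: cvgN; apply: continuous_dot => k.
  by apply: continuous_mean_curv => //; exact: smooth_C2map.
by have [H _ _] := smooth_C2map sV; exact: H.
Qed.

Let cgrad u : {for u, continuous (fun v => grad_dot psi (pf v) (pV v))}.
Proof.
have fU v : U (pf v) by apply: S3_neq0; exact: ff.
exact: (continuous_grad_dot sf sV fU cDpsi).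
Qed.

Let crate : continuous rate_density.
Proof.
move=> u; apply: cvgD; apply: cvgM.
- exact: cpsif.
- by apply: cvgM; [exact: cHV|exact: cdens].
- exact: cgrad.
- exact: cdens.
Qed.

Definition sphere_rate : R := square_int rate_density.

(** Product of the expansions of the test function and of the area density. *)
Lemma sphere_expansion e : 0 < e ->
  \forall h \near within adm (nbhs (0 : R)),
    `|sphere_int (F (t0 + h)) phi - (sphere_int f phi + h * sphere_rate)| <= e * `|h|.
Proof.
move=> e0.
have N0 : \forall h \near within adm (nbhs (0 : R)), adm h by exact: withinT.
have cb h : continuous (fun u => mass t0 u + h * rate_density u).
  move=> u; apply: cvgD; first exact: mass_continuous.
  by apply: cvgM; [exact: cvg_cst|exact: crate].
have S : small_diff (within adm (nbhs (0 : R))) id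
    (fun h => square_int (mass (t0 + h)))
    (fun h => square_int (fun u => mass t0 u + h * rate_density u)).
  apply: square_int_small_diff.
  - by apply: filterS N0 => h /adm_in[h1 h2]; exact: mass_continuous.
  - by apply: filterS N0 => h _; exact: cb.
  - move=> u _.
    have fU v : U (pf v) by apply: S3_neq0; exact: ff.
    have normal i v : dot (pV v) (partial i pf v) = 0 by exact: VDf.
    have A := area_density_expansion family sf sV df Vf (fun v i => normal i v) u.
    have P := test_function_expansion family sf sV (@open_neq0 R) fU dpsi cDpsi u.
    have [_ _] := time_linearM (@cpsif u) (@cgrad u) (@cdens u)
      (cvgM (@cHV u) (@cdens u)) P A.
    by [].
have S' := S e e0.
apply: filterS2 N0 S' => h /adm_in[h1 h2].
rewrite -(sphere_lift h1 h2) square_intD; last 2 first.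
- exact: mass_continuous.
- by move=> u; apply: cvgM; [exact: cvg_cst|exact: crate].
by rewrite square_intZ -?(sphere_lift t00 t0T).
Qed.

Let energy_density u := dot (pV u) (pV u) * area_density pf u.

Let cVV u : {for u, continuous (fun v => dot (pV v) (pV v))}.
Proof.
by apply: continuous_dot => k; have [H _ _] := smooth_C2map sV; exact: H.
Qed.

Let cenergy : continuous energy_density.
Proof. by move=> u; apply: cvgM; [exact: cVV|exact: cdens]. Qed.

Let dens_ge0 u : 0 <= area_density pf u. Proof. exact: sqrtr_ge0. Qed.

Lemma dot_gradient x : dot (G x) (velocity x) =
  - (A0_sq f x ^+ 2 * dot (velocity x) (velocity x)).
Proof.
have [_ umb] := immF t00 t0T.
have A0 : A0_sq f x ^+ 2 != 0 by rewrite expf_neq0 //; exact: umb.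
have E : G x = - (A0_sq f x ^+ 2 *: velocity x).
  by rewrite /velocity scalerN opprK scalerA mulfV // scale1r.
by rewrite {1}E dotNl dotZl.
Qed.

(** <G, V> = - |A0|^4 |V|^2, and A0_sq is the square of |A0|. *)
Lemma energy_rate_le (c0 : R) : 0 <= c0 -> (forall x, c0 <= A0_sq f x) ->
  energy_rate <= - (c0 ^+ 2 * square_int energy_density).
Proof.
move=> c00 H.
have [[sG _] _] := gradG.
have cGV : continuous ((fun x => dot (G x) (velocity x)) \o torus_cover Sigma).
  move=> u; apply: (continuous_dot (a := periodic_lift G) (b := pV)) => k.
    by have [C _ _] := smooth_C2map sG; exact: C.
  by have [C _ _] := smooth_C2map sV; exact: C.
rewrite /energy_rate (surface_intE (smooth_C2map sf) cGV).
rewrite -mulNr -square_intZ //; apply: square_int_le.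
- by move=> u; apply: cvgM; [exact: cGV|exact: cdens].
- by move=> u; apply: cvgM; [exact: cvg_cst|exact: cenergy].
move=> u _; rewrite dot_gradient /energy_density mulrA; apply: ler_wpM2r.
  exact: dens_ge0.
rewrite mulNr lerN2; apply: ler_wpM2r; first exact: dot_ge0.
by rewrite ler_pXn2r ?nnegrE // (le_trans c00).
Qed.

Let supE (g h : 'rV[R]_4 -> R) : (forall q, S3 q -> g q = h q) ->
  [set g q | q in @S3 R] = [set h q | q in @S3 R].
Proof.
by move=> gh; apply/seteqP; split=> _ [q Sq <-]; exists q => //; rewrite gh.
Qed.

Let sup_phi q : S3 q -> `|psi q| <= sup [set `|phi p| | p in @S3 R].
Proof.
move=> Sq; rewrite (supE (g := fun p => `|phi p|) (h := fun p => `|psi p|)); last first.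
  by move=> p Sp; rewrite psiE.
apply: (S3_sup_ge (g := fun p => `|psi p|)) => // p Sp.
apply: (@continuous_comp _ _ _ psi Num.norm); first by apply: cpsi; exact: S3_neq0.
exact: norm_continuous.
Qed.

Let sup_grad q : S3 q -> enorm (grad_S3 phi q) <= sup [set enorm (grad_S3 phi p) | p in @S3 R].
Proof.
apply: S3_sup_ge => p Sp.
apply: (@continuous_comp _ _ _ (fun q => dot (grad_S3 phi q) (grad_S3 phi q)) Num.sqrt).
  have C k : {for p, continuous (fun q => grad_S3 phi q 0 k)}.
    have -> : (fun q => grad_S3 phi q 0 k) = 'D_(delta_mx 0 k) psi.
      by apply/funext => q'; rewrite mxE.
    by apply: cDpsi; exact: S3_neq0.
  exact: continuous_dot.
exact: sqrt_continuous.
Qed.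

Let grad_dotE q v : grad_dot psi q v = dot v (grad_S3 phi q).
Proof. by apply: eq_bigr => k _; rewrite mxE. Qed.

Let rate_density_le eta u : 0 < eta ->
  `|rate_density u| <= C1_norm phi *
    (eta * willmore_density pf u + eta^-1 * energy_density u).
Proof.
move=> eta0; rewrite /rate_density mulrA -mulrDl normrM (ger0_norm (dens_ge0 u)).
have -> : C1_norm phi * (eta * willmore_density pf u + eta^-1 * energy_density u) =
    C1_norm phi * (eta * (1 + 4^-1 * dot (mean_curv pf u) (mean_curv pf u)) +
      dot (pV u) (pV u) / eta) * area_density pf u.
  by rewrite /willmore_density /energy_density; ring.
apply: ler_wpM2r; first exact: dens_ge0.
set H := mean_curv pf u; set v := pV u; set q := pf u.
have Sq : S3 q by exact: ff.
have Y := @young_integrand R (sup [set `|phi p| | p in @S3 R])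
  (sup [set enorm (grad_S3 phi p) | p in @S3 R])
  `|psi q| (enorm (grad_S3 phi q)) (enorm v) (enorm H) eta.
rewrite -!enorm_sqr; apply: le_trans (Y _ _ _ _ eta0).
- rewrite grad_dotE addrC mulrDr; apply: (le_trans (ler_normD _ _)); apply: lerD.
    exact: dot_cauchy.
  rewrite normrM normrN mulrCA; apply: ler_wpM2l; first exact: normr_ge0.
  by rewrite [leRHS]mulrC; exact: dot_cauchy.
- by rewrite normr_ge0 sup_phi.
- by rewrite enorm_ge0 sup_grad.
- exact: enorm_ge0.
- exact: enorm_ge0.
Qed.

Lemma C1_norm_ge0 : 0 <= C1_norm phi.
Proof.
have Sq : S3 (pf (0, 0)) by exact: ff.
apply: addr_ge0; first exact: le_trans (normr_ge0 _) (sup_phi Sq).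
exact: le_trans (enorm_ge0 _) (sup_grad Sq).
Qed.

(** Young's inequality under the integral, then energy_rate_le to bound the integral
    of |V|^2. *)
Lemma sphere_rate_le (c0 eta : R) : 0 < c0 -> (forall x, c0 <= A0_sq f x) -> 0 < eta ->
  `|sphere_rate| <=
    C1_norm phi * (eta * willmore f + - energy_rate / c0 ^+ 2 / eta).
Proof.
move=> c00 H eta0.
have cW : continuous (willmore_density pf).
  by apply: continuous_willmore_density => //; exact: smooth_C2map.
have cb : continuous (fun u => eta * willmore_density pf u + eta^-1 * energy_density u).
  move=> u; apply: cvgD; apply: cvgM; [exact: cvg_cst|exact: cW|exact: cvg_cst|].
  exact: cenergy.
have cb' : continuous (fun u => C1_norm phi *
    (eta * willmore_density pf u + eta^-1 * energy_density u)).
  by move=> u; apply: cvgM; [exact: cvg_cst|exact: cb].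
have := square_int_norm_le crate cb' (fun u _ => rate_density_le u eta0).
have cW' : continuous (fun u => eta * willmore_density pf u).
  by move=> u; apply: cvgM; [exact: cvg_cst|exact: cW].
have cE' : continuous (fun u => eta^-1 * energy_density u).
  by move=> u; apply: cvgM; [exact: cvg_cst|exact: cenergy].
rewrite (square_intZ _ cb) (square_intD cW' cE') (square_intZ _ cW) (square_intZ _ cenergy) -(willmore_lift t00 t0T).
move=> HH; apply: (le_trans HH); apply: ler_wpM2l; first exact: C1_norm_ge0.
rewrite lerD2l [leRHS]mulrC; apply: ler_wpM2l; first by rewrite invr_ge0 ltW.
rewrite ler_pdivlMr ?exprn_gt0 // lerNr mulrC.
exact: energy_rate_le (ltW c00) H.
Qed.

End test.
End flow_step.

(** * The estimate *)

Lemma is_derive_affine_comb (R : realType) (f g : R -> R) (x a b c f' g' : R) :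
  is_derive x (1 : R) f f' -> is_derive x (1 : R) g g' ->
  is_derive x (1 : R) (fun y => a * y + b * f y + c * g y) (a + b * f' + c * g').
Proof.
move=> Hf Hg.
have -> : (fun y => a * y + b * f y + c * g y) =
    (a \*: (id : R -> R) + b \*: f) + c \*: g by [].
have D := is_deriveD (is_deriveD (is_deriveZ a (is_derive_id x (1 : R)))
  (is_deriveZ b Hf)) (is_deriveZ c Hg).
by apply: (is_derive_eq D); rewrite [a *: _]mulr1.
Qed.

(** For every eta the function N (eta W0 r - W r / (c^2 eta)) - k I r is nondecreasing
    in r when k is 1 or -1; compare its values at s and t, then optimise eta. *)
Lemma dissipation_estimate (R : realType) (W I : R -> R) (s t c N W0 : R) :
  s < t -> 0 < c -> 0 <= N -> 0 <= W0 -> W t <= W s ->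
  (forall r, s <= r -> r <= t -> exists w i : R,
    [/\ is_derive r (1 : R) W w, is_derive r (1 : R) I i, W r <= W0 &
     forall eta, 0 < eta -> `|i| <= N * (eta * W r + - w / c ^+ 2 / eta)]) ->
  `|I t - I s| <= 2 * Num.sqrt W0 / c * N * Num.sqrt ((t - s) * (W s - W t)).
Proof.
move=> st c_gt0 N0 W00 Wst Hrate.
have ts0 : 0 < t - s by rewrite subr_gt0.
have c2 : 0 < c ^+ 2 by rewrite exprn_gt0.
have dW0 : 0 <= W s - W t by rewrite subr_ge0.
have -> : 2 * Num.sqrt W0 / c * N * Num.sqrt ((t - s) * (W s - W t)) =
    2 * N * (Num.sqrt (W0 * (t - s)) * Num.sqrt ((W s - W t) / c ^+ 2)).
  rewrite !sqrtrM ?(ltW ts0) // sqrtrV ?(ltW c2) // sqrtr_sqr gtr0_norm //.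
  by field; rewrite gt_eqF.
apply: young_optimal => //.
- by rewrite mulr_ge0 // ltW.
- by rewrite divr_ge0 // ltW.
move=> eta eta0.
have key (k : R) : `|k| = 1 -> k * (I t - I s) <=
    N * (eta * (W0 * (t - s)) + (W s - W t) / c ^+ 2 / eta).
  move=> k1.
  pose a : R := N * (eta * W0).
  pose b : R := - (N / c ^+ 2 / eta).
  (* k = 1 and k = -1 give the two bounds of the absolute value. *)
  pose Phi r := a * r + b * W r + (- k) * I r.
  have R1 (r : R) : exists d : R, s <= r <= t -> is_derive r (1 : R) Phi d /\ 0 <= d.
    have [/andP[sr rt]|nr] := boolP (s <= r <= t); last by exists 0.
    have [w [i [Dw Di WrW0 H]]] := Hrate r sr rt.
    exists (a + b * w + (- k) * i) => _; split.
      exact: is_derive_affine_comb Dw Di.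
    have ki : k * i <= `|i|.
      by apply: le_trans (ler_norm _) _; rewrite normrM k1 mul1r.
    have {}H := H eta eta0.
    have WW : N * (eta * W r) <= a.
      by apply: ler_wpM2l => //; apply: ler_wpM2l => //; exact: ltW.
    have E : N * (eta * W r + - w / c ^+ 2 / eta) = N * (eta * W r) + b * w.
      by rewrite /b; ring.
    rewrite E in H.
    rewrite (mulNr k i) subr_ge0; apply: (le_trans ki); apply: (le_trans H).
    by rewrite lerD2r.
  have [d Hd] := choice R1.
  have := @derive_ge0_le R Phi d s t st (fun r rst => (Hd r rst).1)
    (fun r rst => (Hd r rst).2).
  rewrite -subr_ge0 => H1; rewrite -subr_ge0; move: H1; congr (0 <= _).
  by rewrite /Phi /a /b; field; rewrite !gt_eqF.
rewrite ler_norml lerNl; apply/andP; split.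
  by rewrite -mulN1r; apply: key; rewrite normrN1.
by rewrite -[leLHS]mul1r; apply: key; rewrite normr1.
Qed.

Lemma C1_S3_cst (R : realType) : C1_S3 (fun=> 0 : R).
Proof.
move=> p v _; rewrite /homog_ext; split; first exact: derivable_cst.
have -> : 'D_v ((fun=> 0 : R) \o @to_S3 R) = cst 0.
  by apply/funext => q; exact: derive_cst.
exact: cst_continuous.
Qed.

Section estimate.
Context (R : realType) (Sigma : smooth_torus R) (T : \bar R).
Variables (F : R -> Sigma -> 'rV[R]_4) (c0 : R).
Hypothesis hF : MIWF T F.
Hypothesis c0_gt0 : 0 < c0.
Hypothesis A0_ge : forall (t : R) x, 0 < t -> (t%:E < T)%E -> c0 <= A0_sq (F t) x.

(** At an interior time all small h are admissible. *)
Lemma interior_expansion (f : R -> R) t d : 0 < t -> (t%:E < T)%E ->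
  (forall e, 0 < e -> \forall h \near within (admissible T t) (nbhs (0 : R)),
    `|f (t + h) - (f t + h * d)| <= e * `|h|) ->
  is_derive t (1 : R) f d.
Proof.
move=> t0 tT H; apply: expansion_is_derive => e e0.
have N1 : \forall h \near (0 : R), 0 <= t + h.
  apply: (norm_nbhs t0) => h; rewrite sub0r normrN ltr_norml => /andP[h1 _].
  by rewrite -lerBlDl sub0r ltW.
by apply: filterS3 N1 (admissible_near tT) (H e e0) => h h1 h2; apply.
Qed.

Lemma willmore_rate t : 0 <= t -> (t%:E < T)%E -> exists w : R,
  forall e, 0 < e -> \forall h \near within (admissible T t) (nbhs (0 : R)),
    `|willmore (F (t + h)) - (willmore (F t) + h * w)| <= e * `|h|.
Proof.
move=> t0 tT; have [smF immF [G HG]] := hF.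
have [gradG velF] := HG t t0 tT.
by exists (energy_rate F t (G t)); exact: willmore_expansion.
Qed.

Lemma rates t phi : 0 < t -> (t%:E < T)%E -> C1_S3 phi -> exists w i : R,
  [/\ is_derive t (1 : R) (fun s => willmore (F s)) w,
      is_derive t (1 : R) (fun s => sphere_int (F s) phi) i,
      w <= 0, 0 <= C1_norm phi &
      forall eta, 0 < eta -> `|i| <=
        C1_norm phi * (eta * willmore (F t) + - w / c0 ^+ 2 / eta)].
Proof.
move=> t0 tT Cphi; have [smF immF [G HG]] := hF.
have t0' := ltW t0; have [gradG velF] := HG t t0' tT.
have A0 x : c0 <= A0_sq (F t) x by exact: A0_ge.
exists (energy_rate F t (G t)), (sphere_rate F t (G t) phi); split.
- apply: interior_expansion => // e e0.
  exact: (willmore_expansion smF immF t0' tT gradG velF e0).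
- apply: interior_expansion => // e e0.
  exact: (sphere_expansion smF immF t0' tT gradG velF Cphi e0).
- have A00 x : 0 <= A0_sq (F t) x by exact: le_trans (ltW c0_gt0) (A0 x).
  have := energy_rate_le smF immF t0' tT gradG velF (lexx 0) A00.
  by rewrite expr0n mul0r oppr0.
- exact: (C1_norm_ge0 immF t0' tT Cphi).
- by move=> eta eta0; exact: (sphere_rate_le smF immF t0' tT gradG velF Cphi c0_gt0 A0 eta0).
Qed.

Lemma willmore_le (s t : R) : 0 < s -> s < t -> (t%:E < T)%E ->
  willmore (F t) <= willmore (F s).
Proof.
move=> s0 st tT.
have R1 (r : R) : exists w : R, s <= r <= t ->
    is_derive r (1 : R) (fun y => - willmore (F y)) w /\ 0 <= w.
  have [/andP[sr rt]|nr] := boolP (s <= r <= t); last by exists 0.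
  have rT : (r%:E < T)%E by apply: le_lt_trans tT; rewrite lee_fin.
  (* Only the energy matters here, so any test function will do. *)
  have [w [i [D _ w0 _ _]]] := rates (lt_le_trans s0 sr) rT (@C1_S3_cst R).
  exists (- w) => _; split; last by rewrite oppr_ge0.
  exact: is_deriveN D.
have [dW HW] := choice R1.
rewrite -lerN2.
apply: (@derive_ge0_le R (fun y => - willmore (F y)) dW s t st) => r /HW[] //.
Qed.

(** The energy decreases at positive times, and its expansion at time 0 shows that it is
    right-continuous there. *)
Lemma willmore_le0 (t : R) : 0 < t -> (t%:E < T)%E -> willmore (F t) <= willmore (F 0).
Proof.
move=> t0 tT.
have T0 : ((0 : R)%:E < T)%E by apply: lt_trans tT; rewrite lte_fin.
have [w Hw] := willmore_rate (lexx 0) T0.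
apply/ler_addgt0Pr => e e0.
pose K : R := 1 + `|w|.
have K0 : 0 < K by rewrite /K ltr_pwDl.
have N1 := Hw 1 ltr01.
have N2 : \forall h \near within (admissible T 0) (nbhs (0 : R)), `|h| < e / K.
  apply: cvg_within.
  have eK : 0 < e / K by rewrite divr_gt0.
  by apply: (norm_nbhs eK) => h; rewrite sub0r normrN.
have N : \forall h \near within (admissible T 0) (nbhs (0 : R)),
    `|willmore (F (0 + h)) - (willmore (F 0) + h * w)| <= 1 * `|h| /\ `|h| < e / K.
  exact: filterI N1 N2.
have [r r0 Hr] := nbhs_ex_norm N.
pose h := Num.min (r / 2) (t / 2).
have r2 : 0 < r / 2 by rewrite divr_gt0.
have t2 : 0 < t / 2 by rewrite divr_gt0.
have h0 : 0 < h by rewrite lt_min r2.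
have ht : h < t.
  by apply: (@le_lt_trans _ _ (t / 2)); [rewrite ge_min lexx orbT|rewrite ltr_pdivrMr // ltr_pMr // ltr1n].
have hr : `|0 - h| < r.
  rewrite sub0r normrN gtr0_norm //.
  by apply: (@le_lt_trans _ _ (r / 2)); [rewrite ge_min lexx|rewrite ltr_pdivrMr // ltr_pMr // ltr1n].
have ha : admissible T 0 h.
  split; rewrite add0r; first exact: ltW.
  by apply: lt_trans tT; rewrite lte_fin.
have [] := Hr h hr ha; rewrite add0r mul1r (gtr0_norm h0) => H1 H2.
have W1 := willmore_le h0 ht tT.
apply: (le_trans W1).
have hK : h * K <= e by rewrite -ler_pdivlMr // ltW.
rewrite /K mulrDr mulr1 in hK.
have hw : h * w <= h * `|w| by apply: ler_wpM2l; [exact: ltW|exact: ler_norm].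
move: H1; rewrite ler_norml => /andP[_]; rewrite lerBlDl => H1.
apply: (le_trans H1); rewrite -addrA; apply: lerD; first exact: lexx.
apply: le_trans hK; rewrite addrC; apply: lerD; first exact: lexx.
exact: hw.
Qed.

Lemma sphere_int_bound (s t : R) phi : 0 < s -> s < t -> (t%:E < T)%E -> C1_S3 phi ->
  `|sphere_int (F t) phi - sphere_int (F s) phi| <=
    2 * Num.sqrt (willmore (F 0)) / c0 * C1_norm phi *
    Num.sqrt ((t - s) * (willmore (F s) - willmore (F t))).
Proof.
move=> s0 st tT Cphi.
have t0 := lt_trans s0 st.
have T0 : ((0 : R)%:E < T)%E by apply: lt_trans tT; rewrite lte_fin.
have W0 : 0 <= willmore (F 0).
  by have [_ immF _] := hF; exact: (willmore_ge0 immF (lexx 0) T0).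
have [_ [_ [_ _ _ N0 _]]] := rates t0 tT Cphi.
apply: (dissipation_estimate (W := fun r => willmore (F r))
  (I := fun r => sphere_int (F r) phi) st c0_gt0 N0 W0 (willmore_le s0 st tT)).
move=> r sr rt; have r0 := lt_le_trans s0 sr.
have rT : (r%:E < T)%E by apply: le_lt_trans tT; rewrite lee_fin.
have [w [i [Dw Di _ _ H]]] := rates r0 rT Cphi.
by exists w, i; split; [exact: Dw|exact: Di|exact: willmore_le0|exact: H].
Qed.

End estimate.

Theorem proposition3p4 (R : realType) (Sigma : smooth_torus R) (T : \bar R)
    (F : R -> Sigma -> 'rV[R]_4) (c0 : R)
    (hT : (0 < T)%E) (hF : MIWF T F) (hc0 : 0 < c0)
    (hA0 : (c0%:E <= ereal_inf
              [set ereal_inf [set (A0_sq (F t) x)%:E | x in [set: Sigma]] |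
                 t in [set t : R | (0 < t)%R /\ t%:E < T]])%E)
    (s t : R) (hs : 0 < s) (hst : s < t) (ht : (t%:E < T)%E)
    (phi : 'rV[R]_4 -> R) (hphi : C1_S3 phi) :
  `|sphere_int (F t) phi - sphere_int (F s) phi| <=
    2 * Num.sqrt (willmore (F 0)) / c0 * C1_norm phi *
    Num.sqrt ((t - s) * (willmore (F s) - willmore (F t))).
Proof.
have A0 r x : 0 < r -> (r%:E < T)%E -> c0 <= A0_sq (F r) x.
  move=> r0 rT; rewrite -lee_fin; apply: (le_trans hA0).
  apply: (@le_trans _ _ (ereal_inf [set (A0_sq (F r) x)%:E | x in [set: Sigma]])).
    by apply: ereal_inf_lbound; exists r.
  by apply: ereal_inf_lbound; exists x.
exact: (sphere_int_bound hF hc0 A0 hs hst ht hphi).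
Qed.
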